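(* Let $\mathbf{x}^{(t)}\in\mathbf{R}^d$, $t\in\mathbf{Z}$, satisfy the vector autoregression $\mathbf{x}^{(t)}=\sum_{j=1}^p\mathbf{A}^{(j)}\mathbf{x}^{(t-j)}+\boldsymbol\epsilon^{(t)}$ with $\mathbf{A}^{(j)}\in\mathbf{R}^{d\times d}$ and white noise innovations: $\mathbf{E}\boldsymbol\epsilon^{(t)}=0$, $\mathbf{E}\boldsymbol\epsilon^{(t)}\boldsymbol\epsilon^{(t)\top}=\boldsymbol\Sigma_{\boldsymbol\epsilon}$ for all $t$, $\mathbf{E}\boldsymbol\epsilon^{(t_1)}\boldsymbol\epsilon^{(t_2)\top}=0$ for $t_1\ne t_2$. The vectors $\mathbf{x}^{(t)}$, $t=1,\dots,T$, are observed. Let $\mathbf{W},\mathbf{S},\mathbf{y}^{(l)},\boldsymbol\eta^{(l)},\mathbf{z}^{(t)},\mathbf{S}^\dagger,\boldsymbol\Sigma^{(0)},\mathcal{B}_l,\widetilde{\mathbf{S}},\widetilde{\mathcal{B}}_l,\mathcal{F}_{\mathcal B}(\cdot),\boldsymbol\Lambda^{(l_1,l_2)}$ be as defined in the context. Assume: (1) $\mathbf{x}^{(t)},t\in\mathbf{Z}$, are $(m,\alpha)$-short range dependent with constants $m>8$, $\alpha>1$; $p=O(1)$; $d=O(T^{\alpha_d})$ with a constant $0\le\alpha_d<\frac{m\alpha}{2+24\alpha}$. (2) $\lambda=c_\lambda T^{-\alpha_\lambda}$ with constants $c_\lambda>0$ and $0<\alpha_\lambda<\frac12-\frac{4\alpha_d}{m}$;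 $b_T\to0$ and $b_T/\lambda\to\infty$ as $T\to\infty$; $\max_{l=1,\dots,d}\vert\mathcal{B}_l\vert=O(1)$ and $\max_{l=1,\dots,d}\vert\mathcal{B}_l\vert>0$; $\min_{l=1,\dots,d,\ j\in\mathcal{B}_l}\vert\mathbf{S}_{jl}\vert>2b_T$; all eigenvalues of $\mathbf{S}^\dagger$ are less than $1$ in absolute value; the minimum eigenvalue of $\boldsymbol\Sigma^{(0)}$ is greater than a constant $c>0$. (3) There is a constant $c'>0$ such that for all sufficiently large $T$, $\boldsymbol\Lambda^{(l,l)}_{jj}>c'$ for all $l=1,\dots,d$ and $j\in\mathcal{B}_l$. Then $$\max_{l=1,\dots,d}\vert\widetilde{\mathbf{S}}_{\cdot l}-\mathbf{S}_{\cdot l}\vert_1=O_p(\lambda)\quad\text{and}\quad\max_{l=1,\dots,d}\vert\widetilde{\mathbf{S}}_{\cdot l}-\mathbf{S}_{\cdot l}\vert_2=O_p(\lambda).$$ In particular, $$\mathrm{Prob}\Big(\bigcup_{l=1,\dots,d}\{\widetilde{\mathcal{B}}_l\ne\mathcal{B}_l\}\Big)=o(1).$$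
   Context: $T$ is the sample size; $d$, $p$, the matrices $\mathbf{A}^{(j)}$ and the laws of the processes may depend on $T$; $O,o,O_p$ refer to $T\to\infty$, and ''constant'' means independent of $T$. $\Vert X\Vert_m=(\mathbf{E}\vert X\vert^m)^{1/m}$. $\vert\cdot\vert_1,\vert\cdot\vert_2$ are the vector $\ell_1,\ell_2$ norms; $\vert\mathcal{B}\vert$ is the cardinality of a set; $\mathbf{M}_{\cdot l}$ is the $l$th column of $\mathbf{M}$. $(m,\alpha)$-short range dependence of random vectors $\mathbf{v}^{(t)}\in\mathbf{R}^d$, $t\in\mathbf{Z}$: there are independent (not necessarily identically distributed) random variables $e_t,t\in\mathbf{Z}$, and measurable functions with $\mathbf{v}^{(t)}_i=g^{(t,T)}_i(\dots,e_{t-1},e_t)$. Let $e_t^\dagger$ be independent random variables, independent of $(e_s)_{s\in\mathbf{Z}}$, with $e^\dagger_t$ distributed as $e_t$; for $j\ge0$ let $\mathbf{v}^{(t,j)}_i=g^{(t,T)}_i(\dots,e_{t-j-1},e^\dagger_{t-j},e_{t-j+1},\dots,e_t)$ and $\delta^{(j)}=\sup_{i,\,t\in\mathbf{Z}}\Vert\mathbf{v}^{(t)}_i-\mathbf{v}^{(t,j)}_i\Vert_m$. It is required that $\mathbf{E}\mathbf{v}^{(t)}=0$ for all $t$, $\sup_{t,i}\Vert\mathbf{v}^{(t)}_i\Vert_m=O(1)$, and $\sup_{k\ge0}(1+k)^\alpha\sum_{j=k}^\infty\delta^{(j)}=O(1)$. Definitions. $\mathbf{z}^{(t)}=(\mathbf{x}^{(t)\top},\mathbf{x}^{(t-1)\top},\dots,\mathbf{x}^{(t-p+1)\top})^\top\in\mathbf{R}^{pd}$.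 $\mathbf{W}$ is the $(T-p)\times pd$ matrix with rows $\mathbf{z}^{(p)\top},\mathbf{z}^{(p+1)\top},\dots,\mathbf{z}^{(T-1)\top}$. $\mathbf{S}=[\mathbf{A}^{(1)},\dots,\mathbf{A}^{(p)}]^\top\in\mathbf{R}^{pd\times d}$. For $l=1,\dots,d$: $\mathbf{y}^{(l)}=(\mathbf{x}^{(p+1)}_l,\dots,\mathbf{x}^{(T)}_l)^\top$ and $\boldsymbol\eta^{(l)}=(\boldsymbol\epsilon^{(p+1)}_l,\dots,\boldsymbol\epsilon^{(T)}_l)^\top$, so $\mathbf{y}^{(l)}=\mathbf{W}\mathbf{S}_{\cdot l}+\boldsymbol\eta^{(l)}$. $\mathcal{B}_l=\{j\in\{1,\dots,pd\}:\mathbf{S}_{jl}\ne0\}$. $\boldsymbol\Sigma^{(0)}=\mathbf{E}\mathbf{z}^{(p)}\mathbf{z}^{(p)\top}$. $\mathbf{S}^\dagger$ is the $pd\times pd$ transpose of the block companion matrix whose first $d$ rows are $\mathbf{S}^\top$ and whose remaining $(p-1)d$ rows are $[\mathbf{I}_{(p-1)d}\ \ 0]$. Lasso with parameter $\lambda$: $\widetilde{\mathbf{S}}\in\mathbf{R}^{pd\times d}$ has columns $\widetilde{\mathbf{S}}_{\cdot l}\in\mathrm{argmin}_{\mathbf{s}\in\mathbf{R}^{pd}}\frac{1}{2T}\vert\mathbf{y}^{(l)}-\mathbf{W}\mathbf{s}\vert_2^2+\lambda\vert\mathbf{s}\vert_1$. With threshold $b_T$: $\widetilde{\mathcal{B}}_l=\{j\in\{1,\dots,pd\}:\vert\widetilde{\mathbf{S}}_{jl}\vert>b_T\}$.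 Partial inverse operator: for a square matrix $\mathbf{A}\in\mathbf{R}^{n\times n}$ and $\mathcal{B}=\{k_1<\dots<k_v\}\subset\{1,\dots,n\}$, let $\mathbf{A}_{\mathcal{B}}=(\mathbf{A}_{k_sk_t})_{s,t=1,\dots,v}$ and let $\mathbf{Z}$ be the Moore–Penrose pseudo-inverse of $\mathbf{A}_{\mathcal{B}}$; $\mathcal{F}_{\mathcal{B}}(\mathbf{A})\in\mathbf{R}^{n\times n}$ has $(k_s,k_t)$ entry $\mathbf{Z}_{st}$ and all other entries $0$. $\boldsymbol\Lambda^{(l_1,l_2)}=\mathcal{F}_{\mathcal{B}_{l_1}}(\boldsymbol\Sigma^{(0)})\big(\frac1T\mathbf{E}\mathbf{W}^\top\boldsymbol\eta^{(l_1)}\boldsymbol\eta^{(l_2)\top}\mathbf{W}\big)\mathcal{F}_{\mathcal{B}_{l_2}}(\boldsymbol\Sigma^{(0)})$ for $l_1,l_2=1,\dots,d$. *)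

(* Defs.v *)
From HB Require Import structures.
From mathcomp Require Import all_boot all_order all_algebra.
From mathcomp Require Import finmap complex.
From mathcomp Require Import all_classical all_reals all_analysis.
Set Implicit Arguments.
Unset Strict Implicit.
Unset Printing Implicit Defensive.
Import Order.TTheory GRing.Theory Num.Theory.
Import numFieldNormedType.Exports.
Local Open Scope classical_set_scope.
Local Open Scope ring_scope.

Definition norm1 (R : realType) n (v : 'cV[R]_n) : R := \sum_(k < n) `|v k 0|.

Definition norm2 (R : realType) n (v : 'cV[R]_n) : R :=
  Num.sqrt (\sum_(k < n) v k 0 ^+ 2).

Definition expect_mx d (Omega : measurableType d) (R : realType)
    (P : probability Omega R) m n (M : Omega -> 'M[R]_(m, n)) : 'M[R]_(m, n) :=
  \matrix_(i < m, j < n) fine ('E_P[fun w => M w i j])%E.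

(* Boundedness of an extended-real sequence; a value +oo at finitely many
   indices is harmless. *)
Definition ebigO1 (R : realType) (u : nat -> \bar R) : Prop :=
  exists C : R, \forall n \near \oo, (u n <= C%:E)%E.

(* X n = O_p (a n), where the probability space may change with n. *)
Definition bigO_prob (R : realType) (disp : nat -> measure_display)
    (Omega : forall n, measurableType (disp n))
    (P : forall n, probability (Omega n) R)
    (X : forall n, Omega n -> R) (a : nat -> R) : Prop :=
  forall e : R, 0 < e -> exists2 M : R, 0 < M &
    \forall n \near \oo,
      (P n [set w | (M * a n < `|X n w|)%R] <= e%:E)%E.

Definition mutually_independent d (Omega : measurableType d) (R : realType)
    (P : probability Omega R) (I : choiceType) (X : I -> {RV P >-> R}) : Prop :=
  forall (J : {fset I}) (B : I -> set R), (forall i, measurable (B i)) ->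
    P (\bigcap_(i in [set` J]) X i @^-1` B i) =
    (\prod_(i <- J) P (X i @^-1` B i))%E.

(* One-sided sequences (u 0, u 1, ...) with the product sigma-algebra. *)
Definition coordinate_preimages (R : realType) : set (set (nat -> R)) :=
  [set A | exists k (B : set R),
     measurable B /\ A = (fun u : nat -> R => u k) @^-1` B].

Notation seqR R := (g_sigma_algebraType (@coordinate_preimages R)).

(* (e_t, e_(t-1), e_(t-2), ...): the k-th term is e_(t-k). *)
Definition past (Omega R : Type) (e : int -> Omega -> R) (t : int)
    (w : Omega) : nat -> R :=
  fun k => e (t - k%:Z) w.

(* The past of e at t with e_(t-j) replaced by an independent copy.  The copy
   is realised on the product space Omega * Omega, by
   e_s (w, w') := e_s w and edag_s (w, w') := e_s w': under the product measure
   P \x P, the variables (edag_s)_s are distributed as (e_s)_s and independent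
   of them, and Omega need not itself carry such a copy. *)
Definition coupled_past (Omega R : Type) (e : int -> Omega -> R) (t : int)
    (j : nat) (w : Omega * Omega) : nat -> R :=
  fun k => if k == j then e (t - k%:Z) w.2 else e (t - k%:Z) w.1.

(* delta^(j) = sup_(t, i) || v^(t)_i - v^(t, j)_i ||_m
   for v^(t)_i = g^(t)_i (e_t, e_(t-1), ...). *)
Definition dependence_coef d (Omega : measurableType d) (R : realType)
    (P : probability Omega R) (m : R) n (e : int -> Omega -> R)
    (g : int -> 'I_n -> seqR R -> R) (j : nat) : \bar R :=
  ereal_sup [set y | exists t i,
    y = Lnorm (P \x P)%E m%:E (fun w : Omega * Omega =>
          (g t i (past e t w.1) - g t i (coupled_past e t j w))%:E)].

(* (m, alpha)-short range dependence of the array v_T^(t), t in int, indexed by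
   the sample size T; the O(1) conditions are for T --> oo. *)
Definition short_range_dependent (R : realType) (m alpha : R)
    (disp : nat -> measure_display)
    (Omega : forall T, measurableType (disp T))
    (P : forall T, probability (Omega T) R) (d : nat -> nat)
    (v : forall T, int -> Omega T -> 'cV[R]_(d T)) : Prop :=
  exists (e : forall T, int -> {RV (P T) >-> R})
         (g : forall T, int -> 'I_(d T) -> seqR R -> R),
    [/\ forall T, mutually_independent (e T),
        forall T t i, measurable_fun [set: seqR R] (g T t i)
      & forall T t i w, v T t w i 0 = g T t i (past (fun s => e T s) t w)] /\
    [/\ forall T t i, ('E_(P T)[(fun w => v T t w i 0)%R] = 0)%E,
        ebigO1 (fun T => ereal_sup [set y | exists t i,
          y = Lnorm (P T) m%:E (fun w => (v T t w i 0)%:E)])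
      & ebigO1 (fun T => ereal_sup [set y | exists k : nat,
          y = (((1 + k%:R) `^ alpha)%:E *
               \sum_(k <= j <oo) 
                 dependence_coef (P T) m (fun s => e T s) (g T) j)%E])].

(* In 'cV_(p * d), the i-th coordinate of the a-th block (a < p, i < d) sits at
   position a * d + i = mxvec_index a i. *)
Definition lag_vector (R : realType) (Omega : Type) (p d : nat)
    (x : int -> Omega -> 'cV[R]_d) (t : int) (w : Omega) : 'cV[R]_(p * d) :=
  (mxvec (\matrix_(a < p, i < d) x (t - a%:Z) w i 0))^T.

(* Row r is z^(p+r) transposed, for p <= p + r <= T - 1. *)
Definition design (R : realType) (Omega : Type) (p d T : nat)
    (x : int -> Omega -> 'cV[R]_d) (w : Omega) : 'M[R]_(T - p, p * d) :=
  \matrix_(r < T - p, k < p * d) lag_vector p x (p + r)%N%:Z w k 0.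

(* (u^(p+1)_l, ..., u^(T)_l): the response y^(l) for u = x, the noise eta^(l)
   for u = eps. *)
Definition sample_column (R : realType) (Omega : Type) (p d T : nat)
    (u : int -> Omega -> 'cV[R]_d) (l : 'I_d) (w : Omega) : 'cV[R]_(T - p) :=
  \col_(r < T - p) u (p + r).+1%:Z w l 0.

(* S = [A^(1), ..., A^(p)]^T; the matrix A^(a+1) is A a. *)
Definition coef_mx (R : realType) (p d : nat) (A : 'I_p -> 'M[R]_d) :
    'M[R]_(p * d, d) :=
  \matrix_(k < p * d, l < d) mxvec (\matrix_(a < p, i < d) A a l i) 0 k.

(* First d rows S^T, remaining rows [I 0]; S^dagger is its transpose. *)
Definition block_companion (R : realType) (p d : nat) (S : 'M[R]_(p * d, d)) :
    'M[R]_(p * d) :=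
  \matrix_(k < p * d, k' < p * d)
    if insub (val k) is Some l then S^T l k' else (k == (d + k')%N :> nat)%:R.

Definition Sdagger (R : realType) (p d : nat) (S : 'M[R]_(p * d, d)) :
    'M[R]_(p * d) := (block_companion S)^T.

Definition Sigma0 d' (Omega : measurableType d') (R : realType)
    (P : probability Omega R) (p d : nat) (x : int -> Omega -> 'cV[R]_d) :
    'M[R]_(p * d) :=
  expect_mx P (fun w => lag_vector p x p%:Z w *m (lag_vector p x p%:Z w)^T).

Definition active (R : realType) (q d : nat) (S : 'M[R]_(q, d)) (l : 'I_d) :
    {set 'I_q} := [set k | S k l != 0]%SET.

Definition lasso_objective (R : realType) (q n T : nat) (lambda : R)
    (y : 'cV[R]_n) (W : 'M[R]_(n, q)) (s : 'cV[R]_q) : R :=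
  (2 * T%:R)^-1 * norm2 (y - W *m s) ^+ 2 + lambda * norm1 s.

Definition thresholded (R : realType) (q d : nat) (b : R) (S : 'M[R]_(q, d))
    (l : 'I_d) : {set 'I_q} := [set k | b < `|S k l|]%SET.

Definition is_moore_penrose (R : realType) m n
    (A : 'M[R]_(m, n)) (Z : 'M[R]_(n, m)) : Prop :=
  [/\ A *m Z *m A = A, Z *m A *m Z = Z,
      (A *m Z)^T = A *m Z & (Z *m A)^T = Z *m A].

Lemma moore_penrose_unique (R : realType) m n (A : 'M[R]_(m, n))
    (Y Z : 'M[R]_(n, m)) :
  is_moore_penrose A Y -> is_moore_penrose A Z -> Y = Z.
Proof.
move=> [AYA YAY AYt YAt] [AZA ZAZ AZt ZAt].
have AYZ : A *m Y = A *m Z.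
  rewrite -[in LHS]AZA -(mulmxA (A *m Z)) -AZt -AYt -trmx_mul mulmxA AYA.
  by rewrite AZt.
have YAZ : Y *m A = Z *m A.
  rewrite -[in LHS]AZA -(mulmxA A) mulmxA -YAt -ZAt -trmx_mul -mulmxA.
  by rewrite (mulmxA A) AYA ZAt.
by rewrite -YAY YAZ -mulmxA AYZ mulmxA ZAZ.
Qed.

Lemma row_free_gram (R : realType) m n (F : 'M[R]_(m, n)) :
  row_free F -> F *m F^T \in unitmx.
Proof.
move=> Ffree; rewrite -row_free_unit -kermx_eq0; apply/eqP/row_matrixP => i.
rewrite row0; set v := row i _.
have v0 : v *m (F *m F^T) = 0 by apply/sub_kermxP; exact: row_sub.
suff vF : v *m F = 0.
  by apply: (row_free_inj Ffree); rewrite vF mul0mx.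
have : (v *m F) *m (v *m F)^T = 0 by rewrite trmx_mul !mulmxA -(mulmxA v) v0 mul0mx.
move/matrixP/(_ 0 0); rewrite [LHS]mxE [RHS]mxE.
under eq_bigr do rewrite [(_^T) _ _]mxE -expr2.
move/eqP; rewrite psumr_eq0 => [/allP sqr0|k _]; last exact: sqr_ge0.
apply/rowP => k; rewrite [RHS]mxE; apply/eqP.
by rewrite -sqrf_eq0; exact: (implyP (sqr0 k (mem_index_enum _))).
Qed.

Lemma moore_penrose_exists (R : realType) m n (A : 'M[R]_(m, n)) :
  exists Z, is_moore_penrose A Z.
Proof.
have : row_free (col_base A)^T by rewrite /row_free mxrank_tr; exact: col_base_full.
move: (mulmx_base A) (row_base_free A).
move: (\rank A) (col_base A) (row_base A) => r C F CF Ffree Cfree.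
have uF := row_free_gram Ffree.
have := row_free_gram Cfree; rewrite trmxK => uC.
pose G := invmx (F *m F^T); pose H := invmx (C^T *m C).
have Gt : G^T = G by rewrite /G trmx_inv trmx_mul trmxK.
have Ht : H^T = H by rewrite /H trmx_inv trmx_mul trmxK.
pose Z := F^T *m G *m H *m C^T.
have AZ : A *m Z = C *m H *m C^T.
  by rewrite -CF /Z !mulmxA -(mulmxA C F) -(mulmxA C _ G) mulmxV// mulmx1.
have ZA : Z *m A = F^T *m G *m F.
  by rewrite -CF /Z !mulmxA -(mulmxA _ C^T C) -(mulmxA _ H) mulVmx// mulmx1.
exists Z; split.
- by rewrite AZ -CF !mulmxA -(mulmxA _ C^T C) -(mulmxA _ H) mulVmx// mulmx1.
- rewrite ZA /Z !mulmxA -(mulmxA _ F F^T) -(mulmxA _ (F *m F^T)) mulmxV//.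
  by rewrite mulmx1.
- by rewrite AZ !trmx_mul trmxK Ht mulmxA.
- by rewrite ZA !trmx_mul trmxK Gt mulmxA.
Qed.

Definition moore_penrose (R : realType) m n (A : 'M[R]_(m, n)) : 'M[R]_(n, m) :=
  xget 0 [set Z | is_moore_penrose A Z].

Lemma moore_penroseP (R : realType) m n (A : 'M[R]_(m, n)) :
  is_moore_penrose A (moore_penrose A).
Proof. by have [Z AZ] := moore_penrose_exists A; exact: (xgetI 0 AZ). Qed.

(* enum_val lists the elements k_1 < ... < k_v of B; E is the v x n matrix whose
   s-th row is the k_s-th unit vector, so that the (k_s, k_t) entry of
   E^T *m Z *m E is Z s t and its other entries are 0. *)
Definition partial_inverse (R : realType) n (B : {set 'I_n}) (A : 'M[R]_n) :
    'M[R]_n :=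
  let k : 'I_#|B| -> 'I_n := enum_val in
  let E : 'M[R]_(#|B|, n) := rowsub k 1%:M in
  E^T *m moore_penrose (mxsub k k A) *m E.

Definition Lambda d' (Omega : measurableType d') (R : realType)
    (P : probability Omega R) (p d T : nat) (x eps : int -> Omega -> 'cV[R]_d)
    (S : 'M[R]_(p * d, d)) (l1 l2 : 'I_d) : 'M[R]_(p * d) :=
  partial_inverse (active S l1) (Sigma0 P p x) *m
  (T%:R^-1 *: expect_mx P (fun w =>
     (design p T x w)^T *m sample_column p T eps l1 w *m
     (sample_column p T eps l2 w)^T *m design p T x w)) *m
  partial_inverse (active S l2) (Sigma0 P p x).

(* Main.v *)
(* On the event that all entries of W^T W / T and W^T y^(l) / T are within eta of
   their means, with eta a small multiple of lambda, the lasso cone argument gives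
   an l1 error of order lambda for every column: Sigma^(0) is bounded below by c,
   stability makes E z^(t) z^(t)^T constant in t and the noise uncorrelated with
   the past, and |S_l|_1 is bounded because S_l^T Sigma^(0) S_l <= E (x_l)^2.
   Each entry is a sum over time of products x_i x_j.  Replacing coordinates of
   the innovation sequence one at a time by independent copies gives an
   Efron-Stein type bound on its moment of order m / 2 by T^(m/4), where the effect
   of each replacement is controlled by the coefficients delta^(j).  Markov's
   inequality and a union bound over O(d^2) entries bound the probability of the
   complement by a multiple of T^(2 alpha_d - m/4 + m alpha_lambda / 2), which
   tends to 0 since alpha_lambda < 1/2 - 4 alpha_d / m. *)
Require Import Defs.
From HB Require Import structures.
From mathcomp Require Import all_boot all_order all_algebra.
From mathcomp Require Import finmap complex.
From mathcomp Require Import all_classical all_reals all_analysis.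
From mathcomp Require Import measurable_realfun.
From mathcomp Require Import ring lra zify.
Set Implicit Arguments.
Unset Strict Implicit.
Unset Printing Implicit Defensive.
Import Order.TTheory GRing.Theory Num.Theory.
Import numFieldNormedType.Exports.
Local Open Scope classical_set_scope.
Local Open Scope ring_scope.

(** * Elementary inequalities for powers *)

(** The observations are unbounded and depend on infinitely many innovations. Concentration is
    therefore proved first for bounded functions on the space of one-sided sequences and extended by
    truncation, which is 1-Lipschitz and so cannot raise the effect of a replacement. Conditional
    expectation is realised as integration over a resampled coordinate. Coordinates are averaged out
    from the present towards the past; what remains after many of them is nearly constant. The power
    inequality needs an exact linear term, because orthogonality cancels precisely this term. Each
    step then multiplies the moment by a factor 1 + K th_i, with weights th_i of sum at most 1, so
    that the total factor is at most exp K. Stationarity of the process is not among the hypotheses.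
    It is recovered at the level of covariances: cross covariances with the noise, and differences
    of consecutive second moments, satisfy homogeneous recursions that reach back into the infinite
    past, and a bounded solution of a stable recursion of this kind is zero. *)

Section power_inequalities.
Variable R : realType.
Implicit Types (a b s t q y z : R).

(** Young's inequality for [1 + t] and [1], with exponents [s] and [s / (s - 1)]. *)
Lemma bernoulli_powR s t : 1 <= s -> -1 <= t -> 1 + s * t <= (1 + t) `^ s.
Proof.
move=> s1 t1; have t0 : 0 <= 1 + t by lra.
move: s1; rewrite le_eqVlt => /predU1P[<-|s1]; first by rewrite mul1r powRr1.
have s0 : 0 < s by lra.
have s10 : 0 < s - 1 by lra.
have /= := @conjugate_powR R (1 + t) 1 s (s / (s - 1)) t0 ler01 s0.
rewrite divr_gt0// powR1 mulr1 => /(_ isT).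
have -> : s^-1 + (s / (s - 1))^-1 = 1.
  by rewrite invf_div -{1}(mul1r s^-1) -mulrDl subrKC divff// gt_eqF.
move=> /(_ erefl); rewrite -(ler_pM2r s0).
have -> : ((1 + t) `^ s / s + 1 / (s / (s - 1))) * s = (1 + t) `^ s + (s - 1).
  by field; rewrite !lt0r_neq0.
by lra.
Qed.

(** Bernoulli's inequality for the reciprocal of [1 + t], which is 1 plus [- t / (1 + t)],
    multiplied by the power of [1 + t]. The point [t = -1] has no reciprocal and is treated
    apart. *)
Lemma powR_add1_le s t : 1 < s -> -1 <= t ->
  (1 + t) `^ s <= 1 + s * t * (1 + t) `^ (s - 1).
Proof.
move=> s1 t1; have : 0 <= 1 + t by lra.
rewrite le_eqVlt => /predU1P[<-|u0].
  by rewrite !powR0 ?mulr0 ?addr0 ?ler01//; apply: lt0r_neq0; lra.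
have s0 : 1 <= s by lra.
have tu : -1 <= - t / (1 + t).
  by rewrite ler_pdivlMr// mulN1r; lra.
have := bernoulli_powR s0 tu.
have -> : 1 + - t / (1 + t) = (1 + t)^-1 by field; apply: lt0r_neq0.
have -> : (1 + t)^-1 `^ s = ((1 + t) `^ s)^-1.
  by rewrite -powR_inv1 ?(ltW u0)// -powRrM mulN1r powRN.
have us0 : 0 < (1 + t) `^ s by exact: powR_gt0.
rewrite -(ler_pM2r us0) mulVf ?gt_eqF// mulrDl mul1r.
have -> : s * (- t / (1 + t)) * (1 + t) `^ s = - (s * t * (1 + t) `^ (s - 1)).
  have -> : (1 + t) `^ s = (1 + t) * (1 + t) `^ (s - 1).
    by rewrite mulr_powRB1//; lra.
  by field; apply: lt0r_neq0.
by lra.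
Qed.

(** One constant for both cases of the expansion below: the first summand serves [|t| <= 1], the
    other two serve [|t| > 1]. *)
Definition expansion_cst q : R := q ^+ 2 * 2 `^ q + q + 2 `^ q.

Lemma expansion_cst_ge1 q : 2 <= q -> 1 <= expansion_cst q.
Proof.
move=> q2; rewrite /expansion_cst; have := powR_ge0 2 q.
by have := sqr_ge0 q; nra.
Qed.

(** A second-order expansion near 0 and the crude bound [|1 + t| <= 2 * |t|] away from it. The
    linear term keeps its exact coefficient, since it has to vanish in expectation later. *)
Lemma powR_norm_add1_le q t : 2 < q ->
  `|1 + t| `^ q <= 1 + q * t + expansion_cst q * (t ^+ 2 + `|t| `^ q).
Proof.
move=> q2; have q0 : 0 <= q by lra.
have p2 : 1 <= 2 `^ q by rewrite -[leLHS](@powRr0 R 2); apply: ler_powR; lra.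
have [t1|t1] := lerP `|t| 1.
  have tq0 := powR_ge0 `|t| q.
  move: t1; rewrite ler_norml => /andP[tN1 t1].
  have u0 : 0 <= 1 + t by lra.
  rewrite ger0_norm//.
  have q1 : 1 < q by lra.
  have := powR_add1_le q1 tN1; set v := (1 + t) `^ (q - 1) => h.
  (* The convexity bound has slope [v] where the expansion has slope 1. The gap is of second order
     because [v - 1] is of order [t], by convexity for [t >= 0] and by Bernoulli's inequality for
     [t < 0]. *)
  suff : q * t * (v - 1) <= q ^+ 2 * 2 `^ q * t ^+ 2.
    move=> h2; rewrite /expansion_cst.
    have h3 : 0 <= (q + 2 `^ q) * (t ^+ 2 + `|t| `^ q).
      by rewrite mulr_ge0 ?addr_ge0 ?sqr_ge0 ?(le_trans ler01 p2).
    have h4 : 0 <= q ^+ 2 * 2 `^ q * `|t| `^ q.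
      by rewrite !mulr_ge0 ?sqr_ge0 ?(le_trans ler01 p2).
    by lra.
  have [t0|t0] := lerP 0 t.
    have q11 : 1 < q - 1 by lra.
    have := powR_add1_le q11 tN1; rewrite -/v.
    have w2 : (1 + t) `^ (q - 1 - 1) <= 2 `^ q.
      apply: (@le_trans _ _ (2 `^ (q - 1 - 1))).
        by apply: ge0_ler_powR; rewrite ?nnegrE; lra.
      by apply: ler_powR; lra.
    have w0 := powR_ge0 (1 + t) (q - 1 - 1).
    set w := (1 + t) `^ (q - 1 - 1) in w2 w0 * => hv.
    have h1 : v - 1 <= q * t * 2 `^ q.
      apply: (@le_trans _ _ ((q - 1) * t * w)); first by lra.
      apply: ler_pM => //; [nra|nra].
    have -> : q ^+ 2 * 2 `^ q * t ^+ 2 = (q * t) * (q * t * 2 `^ q) by ring.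
    by apply: ler_wpM2l => //; nra.
  have q11 : 1 <= q - 1 by lra.
  have := bernoulli_powR q11 tN1; rewrite -/v => hv.
  have h1 : 1 - v <= q * (- t) by nra.
  have -> : q * t * (v - 1) = (q * (- t)) * (1 - v) by ring.
  apply: (@le_trans _ _ ((q * - t) * (q * - t))).
    by apply: ler_wpM2l => //; nra.
  have -> : q * - t * (q * - t) = q ^+ 2 * t ^+ 2 * 1 by ring.
  rewrite [leRHS](_ : _ = q ^+ 2 * t ^+ 2 * 2 `^ q); last by ring.
  by apply: ler_wpM2l => //; apply: mulr_ge0; exact: sqr_ge0.
have h1 : `|1 + t| `^ q <= 2 `^ q * `|t| `^ q.
  rewrite -powRM//; apply: ge0_ler_powR; rewrite ?nnegrE ?mulr_ge0//.
  by rewrite (le_trans (ler_normD _ _))// normr1; lra.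
have tq : `|t| <= `|t| `^ q by apply: le1r_powR; lra.
have h3 : q * - t <= q * `|t| `^ q.
  by apply: ler_wpM2l => //; rewrite (le_trans _ tq)// -normrN ler_norm.
have h4 : 0 <= (q ^+ 2 * 2 `^ q + q + 2 `^ q) * t ^+ 2.
  rewrite mulr_ge0 ?sqr_ge0// addr_ge0 ?powR_ge0// addr_ge0//.
  by rewrite mulr_ge0 ?sqr_ge0 ?powR_ge0.
have h5 : 0 <= q ^+ 2 * 2 `^ q * `|t| `^ q.
  by rewrite !mulr_ge0 ?sqr_ge0 ?powR_ge0.
by rewrite /expansion_cst; lra.
Qed.

(** Up to the factor [q], the derivative of the q-th power of [|a|]. *)
Definition signed_powR q a : R := Num.sg a * `|a| `^ (q - 1).

Lemma signed_powR_mul q a : 0 < q -> signed_powR q a * a = `|a| `^ q.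
Proof.
by move=> q0; rewrite /signed_powR mulrAC -normrEsg mulr_powRB1.
Qed.

Lemma norm_signed_powR_le q a : `|signed_powR q a| <= `|a| `^ (q - 1).
Proof.
rewrite normrM normr_sg (ger0_norm (powR_ge0 _ _)).
by case: eqVneq => _ /=; rewrite ?mul0r ?mul1r ?powR_ge0.
Qed.

(** The previous expansion at [t = b / a], rescaled by the q-th power of [|a|]. For [a = 0] it holds
    because the constant is at least 1. *)
Lemma powR_normD_le q a b : 2 < q ->
  `|a + b| `^ q <= `|a| `^ q + q * signed_powR q a * b +
     expansion_cst q * (`|a| `^ (q - 2) * b ^+ 2 + `|b| `^ q).
Proof.
move=> q2; have q0 : 0 < q by lra.
have [->|a0] := eqVneq a 0.
  rewrite add0r /signed_powR sgr0 mul0r mulr0 mul0r normr0 powR0 ?gt_eqF//.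
  rewrite powR0; last by apply: lt0r_neq0; lra.
  rewrite mul0r !add0r ler_peMl ?powR_ge0//.
  by apply: expansion_cst_ge1; lra.
have na0 : 0 < `|a| by rewrite normr_gt0.
have -> : a + b = a * (1 + b / a) by field.
rewrite normrM powRM//.
apply: (le_trans (ler_wpM2l (powR_ge0 _ _) (powR_norm_add1_le (b / a) q2))).
rewrite le_eqVlt; apply/orP; left; apply/eqP.
rewrite -!(signed_powR_mul a q0) normrM powRM// normfV.
have -> : `|a|^-1 `^ q = (`|a| `^ q)^-1.
  by rewrite -(powR_inv1 (normr_ge0 a)) -powRrM mulN1r powRN.
have -> : `|a| `^ (q - 2) = signed_powR q a / a.
  rewrite powRB; last by rewrite normr_eq0 a0 implybT.
  rewrite -(signed_powR_mul a q0) -[2]/(2%:R) powR_mulrn// real_normK ?num_real//.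
  by field.
have -> : (`|a| `^ q)^-1 = (signed_powR q a * a)^-1 by rewrite signed_powR_mul.
field; rewrite a0 /= /signed_powR mulf_neq0 ?sgr_eq0//.
by rewrite gt_eqF// powR_gt0.
Qed.

(** A weighted Young inequality, by cases according to whether [b ^+ 2] or [th * a ^+ 2] is larger.
    The weight [th] stays free so that it can be adapted to each coordinate. *)
Lemma mixed_power_le q a b th : 2 < q -> 0 < th ->
  `|a| `^ (q - 2) * b ^+ 2 <= th * `|a| `^ q + th `^ (1 - q / 2) * `|b| `^ q.
Proof.
move=> q2 th0.
have sq y : `|y| `^ q = `|y| `^ (q - 2) * y ^+ 2.
  have [->|y0] := eqVneq y 0.
    by rewrite normr0 !powR0 ?mul0r//; apply: lt0r_neq0; lra.
  rewrite -(real_normK (num_real y)) -powR_mulrn// -powRD; last by rewrite normr_eq0 y0 implybT.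
  by congr (_ `^ _); ring.
have [h|h] := lerP (b ^+ 2) (th * a ^+ 2).
  rewrite (le_trans (ler_wpM2l (powR_ge0 _ _) h))// mulrCA -sq lerDl.
  by rewrite mulr_ge0 ?powR_ge0.
have a2 : `|a| `^ 2 = a ^+ 2 by rewrite -[2]/(2%:R) powR_mulrn// real_normK ?num_real.
have b2 : `|b| `^ 2 = b ^+ 2 by rewrite -[2]/(2%:R) powR_mulrn// real_normK ?num_real.
suff : `|a| `^ (q - 2) <= th `^ (1 - q / 2) * `|b| `^ (q - 2).
  move=> {}h; rewrite (sq b) mulrA.
  apply: (@le_trans _ _ (th `^ (1 - q / 2) * `|b| `^ (q - 2) * b ^+ 2)).
    by apply: ler_wpM2r => //; exact: sqr_ge0.
  by rewrite lerDr mulr_ge0 ?powR_ge0// ltW.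
have e : q - 2 = 2 * (q / 2 - 1) by field.
rewrite e !powRrM a2 b2.
have -> : 1 - q / 2 = - (q / 2 - 1) by ring.
have -> : th `^ (- (q / 2 - 1)) = th^-1 `^ (q / 2 - 1).
  by rewrite -(powR_inv1 (ltW th0)) -powRrM mulN1r.
have th'0 : 0 <= th^-1 by rewrite invr_ge0 ltW.
rewrite -powRM ?sqr_ge0//.
apply: ge0_ler_powR; rewrite ?nnegrE ?sqr_ge0//; first by lra.
  by apply: mulr_ge0 => //; exact: sqr_ge0.
by rewrite [leRHS]mulrC ler_pdivlMr// [leLHS]mulrC ltW.
Qed.

(** A convex function lies above its tangent at [z]; here this follows from Young's inequality. It
    is the form in which convexity yields Jensen's inequality. *)
Lemma powR_tangent q y z : 1 < q ->
  `|z| `^ q + q * signed_powR q z * (y - z) <= `|y| `^ q.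
Proof.
move=> q1; have q0 : 0 < q by lra.
rewrite mulrBr -[q * _ * z]mulrA signed_powR_mul//.
have h : signed_powR q z * y <= `|z| `^ (q - 1) * `|y|.
  by rewrite (le_trans (ler_norm _))// normrM ler_wpM2r// norm_signed_powR_le.
have q10 : 0 < q - 1 by lra.
have /= := @conjugate_powR R (`|z| `^ (q - 1)) `|y| (q / (q - 1)) q
  (powR_ge0 _ _) (normr_ge0 _) (divr_gt0 q0 q10) q0.
have -> : (q / (q - 1))^-1 + q^-1 = 1.
  by rewrite invf_div -{2}(mul1r q^-1) -mulrDl subrK divff// gt_eqF.
move=> /(_ erefl); rewrite -powRrM.
have -> : (q - 1) * (q / (q - 1)) = q by field; exact: lt0r_neq0.
move=> h2; have {h h2} := le_trans h h2; rewrite -(ler_pM2l q0).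
have -> : q * (`|z| `^ q / (q / (q - 1)) + `|y| `^ q / q) =
  `|z| `^ q * (q - 1) + `|y| `^ q by field; rewrite !lt0r_neq0.
lra.
Qed.

End power_inequalities.

(** * Bounded measurable functions *)

(** This class is stable under sums, products, powers, sections and partial integrals, and its
    members are integrable for every probability, so that linearity and Fubini apply without further
    conditions. *)
Definition bmeas d (T : measurableType d) (R : realType) (f : T -> R) : Prop :=
  measurable_fun setT f /\ exists K, forall x, `|f x| <= K.

Section bounded_measurable.
Context d (T : measurableType d) (R : realType).
Implicit Types (f g : T -> R).

Lemma bmeas_cst (a : R) : bmeas (fun _ : T => a).
Proof. by split; [exact: measurable_cst | exists `|a|]. Qed.

Lemma bmeasD f g : bmeas f -> bmeas g -> bmeas (fun x => f x + g x).
Proof.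
move=> [mf [K fK]] [mg [L gL]]; split; first exact: measurable_funD.
exists (K + L) => x; exact: le_trans (ler_normD _ _) (lerD (fK x) (gL x)).
Qed.

Lemma bmeasM f g : bmeas f -> bmeas g -> bmeas (fun x => f x * g x).
Proof.
move=> [mf [K fK]] [mg [L gL]]; split; first exact: measurable_funM.
by exists (K * L) => x; rewrite normrM ler_pM.
Qed.

Lemma bmeasZ (a : R) f : bmeas f -> bmeas (fun x => a * f x).
Proof. by move=> ?; apply: bmeasM => //; exact: bmeas_cst. Qed.

Lemma bmeasB f g : bmeas f -> bmeas g -> bmeas (fun x => f x - g x).
Proof.
move=> bf /(bmeasZ (-1)) bg; have := bmeasD bf bg.
by under eq_fun do rewrite mulN1r.
Qed.

Lemma bmeas_norm f : bmeas f -> bmeas (fun x => `|f x|).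
Proof.
move=> [mf [K fK]]; split; first exact: measurableT_comp.
by exists K => x; rewrite normr_id.
Qed.

Lemma bmeas_powR (q : R) f : 0 <= q -> bmeas f -> bmeas (fun x => `|f x| `^ q).
Proof.
move=> q0 [mf [K fK]]; split.
  apply: (@measurableT_comp _ _ _ _ _ _ (fun y : R => y `^ q)).
    exact: measurable_powR.
  exact: measurableT_comp.
exists (K `^ q) => x; rewrite ger0_norm ?powR_ge0//.
by apply: ge0_ler_powR; rewrite ?nnegrE ?(le_trans _ (fK x)).
Qed.

Lemma bmeas_signed_powR (q : R) f : 1 < q -> bmeas f ->
  bmeas (fun x => signed_powR q (f x)).
Proof.
move=> q1 [mf bf].
have [|mq [K qK]] := @bmeas_powR (q - 1) f _ (conj mf bf); first by lra.
split.
  apply: measurable_funM => //.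
  rewrite (_ : (fun x => _) = fun x => if 0 < f x then 1 else
      if f x < 0 then -1 else 0); last first.
    apply/funext => x.
    by case: ltrgt0P => [/gtr0_sg|/ltr0_sg|->] //; rewrite sgr0.
  apply: measurable_fun_ifT => //; first exact: measurable_fun_ltr.
  by apply: measurable_fun_ifT => //; exact: measurable_fun_ltr.
exists K => x; apply: le_trans (norm_signed_powR_le _ _) _.
by apply: le_trans (qK x); exact: ler_norm.
Qed.

Lemma bmeas_comp d' (T' : measurableType d') (f : T -> R) (g : T' -> T) :
  bmeas f -> measurable_fun setT g -> bmeas (fun x => f (g x)).
Proof.
move=> [mf [K fK]] mg; split; first exact: measurableT_comp.
by exists K.
Qed.

Variable mu : probability T R.

Lemma bmeas_integrable f : bmeas f -> mu.-integrable setT (EFin \o f).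
Proof.
move=> [mf [K fK]].
apply: (@le_integrable _ _ _ mu setT measurableT _ (EFin \o cst K)) => //.
- exact/measurable_EFinP.
- by move=> x _ /=; rewrite lee_fin (le_trans (fK x))// ler_norm.
- exact: finite_measure_integrable_cst.
Qed.

Local Notation E f := (\int[mu]_x f x).

Lemma bmeas_EFin f : bmeas f -> (E f)%:E = (\int[mu]_x (f x)%:E)%E.
Proof.
by move=> /bmeas_integrable bf; rewrite /Rintegral fineK//; exact: integrable_fin_num.
Qed.

Lemma expD f g : bmeas f -> bmeas g -> E (f \+ g) = E f + E g.
Proof. by move=> bf bg; rewrite RintegralD//; exact: bmeas_integrable. Qed.

Lemma expB f g : bmeas f -> bmeas g -> E (f \- g) = E f - E g.
Proof. by move=> bf bg; rewrite RintegralB//; exact: bmeas_integrable. Qed.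

Lemma expZ (a : R) f : bmeas f -> \int[mu]_x (a * f x) = a * E f.
Proof. by move=> bf; rewrite RintegralZl//; exact: bmeas_integrable. Qed.

Lemma exp_cst (a : R) : \int[mu]_x a = a.
Proof.
rewrite Rintegral_cst//; transitivity (a * fine (1%E : \bar R)).
  by congr (_ * fine _); exact: probability_setT.
by rewrite mulr1.
Qed.

Lemma exp_le f g : bmeas f -> bmeas g -> (forall x, f x <= g x) -> E f <= E g.
Proof.
by move=> bf bg fg; apply: le_Rintegral => //; exact: bmeas_integrable.
Qed.

Lemma exp_norm_le f : bmeas f -> `|E f| <= \int[mu]_x `|f x|.
Proof. by move=> bf; apply: le_normr_Rintegral => //; exact: bmeas_integrable. Qed.

(** Integrate the tangent inequality at the point [E f]: the linear term has mean zero. *)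
Lemma exp_jensen (q : R) f : 1 < q -> bmeas f ->
  `|E f| `^ q <= \int[mu]_x `|f x| `^ q.
Proof.
move=> q1 bf; have q0 : 0 <= q by lra.
pose c := q * signed_powR q (E f).
have bl : bmeas (fun x => c * (f x - E f)).
  by apply: bmeasZ; apply: bmeasB => //; exact: bmeas_cst.
apply: (@le_trans _ _ (\int[mu]_x (`|E f| `^ q + c * (f x - E f)))).
  rewrite (@expD (cst _) (fun x => c * (f x - E f)))//; last exact: bmeas_cst.
  rewrite exp_cst expZ; last by apply: bmeasB => //; exact: bmeas_cst.
  rewrite (@expB f (cst (E f)))//; last exact: bmeas_cst.
  by rewrite exp_cst subrr mulr0 addr0.
apply: exp_le.
- by apply: bmeasD => //; exact: bmeas_cst.
- exact: bmeas_powR.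
- by move=> x; exact: powR_tangent.
Qed.

End bounded_measurable.

Section bounded_fubini.
Context d1 d2 (T1 : measurableType d1) (T2 : measurableType d2) (R : realType).
Variables (mu : probability T1 R) (nu : probability T2 R).
Implicit Types f : T1 * T2 -> R.

Lemma bmeas_section1 f x : bmeas f -> bmeas (fun y => f (x, y)).
Proof. by move=> bf; apply: (bmeas_comp bf); exact: pair1_measurable. Qed.

Lemma bmeas_section2 f y : bmeas f -> bmeas (fun x => f (x, y)).
Proof. by move=> bf; apply: (bmeas_comp bf); exact: pair2_measurable. Qed.

Lemma bmeas_integral f : bmeas f -> bmeas (fun x => \int[nu]_y f (x, y)).
Proof.
move=> bf; have bs x := bmeas_section1 x bf; split.
  have mF := @measurable_fubini_F _ _ _ _ _ mu nu _ (@bmeas_integrable _ _ _ (mu \x nu)%E _ bf).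
  exact: (measurableT_comp (fine_measurable measurableT) mF).
have [_ [K fK]] := bf; exists K => x.
apply: (le_trans (exp_norm_le _ (bs x))).
rewrite -[leRHS](exp_cst nu).
by apply: exp_le => //; [exact: bmeas_norm | exact: bmeas_cst].
Qed.

Lemma bmeas_fubini f : bmeas f ->
  \int[mu]_x \int[nu]_y f (x, y) = \int[nu]_y \int[mu]_x f (x, y).
Proof.
move=> bf; rewrite /Rintegral; congr fine.
have bi := @bmeas_integrable _ _ _ (mu \x nu)%E _ bf.
have := Fubini bi => /= h.
transitivity (\int[mu]_x \int[nu]_y (f (x, y))%:E)%E.
  by apply: eq_integral => x _; rewrite -bmeas_EFin//; exact: bmeas_section1.
rewrite h; apply: eq_integral => y _.
by rewrite -bmeas_EFin//; exact: bmeas_section2.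
Qed.

Lemma bmeas_prod f : bmeas f ->
  \int[mu]_x \int[nu]_y f (x, y) = \int[(mu \x nu)%E]_z f z.
Proof.
move=> bf; rewrite /Rintegral; congr fine.
have bi := @bmeas_integrable _ _ _ (mu \x nu)%E _ bf.
rewrite -(integral12_prod_meas1 bi) /fubini_F.
by apply: eq_integral => x _; rewrite -bmeas_EFin//; exact: bmeas_section1.
Qed.

End bounded_fubini.

(** * An Efron-Stein moment inequality for sequences *)

Section sequence_space.
Variable R : realType.
Local Notation S := (seqR R).

Lemma measurable_coordinate k : measurable_fun [set: S] (fun u : S => u k).
Proof.
move=> _ B mB; rewrite setTI; apply: sub_sigma_algebra.
by exists k, B.
Qed.

Lemma measurable_fun_seqP d (T : measurableType d) (f : T -> S) :
  (forall k, measurable_fun [set: T] (fun x => f x k)) -> measurable_fun [set: T] f.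
Proof.
move=> mf; apply: (@measurability _ _ T S setT f (@coordinate_preimages R) erefl).
by move=> _ [_ [k [B [mB ->]]] <-]; exact: mf.
Qed.

(** A whole second sequence is carried, though only one coordinate of it is read, so that the
    independent copy lives on the product space for every [k] alike. *)
Definition resample (k : nat) (w : S * S) : S :=
  fun i => if i == k then w.2 i else w.1 i.

Lemma measurable_resample k : measurable_fun [set: S * S] (resample k).
Proof.
apply: measurable_fun_seqP => i; rewrite /resample; case: (i == k).
  exact: (measurableT_comp (measurable_coordinate i) measurable_snd).
exact: (measurableT_comp (measurable_coordinate i) measurable_fst).
Qed.

Lemma resample_idem k u v v' :
  resample k (resample k (u, v), v') = resample k (u, v').
Proof. by apply/funext => i; rewrite /resample /=; case: eqP. Qed.

Lemma resampleC j k u v v' : j != k ->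
  resample j (resample k (u, v), v') = resample k (resample j (u, v'), v).
Proof.
move=> jk; apply/funext => i; rewrite /resample /=.
by have [->|] := eqVneq i j; [rewrite (negbTE jk)|].
Qed.

Lemma bmeas_resample (f : S -> R) k :
  bmeas f -> bmeas (fun w : S * S => f (resample k w)).
Proof. by move=> bf; exact: (bmeas_comp bf (measurable_resample k)). Qed.

End sequence_space.

(** The only trace of independence that the moment inequality uses: exchanging one coordinate for an
    independent copy leaves the law unchanged. *)
Definition resampling_invariant (R : realType) (mu : probability (seqR R) R) : Prop :=
  forall k (f : seqR R -> R), bmeas f ->
    \int[mu]_u \int[mu]_v f (resample k (u, v)) = \int[mu]_u f u.

Section efron_stein.
Variables (R : realType) (mu : probability (seqR R) R).
Local Notation S := (seqR R).
Hypothesis mu_inv : resampling_invariant mu.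
Implicit Types (f g h : S -> R).
Local Notation E f := (\int[mu]_u f u).

(** Under resampling invariance, a version of the conditional expectation given all coordinates
    except the k-th. *)
Definition avg k f : S -> R := fun u => \int[mu]_v f (resample k (u, v)).

Lemma bmeas_avg k f : bmeas f -> bmeas (avg k f).
Proof. by move=> bf; exact: (bmeas_integral mu mu (bmeas_resample k bf)). Qed.

Lemma bmeas_resample1 k f u : bmeas f -> bmeas (fun v => f (resample k (u, v))).
Proof. by move=> bf; exact: (bmeas_section1 u (bmeas_resample k bf)). Qed.

Lemma exp_avg k f : bmeas f -> E (avg k f) = E f.
Proof. exact: mu_inv. Qed.

Definition insensitive k f := forall u v, f (resample k (u, v)) = f u.

Lemma insensitive_avg k f : insensitive k (avg k f).
Proof.
by move=> u v; apply: eq_Rintegral => v' _; rewrite resample_idem.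
Qed.

Lemma insensitive_avgC j k f : j != k -> insensitive j f -> insensitive j (avg k f).
Proof.
move=> jk fj u v; apply: eq_Rintegral => v' _.
by rewrite resampleC 1?eq_sym// fj.
Qed.

(** The martingale difference property: resampling coordinate [k] in [h * f] leaves [h] in place and
    turns [f] into its average. *)
Lemma exp_insensitive_mul k h f : bmeas h -> bmeas f -> insensitive k h ->
  \int[mu]_u (h u * (f u - avg k f u)) = 0.
Proof.
move=> bh bf hk; have ba := bmeas_avg k bf.
transitivity (\int[mu]_u (h u * f u - h u * avg k f u)).
  by apply: eq_Rintegral => u _; rewrite mulrBr.
rewrite expB; [|exact: bmeasM|exact: bmeasM].
rewrite -(mu_inv k (bmeasM bh bf)); apply/eqP; rewrite subr_eq0; apply/eqP.
apply: eq_Rintegral => u _; rewrite /avg -expZ; last exact: bmeas_resample1.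
by apply: eq_Rintegral => v _; rewrite hk.
Qed.

Definition influence (q : R) k f :=
  \int[mu]_u \int[mu]_v `|f u - f (resample k (u, v))| `^ q.

Lemma bmeas_diff k f : bmeas f -> bmeas (fun w : S * S => f w.1 - f (resample k w)).
Proof.
move=> bf; apply: bmeasB; last exact: bmeas_resample.
by apply: (bmeas_comp bf); exact: measurable_fst.
Qed.

Lemma bmeas_diff_powR q k f : 0 <= q -> bmeas f ->
  bmeas (fun w : S * S => `|f w.1 - f (resample k w)| `^ q).
Proof. by move=> q0 bf; apply: bmeas_powR => //; exact: bmeas_diff. Qed.

(** For fixed [u], the difference [f u - avg k f u] is the mean of the changes caused by a
    replacement, so Jensen's inequality applies. *)
Lemma exp_avg_diff_le q k f : 1 < q -> bmeas f ->
  \int[mu]_u `|f u - avg k f u| `^ q <= influence q k f.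
Proof.
move=> q1 bf; have q0 : 0 <= q by lra.
apply: exp_le.
- by apply: bmeas_powR => //; apply: bmeasB => //; exact: bmeas_avg.
- exact: (bmeas_integral mu mu (bmeas_diff_powR k q0 bf)).
move=> u; have b1 := bmeas_section1 u (bmeas_diff k bf).
apply: (le_trans _ (exp_jensen mu q1 b1)); rewrite le_eqVlt; apply/orP; left.
rewrite /= (expB mu (@bmeas_cst _ S R (f u)) (bmeas_resample1 k u bf)) exp_cst.
by rewrite /avg.
Qed.

(** Averaging over coordinate [k] commutes with resampling [j], so the change of the average is the
    average of the changes; Jensen's inequality, Fubini and the invariance of [mu] conclude. *)
Lemma influence_avg_le q j k f : 1 < q -> j != k -> bmeas f ->
  influence q j (avg k f) <= influence q j f.
Proof.
move=> q1 jk bf; have q0 : 0 <= q by lra.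
have bG := bmeas_integral mu mu (bmeas_diff_powR j q0 bf).
rewrite {2}/influence -(mu_inv k bG).
(* In [H (u, v, y)], [v] supplies the new coordinate [j] and [y] the new coordinate [k]. The
   right-hand side has just been rewritten, by invariance, with coordinate [k] resampled as well. *)
pose H (w : S * S * S) := `|f (resample k (w.1.1, w.2)) -
  f (resample j (resample k (w.1.1, w.2), w.1.2))| `^ q.
have mk : measurable_fun setT (fun w : S * S * S => resample k (w.1.1, w.2)).
  apply: (measurableT_comp (measurable_resample k)).
  apply: measurable_fun_pair; last exact: measurable_snd.
  exact: (measurableT_comp measurable_fst measurable_fst).
have bH : bmeas H.
  apply: (@bmeas_comp _ _ _ _ _ (fun w : S * S => `|f w.1 - f (resample j w)| `^ q)
    (fun w : S * S * S => (resample k (w.1.1, w.2), w.1.2))).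
    exact: bmeas_diff_powR.
  apply: measurable_fun_pair => //.
  exact: (measurableT_comp measurable_snd measurable_fst).
have bH1 := bmeas_integral (mu \x mu)%E mu bH.
have bH' u : bmeas (fun w : S * S => H (u, w.1, w.2)).
  apply: (bmeas_comp bH); apply: measurable_fun_pair => //=.
  by apply: measurable_fun_pair => //; exact: measurable_cst.
apply: (@le_trans _ _ (\int[mu]_u \int[mu]_v \int[mu]_y H (u, v, y))).
  apply: exp_le.
  - exact: (bmeas_integral mu mu (bmeas_diff_powR j q0 (bmeas_avg k bf))).
  - exact: (bmeas_integral mu mu bH1).
  move=> u; apply: exp_le.
  - exact: (bmeas_section1 u (bmeas_diff_powR j q0 (bmeas_avg k bf))).
  - exact: (bmeas_section1 u bH1).
  move=> v.
  have b1 := bmeas_resample1 k u bf.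
  have b2 := bmeas_resample1 k (resample j (u, v)) bf.
  have := exp_jensen mu q1 (bmeasB b1 b2).
  rewrite (expB mu b1 b2) -/(avg k f u) -/(avg k f _) => h.
  apply: (le_trans h); rewrite le_eqVlt; apply/orP; left; apply/eqP.
  by apply: eq_Rintegral => y _; rewrite /H /= (resampleC _ _ _ jk).
rewrite le_eqVlt; apply/orP; left; apply/eqP.
by apply: eq_Rintegral => u _; exact: (bmeas_fubini mu mu (bH' u)).
Qed.

(** Coordinates 0, ..., n - 1 are averaged out, 0 first. For a past sequence this removes the newest
    innovations, so increasing [n] conditions on an ever more remote past. *)
Fixpoint avgs n f := if n is n'.+1 then avg n' (avgs n' f) else f.

Lemma bmeas_avgs n f : bmeas f -> bmeas (avgs n f).
Proof. by move=> bf; elim: n => //= n IH; exact: bmeas_avg. Qed.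

Lemma exp_avgs n f : bmeas f -> E (avgs n f) = E f.
Proof. by move=> bf; elim: n => //= n <-; apply: exp_avg; exact: bmeas_avgs. Qed.

Lemma influence_avgs_le q j n f : 1 < q -> (n <= j)%N -> bmeas f ->
  influence q j (avgs n f) <= influence q j f.
Proof.
move=> q1 nj bf; elim: n nj => [_|n IH nj]; first exact: lexx.
apply: le_trans (IH (ltnW nj)); apply: influence_avg_le => //.
  by rewrite gtn_eqF.
exact: bmeas_avgs.
Qed.

Lemma insensitive_avgs j n f : (j < n)%N -> insensitive j (avgs n f).
Proof.
elim: n => // n IH; rewrite ltnS leq_eqVlt => /predU1P[->|jn] /=.
  exact: insensitive_avg.
by apply: insensitive_avgC; [rewrite ltn_eqF|exact: IH].
Qed.

(** The orthogonality hypothesis removes the linear term of the expansion, and [mixed_power_le]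
    divides the second-order term between the two moments. *)
Lemma exp_powR_normD_le q a b th : 2 < q -> 0 < th -> bmeas a -> bmeas b ->
  \int[mu]_u (signed_powR q (a u) * b u) = 0 ->
  \int[mu]_u `|a u + b u| `^ q <=
    (1 + expansion_cst q * th) * \int[mu]_u `|a u| `^ q +
    expansion_cst q * (th `^ (1 - q / 2) + 1) * \int[mu]_u `|b u| `^ q.
Proof.
move=> q2 th0 ba bb ab0; have q0 : 0 <= q by lra.
have q1 : 1 < q by lra.
have c0 : 0 <= expansion_cst q.
  by apply: (le_trans ler01); apply: expansion_cst_ge1; lra.
have bpa := bmeas_powR q0 ba; have bpb := bmeas_powR q0 bb.
have bs := bmeasM (bmeas_signed_powR q1 ba) bb.
set K := expansion_cst q in c0 *; set L := th `^ _.
apply: (@le_trans _ _ (\int[mu]_u ((1 + K * th) * `|a u| `^ q +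
    (q * (signed_powR q (a u) * b u) + K * (L + 1) * `|b u| `^ q)))).
  apply: exp_le.
  - by apply: bmeas_powR => //; exact: bmeasD.
  - by apply: bmeasD; [exact: bmeasZ|apply: bmeasD; exact: bmeasZ].
  move=> u; apply: (le_trans (powR_normD_le _ _ q2)).
  have := ler_wpM2l c0 (mixed_power_le (a u) (b u) q2 th0).
  by rewrite -/K -/L; lra.
rewrite (@expD _ _ _ mu (fun u => _ * _) (fun u => _ + _)); last 2 first.
- exact: bmeasZ.
- by apply: bmeasD; exact: bmeasZ.
rewrite (@expD _ _ _ mu (fun u => _ * _) (fun u => _ * _)); [|exact: bmeasZ..].
by rewrite !expZ// ab0 mulr0 add0r.
Qed.

(** Adding [2 * M] on both sides absorbs the additive error and leaves a purely multiplicative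
    recursion. *)
Lemma recursion_step (K t M e0 e1 B : R) : 0 <= K -> 0 <= t -> 0 <= M ->
  e0 <= (1 + K * t) * e1 + B -> B <= K * (2 * t * M) ->
  e0 + 2 * M <= (1 + K * t) * (e1 + 2 * M).
Proof. by move=> K0 t0 M0; have := mulr_ge0 K0 t0; lra. Qed.

(** The difference is a telescoping sum of increments, each orthogonal to functions of the later
    coordinates. A weight [th k] proportional to the share of [beta k] in the total makes every
    additive error a multiple of [th k], so the factors multiply to at most the exponential of the
    constant. *)
Lemma efron_stein_moment (q : R) f (beta : nat -> R) (V : R) n :
  2 < q -> bmeas f -> (forall k, 0 <= beta k) ->
  (forall k, influence q k f <= beta k `^ (q / 2)) ->
  0 <= V -> \sum_(k < n) beta k <= V ->
  \int[mu]_u `|f u - avgs n f u| `^ q <=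
    2 * expR (expansion_cst q) * (V + 1) `^ (q / 2).
Proof.
move=> q2 bf beta0 infl V0 betaV; have q0 : 0 <= q by lra.
have q1 : 1 < q by lra.
have r1 : 1 <= q / 2 by lra.
set K := expansion_cst q; have K0 : 0 <= K.
  by apply: (le_trans ler01); apply: expansion_cst_ge1; lra.
case: n betaV => [|m] betaV.
  rewrite /=; under eq_Rintegral do rewrite subrr normr0 powR0 ?(gt_eqF (lt_trans ltr01 q1))//.
  by rewrite exp_cst !mulr_ge0 ?expR_ge0 ?powR_ge0.
set n := m.+1 in betaV *.
have W0 : 0 < V + 1 by lra.
(* The term 1 / n keeps the weight positive where [beta k] vanishes; summed over [n] coordinates it
   adds 1, which explains [V + 1]. By construction [beta k <= th k * (V + 1)]. *)
pose th k := (beta k + n%:R^-1) / (V + 1).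
have n0 : 0 < n%:R^-1 :> R by rewrite invr_gt0.
have th0 k : 0 < th k by rewrite divr_gt0// ltr_wpDl.
have sum_th : \sum_(k < n) th k <= 1.
  rewrite -mulr_suml ler_pdivrMr// mul1r big_split /= lerD//.
  by rewrite sumr_const card_ord -[leLHS]mulr_natr mulVf// pnatr_eq0.
have th1 k : (k < n)%N -> th k <= 1.
  move=> kn; apply: le_trans sum_th.
  rewrite (bigD1 (Ordinal kn)) //= lerDl; apply: sumr_ge0 => i _; exact: ltW.
pose M := (V + 1) `^ (q / 2).
have M0 : 0 <= M by exact: powR_ge0.
pose e j := \int[mu]_u `|avgs j f u - avgs n f u| `^ q.
(* Downward induction from [n], where the difference is zero; each factor [1 + K * th k] is bounded
   by an exponential, so that the exponents add up. *)
suff key j : (j <= n)%N ->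
    e (n - j)%N + 2 * M <= expR (K * \sum_(n - j <= k < n) th k) * (2 * M).
  have := key n (leqnn n); rewrite subnn /e /= => h.
  have {h} : \int[mu]_u `|f u - avgs n f u| `^ q <=
      expR (K * \sum_(0 <= k < n) th k) * (2 * M) by lra.
  move=> h; apply: (le_trans h); rewrite mulrCA mulrA ler_wpM2r//.
  rewrite ler_wpM2l// ler_expR big_mkord.
  by rewrite -[leRHS]mulr1 ler_wpM2l.
elim: j => [_|j IH jn].
  rewrite subn0 big_geq// mulr0 expR0 mul1r gerDr /e.
  under eq_Rintegral do rewrite subrr normr0 powR0 ?(gt_eqF (lt_trans ltr01 q1))//.
  by rewrite exp_cst.
have := IH (ltnW jn).
rewrite -(subnSK jn).
set i := (n - j.+1)%N; have iN : (i < n)%N by rewrite ltn_subrL.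
move=> {}IH.
have ba : bmeas (fun u => avgs i.+1 f u - avgs n f u).
  by apply: bmeasB; exact: bmeas_avgs.
have bb : bmeas (fun u => avgs i f u - avgs i.+1 f u).
  by apply: bmeasB; exact: bmeas_avgs.
(* What is still to be removed no longer depends on coordinate [i], hence is orthogonal to the
   increment at [i]. *)
have orth : \int[mu]_u (signed_powR q (avgs i.+1 f u - avgs n f u) *
    (avgs i f u - avgs i.+1 f u)) = 0.
  have hi : insensitive i (fun u => signed_powR q (avgs i.+1 f u - avgs n f u)).
    by move=> u v; rewrite (insensitive_avgs f (ltnSn i)) (insensitive_avgs f iN).
  exact: (exp_insensitive_mul (bmeas_signed_powR q1 ba) (bmeas_avgs i bf) hi).
have := exp_powR_normD_le q2 (th0 i) ba bb orth.
have -> : \int[mu]_u `|avgs i.+1 f u - avgs n f u + (avgs i f u - avgs i.+1 f u)| `^ q = e i.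
  by apply: eq_Rintegral => u _; congr (`| _ | `^ _); ring.
rewrite -/(e i.+1) -/K => h.
have hb : \int[mu]_u `|avgs i f u - avgs i.+1 f u| `^ q <= th i `^ (q / 2) * M.
  apply: (le_trans (exp_avg_diff_le i q1 (bmeas_avgs i bf))).
  apply: (le_trans (influence_avgs_le q1 (leqnn i) bf)).
  apply: (le_trans (infl i)); rewrite -powRM ?(ltW W0) ?(ltW (th0 i))//.
  rewrite divfK ?gt_eqF//; apply: ge0_ler_powR; rewrite ?nnegrE ?divr_ge0//.
    by rewrite addr_ge0// ltW.
  by rewrite lerDl ltW.
(* In the first term the exponents of [th i] add up to 1; the second uses [th i <= 1] together with
   [1 <= q / 2]. *)
have h2 : K * (th i `^ (1 - q / 2) + 1) * \int[mu]_u `|avgs i f u - avgs i.+1 f u| `^ q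
    <= K * (2 * th i * M).
  rewrite -mulrA ler_wpM2l//.
  apply: (@le_trans _ _ ((th i `^ (1 - q / 2) + 1) * (th i `^ (q / 2) * M))).
    by rewrite ler_wpM2l// addr_ge0 ?powR_ge0.
  rewrite mulrA ler_wpM2r// mulrDl mul1r -powRD ?subrK; last first.
    by rewrite (gt_eqF (th0 i)) implybT.
  have -> : th i `^ 1 = th i by rewrite powRr1 ?(ltW (th0 i)).
  rewrite mulr_natl mulr2n lerD2l.
  by apply: ge1r_powR; rewrite ?th0 ?th1.
rewrite [in leRHS]big_ltn// mulrDr expRD.
apply: (@le_trans _ _ ((1 + K * th i) * (e i.+1 + 2 * M))).
  by apply: (recursion_step K0 (ltW (th0 i)) M0 h h2).
rewrite -mulrA; apply: ler_pM => //.
- exact: addr_ge0 ler01 (mulr_ge0 K0 (ltW (th0 i))).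
- rewrite addr_ge0 ?mulr_ge0// /e; apply: Rintegral_ge0 => u _; exact: powR_ge0.
- exact: expR_ge1Dx.
Qed.

End efron_stein.

Lemma cvge0_lt (R : realType) (u : nat -> \bar R) (e : R) : 0 < e ->
  u n @[n --> \oo] --> 0%E -> \forall n \near \oo, (u n < e%:E)%E.
Proof.
move=> e0 /fine_cvgP[fu cu]; near=> n.
have fn : u n \is a fin_num by near: n.
rewrite -(fineK fn) lte_fin.
by near: n; apply: (cvgr_lt (0 : R)).
Unshelve. all: by end_near. Qed.

(** * Approximation in L1 by functions of finitely many coordinates *)

Section cylinder_approximation.
Variables (R : realType) (mu : probability (seqR R) R).
Local Notation S := (seqR R).
Implicit Types (f g h : S -> R) (Q : nat -> Prop).
Local Notation E f := (\int[mu]_u f u).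

Definition depends_on Q f := forall u v : S, (forall i, Q i -> u i = v i) -> f u = f v.

Lemma depends_on_avg k Q f : depends_on Q f ->
  depends_on (fun i => Q i /\ i <> k) (avg mu k f).
Proof.
move=> fQ u v uv; apply: eq_Rintegral => y _; apply: fQ => i Qi.
by rewrite /resample; case: eqP => // ik; exact: uv.
Qed.

Lemma depends_on_avgs n Q f : depends_on Q f ->
  depends_on (fun i => Q i /\ (n <= i)%N) (avgs mu n f).
Proof.
move=> fQ; elim: n => [|n IH] u v uv; first by apply: fQ => i Qi; exact: uv.
apply: (depends_on_avg IH) => i [[Qi ni] /eqP nei]; apply: uv; split => //.
by rewrite ltn_neqAle eq_sym nei.
Qed.

Definition cylindrical f := bmeas f /\ exists K, depends_on (fun i => (i < K)%N) f.

Definition approximable f := bmeas f /\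
  forall e : R, 0 < e -> exists2 g, cylindrical g & \int[mu]_u `|f u - g u| <= e.

Lemma cylindrical_cst (a : R) : cylindrical (fun=> a).
Proof. by split; [exact: bmeas_cst | exists 0%N]. Qed.

Lemma cylindrical_op (op : R -> R -> R) f g :
  (bmeas f -> bmeas g -> bmeas (fun u => op (f u) (g u))) ->
  cylindrical f -> cylindrical g -> cylindrical (fun u => op (f u) (g u)).
Proof.
move=> bop [bf [K fK]] [bg [L gL]]; split; first exact: bop.
exists (maxn K L) => u v uv; congr op; [apply: fK|apply: gL] => i iK; apply: uv;
by rewrite leq_max iK ?orbT.
Qed.

Lemma cylindrical_approximable f : cylindrical f -> approximable f.
Proof.
move=> cf; split; first by have [] := cf.
move=> e e0; exists f => //.
by under eq_Rintegral do rewrite subrr normr0; rewrite exp_cst ltW.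
Qed.

Lemma approximable_closed f : bmeas f ->
  (forall e : R, 0 < e -> exists2 g, approximable g & \int[mu]_u `|f u - g u| <= e) ->
  approximable f.
Proof.
move=> bf ag; split => // e e0.
have e20 : 0 < e / 2 by rewrite divr_gt0.
have [g [bg /(_ _ e20)[h ch gh]] fg] := ag _ e20; exists h => //.
have bh : bmeas h by have [] := ch.
apply: (@le_trans _ _ (\int[mu]_u (`|f u - g u| + `|g u - h u|))).
  apply: exp_le.
  - by apply/bmeas_norm/bmeasB.
  - by apply: bmeasD; apply/bmeas_norm/bmeasB.
  - by move=> u; rewrite -[f u - h u](subrKA (g u)) ler_normD.
by rewrite expD; [lra|apply/bmeas_norm/bmeasB..].
Qed.

Lemma approximableM f g : approximable f -> approximable g ->
  approximable (fun u => f u * g u).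
Proof.
move=> [bf af] [bg ag]; apply: approximable_closed; first exact: bmeasM.
move=> e e0; have e20 : 0 < e / 2 by rewrite divr_gt0.
have [_ [K fK]] := bf.
have K0 : 0 < `|K| + 1 by rewrite ltr_wpDl.
have [|g' cg' gg'] := ag (e / 2 / (`|K| + 1)); first by rewrite divr_gt0.
have [bg' _] := cg'; have [_ [L gL]] := bg'.
have L0 : 0 < `|L| + 1 by rewrite ltr_wpDl.
have [|f' cf' ff'] := af (e / 2 / (`|L| + 1)); first by rewrite divr_gt0.
have [bf' _] := cf'.
exists (fun u => f' u * g' u).
  by apply: cylindrical_approximable; apply: (cylindrical_op _ cf' cg'); exact: bmeasM.
have b1 : bmeas (fun u => (`|K| + 1) * `|g u - g' u|).
  by apply/bmeasZ/bmeas_norm/bmeasB.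
have b2 : bmeas (fun u => (`|L| + 1) * `|f u - f' u|).
  by apply/bmeasZ/bmeas_norm/bmeasB.
apply: (@le_trans _ _ (\int[mu]_u ((`|K| + 1) * `|g u - g' u| +
    (`|L| + 1) * `|f u - f' u|))).
  apply: exp_le; [|exact: bmeasD|].
    by apply/bmeas_norm/bmeasB; exact: bmeasM.
  move=> u.
  have -> : f u * g u - f' u * g' u = f u * (g u - g' u) + g' u * (f u - f' u) by ring.
  apply: (le_trans (ler_normD _ _)); rewrite !normrM.
  apply: lerD; apply: ler_wpM2r => //.
    by rewrite (le_trans (fK u))// (le_trans (ler_norm K)) ?lerDl.
  by rewrite (le_trans (gL u))// (le_trans (ler_norm L)) ?lerDl.
rewrite expD// !expZ; [|by apply/bmeas_norm/bmeasB..].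
rewrite [e]splitr; apply: lerD.
  by rewrite mulrC -ler_pdivlMr.
by rewrite mulrC -ler_pdivlMr.
Qed.

Lemma approximableD f g : approximable f -> approximable g ->
  approximable (fun u => f u + g u).
Proof.
move=> [bf af] [bg ag]; split; first exact: bmeasD.
move=> e e0; have e20 : 0 < e / 2 by rewrite divr_gt0.
have [f' cf' ff'] := af _ e20; have [g' cg' gg'] := ag _ e20.
have [bf' _] := cf'; have [bg' _] := cg'.
exists (fun u => f' u + g' u).
  by apply: (cylindrical_op _ cf' cg'); exact: bmeasD.
apply: (@le_trans _ _ (\int[mu]_u (`|f u - f' u| + `|g u - g' u|))).
  apply: exp_le.
  - by apply/bmeas_norm/bmeasB; exact: bmeasD.
  - by apply: bmeasD; apply/bmeas_norm/bmeasB.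
  - move=> u.
    have -> : f u + g u - (f' u + g' u) = (f u - f' u) + (g u - g' u) by ring.
    exact: ler_normD.
by rewrite expD; [lra|apply/bmeas_norm/bmeasB..].
Qed.

Lemma approximable_cst (a : R) : approximable (fun=> a).
Proof. exact/cylindrical_approximable/cylindrical_cst. Qed.

Lemma bounded_convergence (f_ : nat -> S -> R) f (K : R) :
  (forall n, bmeas (f_ n)) -> bmeas f -> (forall n u, `|f_ n u| <= K) ->
  (forall u, f_ n u @[n --> \oo] --> f u) ->
  forall e : R, 0 < e -> exists n, \int[mu]_u `|f u - f_ n u| <= e.
Proof.
move=> bf_ bf fK fcv e e0.
have mf_ n : measurable_fun setT (EFin \o f_ n).
  by apply/measurable_EFinP; have [] := bf_ n.
have mf : measurable_fun setT (EFin \o f) by apply/measurable_EFinP; have [] := bf.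
have cv : {ae mu, forall u, setT u -> (EFin \o f_ n) u @[n --> \oo] --> (EFin \o f) u}.
  by apply: aeW => u _; apply/fine_cvgP; split; [exact: nearW|exact: fcv].
have dom : {ae mu, forall u n, setT u -> (`|(EFin \o f_ n) u| <= (EFin \o cst K) u)%E}.
  by apply: aeW => u n _; rewrite /= lee_fin.
have iK := finite_measure_integrable_cst mu K measurableT.
have [_] := dominated_convergence measurableT mf_ mf cv iK dom.
move=> + _.
move=> /(cvge0_lt e0)[N _ /(_ N (leqnn N)) /= h]; exists N.
rewrite -lee_fin bmeas_EFin; last by apply/bmeas_norm/bmeasB.
apply: le_trans (ltW h); rewrite le_eqVlt; apply/orP; left; apply/eqP.
by apply: eq_integral => u _; rewrite distrC.
Qed.

(** The sets with approximable indicator form a sigma-algebra containing the coordinate preimages: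
    sums and products of approximable functions give complements and intersections, bounded
    convergence gives countable unions. *)
Lemma approximable_indic (A : set S) : measurable A -> approximable (\1_A : S -> R).
Proof.
move: A; apply: (@smallest_sub _ (sigma_algebra setT) (@coordinate_preimages R)
  [set A | approximable (\1_A : S -> R)]); last first.
  move=> _ [k [B [mB ->]]] /=; apply: cylindrical_approximable; split.
    split; last by exists 1 => u; rewrite indicE; case: (_ \in _); rewrite ?normr1 ?normr0.
    apply: measurable_indic.
    by rewrite -[X in measurable X]setTI; exact: (measurable_coordinate k).
  exists k.+1 => u v uv; rewrite !indicE; congr (nat_of_bool _)%:R.
  by apply/idP/idP => /set_mem /= h; apply/mem_set; move: h; rewrite /= uv.
have comp A : approximable (\1_A : S -> R) -> approximable (\1_(~` A) : S -> R).
  move=> aA.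
  have := approximableD (approximable_cst 1) (approximableM (approximable_cst (-1)) aA).
  congr approximable; apply/funext => u.
  by rewrite !indicE in_setC; case: (u \in A); rewrite /= ?mulr1 ?mulr0 ?subrr ?addr0.
have inter A B : approximable (\1_A : S -> R) -> approximable (\1_B : S -> R) ->
    approximable (\1_(A `&` B) : S -> R).
  move=> aA aB; have := approximableM aA aB; congr approximable; apply/funext => u.
  by rewrite !indicE in_setI; case: (u \in A); case: (u \in B); rewrite /= ?mulr1 ?mulr0.
split.
- by rewrite /=; have := approximable_cst 0; congr approximable; apply/funext => u;
    rewrite indic0.
- by move=> A /=; rewrite setTD; exact: comp.
- move=> A aA /=.
  have aU n : approximable (\1_(\big[setU/set0]_(i < n) A i) : S -> R).
    elim: n => [|n IH].
      rewrite big_ord0; have := approximable_cst 0; congr approximable; apply/funext => u.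
      by rewrite indic0.
    rewrite big_ord_recr /=; move: IH; set U := \big[setU/set0]_(i < n) A i => IH.
    have -> : U `|` A n = ~` (~` U `&` ~` A n) by rewrite setCI !setCK.
    by apply: (comp); apply: inter; apply: comp => //; exact: aA.
  have cvU u : \1_(\big[setU/set0]_(i < n) A i) u @[n --> \oo] -->
      (\1_(\bigcup_k A k) u : R).
    have [[k _ Aku]|nAu] := pselect ((\bigcup_k A k) u).
      apply: cvg_near_cst; exists k.+1 => // n /= kn.
      rewrite !indicE !mem_set//; first by exists k.
      by rewrite -bigcup_mkord; exists k.
    apply: cvg_near_cst; exists 0%N => // n _ /=.
    rewrite !indicE !memNset// -bigcup_mkord => -[k _ Aku]; apply: nAu.
    by exists k.
  have b1 (B : set S) u : `|\1_B u : R| <= 1.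
    by rewrite indicE; case: (_ \in _); rewrite ?normr1 ?normr0.
  have bU : bmeas (\1_(\bigcup_k A k) : S -> R).
    split; last by exists 1 => u; exact: b1.
    have mU n : measurable_fun setT (\1_(\big[setU/set0]_(i < n) A i) : S -> R).
      by have [[]] := aU n.
    exact: (measurable_fun_cvg mU (fun u _ => cvU u)).
  apply: approximable_closed => // e e0.
  have [n hn] := bounded_convergence (fun n => (aU n).1) bU (fun n u => b1 _ u) cvU e0.
  by exists (\1_(\big[setU/set0]_(i < n) A i)).
Qed.

Import HBSimple.

Lemma bmeas_approximable f : bmeas f -> approximable f.
Proof.
move=> bf; apply: approximable_closed => // e e0.
have [g_ [gi gcv]] := approximation_sfun_integrable measurableT (bmeas_integrable mu bf).
move=> /(cvge0_lt e0)[N _ /(_ N (leqnn N)) /= h].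
have ag : approximable (fun u => g_ N u).
  have -> : (fun u => g_ N u) = fun u =>
      \sum_(y <- fset_set (range (g_ N))) y * \1_(g_ N @^-1` [set y]) u.
    by apply/funext => u; rewrite fimfunE fsbig_finite.
  elim: (finmap.enum_fset (fset_set (range (g_ N)))) => [|y s IH].
    by under eq_fun do rewrite big_nil; exact: approximable_cst.
  under eq_fun do rewrite big_cons; apply: approximableD => //.
  apply: approximableM; first exact: approximable_cst.
  by apply: approximable_indic; exact: measurable_funPTI.
exists (fun u => g_ N u) => //.
rewrite -lee_fin bmeas_EFin; last by apply/bmeas_norm/bmeasB => //; have [] := ag.
by apply: le_trans (ltW h).
Qed.

End cylinder_approximation.

Section markov_inequality.
Context d (T : measurableType d) (R : realType) (mu : probability T R).

Lemma markov_norm (h : T -> R) (c : R) : measurable_fun setT h -> 0 < c ->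
  (c%:E * mu [set x | (c < `|h x|)%R] <= \int[mu]_x `|h x|%:E)%E.
Proof.
move=> mh c0; set B := [set x | _].
have mnh : measurable_fun setT (fun x => `|h x|) by exact: measurableT_comp.
have mB : measurable B.
  have -> : B = (fun x => `|h x|) @^-1` `]c, +oo[.
    by apply/seteqP; split => x /=; rewrite in_itv/= andbT.
  by rewrite -[X in measurable X]setTI; apply: mnh.
rewrite -integral_cst//.
apply: (@le_trans _ _ (\int[mu]_(x in B) `|h x|%:E)%E).
  apply: ge0_le_integral => //.
  - by move=> x _; rewrite lee_fin ltW.
  - exact/measurable_EFinP/measurable_funTS.
  - by move=> x; rewrite /B /= lee_fin => /ltW.
by apply: ge0_subset_integral => //; exact/measurable_EFinP.
Qed.

Lemma probability_exp_indic (A : set T) : measurable A ->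
  mu A = (\int[mu]_x (\1_A x : R))%:E.
Proof.
move=> mA; rewrite bmeas_EFin; last first.
  split; first exact: measurable_indic.
  by exists 1 => x; rewrite indicE; case: (_ \in _); rewrite ?normr1 ?normr0.
by rewrite integral_indic// setIT.
Qed.

End markov_inequality.

(** * Concentration of a function of independent coordinates around its mean *)

Section concentration.
Variables (R : realType) (mu : probability (seqR R) R).
Local Notation S := (seqR R).
Hypothesis mu_inv : resampling_invariant mu.
Implicit Types (f g : S -> R).
Local Notation E f := (\int[mu]_u f u).

(** Averaging is a contraction of L1: the modulus moves inside the average, and averaging preserves
    the expectation. *)
Lemma exp_avgs_dist_le n f g : bmeas f -> bmeas g ->
  \int[mu]_u `|avgs mu n f u - avgs mu n g u| <= \int[mu]_u `|f u - g u|.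
Proof.
move=> bf bg; elim: n => [|n IH]; first exact: lexx.
apply: le_trans IH.
have bfn := bmeas_avgs mu n bf; have bgn := bmeas_avgs mu n bg.
have bd := bmeas_norm (bmeasB bfn bgn).
rewrite -[leRHS](exp_avg mu_inv n bd); apply: exp_le.
- by apply: bmeas_norm; apply: bmeasB; exact: (@bmeas_avgs _ mu n.+1).
- exact: bmeas_avg.
move=> u.
have b1 := bmeas_resample1 n u bfn; have b2 := bmeas_resample1 n u bgn.
have := exp_norm_le mu (bmeasB b1 b2).
by rewrite (expB mu b1 b2).
Qed.

(* The tail sigma-algebra is trivial: an L1-approximation of [f] by a function of
   finitely many coordinates is sent to a constant by [avgs n] once [n] is large. *)
Lemma exp_avgs_dist_exp f (e : R) : bmeas f -> 0 < e ->
  exists n, \int[mu]_u `|avgs mu n f u - E f| <= e.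
Proof.
move=> bf e0; have [_ /(_ (e / 2))] := bmeas_approximable mu bf.
rewrite divr_gt0// => /(_ isT)[g [bg [K gK]] fg]; exists K.
have bfK := bmeas_avgs mu K bf; have bgK := bmeas_avgs mu K bg.
have gc u : avgs mu K g u = E g.
  rewrite -(exp_avgs mu_inv K bg) -[LHS](exp_cst mu); apply: eq_Rintegral => v _.
  by apply: (depends_on_avgs mu gK) => i [iK Ki]; rewrite ltnNge Ki in iK.
have gf : `|E g - E f| <= e / 2.
  rewrite distrC -(expB mu bf bg); apply: le_trans fg.
  exact: (exp_norm_le mu (bmeasB bf bg)).
have bd := bmeas_norm (bmeasB bfK bgK).
apply: (@le_trans _ _ (\int[mu]_u (`|avgs mu K f u - avgs mu K g u| + e / 2))).
  apply: exp_le.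
  - by apply: bmeas_norm; apply: bmeasB => //; exact: bmeas_cst.
  - by apply: bmeasD => //; exact: bmeas_cst.
  move=> u; rewrite -[avgs mu K f u - E f](subrKA (avgs mu K g u)).
  by apply: (le_trans (ler_normD _ _)); rewrite gc; apply: lerD.
rewrite (@expD _ _ _ mu _ (cst (e / 2)))//; last exact: bmeas_cst.
rewrite exp_cst; have := exp_avgs_dist_le K bf bg; lra.
Qed.

(** The power of 2 comes from Markov's inequality at level [eta / 2], the other factor from
    [efron_stein_moment]. *)
Definition concentration_cst (q : R) : R := 2 `^ q * (2 * expR (expansion_cst q)).

(** [f - E f] is split at [avgs mu n f]. The moment inequality controls the first part uniformly in
    [n]; the second is arbitrarily small in L1 for a suitable [n] and contributes only the slack
    [e]. *)
Lemma concentration_bounded (q : R) f (beta : nat -> R) (V eta : R) :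
  2 < q -> bmeas f -> (forall k, 0 <= beta k) ->
  (forall k, influence mu q k f <= beta k `^ (q / 2)) ->
  0 <= V -> (forall n, \sum_(k < n) beta k <= V) -> 0 < eta ->
  (mu [set u | (eta < `|f u - E f|)%R] <=
    (concentration_cst q * (V + 1) `^ (q / 2) * eta `^ (- q))%:E)%E.
Proof.
move=> q2 bf beta0 infl V0 betaV eta0; have q0 : 0 <= q by lra.
set A := [set u | _].
have bfE : bmeas (fun u => `|f u - E f|).
  by apply: bmeas_norm; apply: bmeasB => //; exact: bmeas_cst.
have mA : measurable A.
  have -> : A = (fun u => `|f u - E f|) @^-1` `]eta, +oo[.
    by apply/seteqP; split => x /=; rewrite in_itv/= andbT.
  by rewrite -[X in measurable X]setTI; apply: bfE.1.
have bA : bmeas (\1_A : S -> R).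
  split; first exact: measurable_indic.
  by exists 1 => x; rewrite indicE; case: (_ \in _); rewrite ?normr1 ?normr0.
rewrite (probability_exp_indic mu mA) lee_fin; apply/ler_addgt0Pr => e e0.
have [|n hn] := exp_avgs_dist_exp (e := e * (eta / 2)) bf.
  by rewrite mulr_gt0// divr_gt0.
have bn := bmeas_avgs mu n bf.
have h := efron_stein_moment mu_inv q2 bf beta0 infl V0 (betaV n).
set c := 2 `^ q * eta `^ (- q).
have c0 : 0 <= c by rewrite mulr_ge0 ?powR_ge0.
have b1 : bmeas (fun u => `|f u - avgs mu n f u| `^ q).
  by apply: bmeas_powR => //; exact: bmeasB.
have b2 : bmeas (fun u => `|avgs mu n f u - E f|).
  by apply: bmeas_norm; apply: bmeasB => //; exact: bmeas_cst.
(* The indicator is dominated pointwise: on the event one of the two parts is at least [eta / 2],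
   which makes the corresponding summand at least 1. *)
apply: (@le_trans _ _ (\int[mu]_u (c * `|f u - avgs mu n f u| `^ q +
    (2 / eta) * `|avgs mu n f u - E f|))).
  apply: exp_le => //; first by apply: bmeasD; exact: bmeasZ.
  move=> u; rewrite indicE; have [uA|uA] := boolP (u \in A); last first.
    by rewrite addr_ge0// mulr_ge0 ?powR_ge0// divr_ge0// ltW.
  move: uA => /set_mem; rewrite /A /= => uA.
  have [h1|h1] := lerP (eta / 2) `|f u - avgs mu n f u|.
    rewrite -[leLHS]addr0; apply: lerD; last by rewrite mulr_ge0// divr_ge0// ltW.
    have -> : c = (eta / 2) `^ (- q).
      by rewrite powRM ?(ltW eta0) ?invr_ge0// mulrC -powR_inv1// -powRrM mulN1r opprK.
    rewrite powRN mulrC ler_pdivlMr ?powR_gt0 ?divr_gt0// mul1r.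
    by apply: ge0_ler_powR; rewrite ?nnegrE// ltW// divr_gt0.
  rewrite -[leLHS]add0r; apply: lerD; first by rewrite mulr_ge0 ?powR_ge0.
  rewrite mulrAC ler_pdivlMr// mul1r.
  have := ler_normD (f u - avgs mu n f u) (avgs mu n f u - E f).
  rewrite subrKA; lra.
rewrite (@expD _ _ _ mu (fun u => _ * _) (fun u => _ * _)); [|exact: bmeasZ..].
rewrite !expZ//; apply: lerD.
  rewrite /concentration_cst.
  rewrite (_ : _ * eta `^ (- q) =
    c * (2 * expR (expansion_cst q) * (V + 1) `^ (q / 2))); last by rewrite /c; ring.
  exact: ler_wpM2l.
have -> : e = (2 / eta) * (e * (eta / 2)) by field; exact: lt0r_neq0.
by apply: ler_wpM2l => //; rewrite divr_ge0// ltW.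
Qed.

Definition clamp (K x : R) : R := Num.max (- K) (Num.min x K).

Lemma norm_clamp_le K x : 0 <= K -> `|clamp K x| <= K.
Proof.
move=> K0; rewrite ler_norml le_max lexx /= ge_max ge_min lexx orbT andbT.
by lra.
Qed.

(** The reason for truncating in this way: no influence of a coordinate increases, so the bounds
    [beta] remain valid for the truncated function. *)
Lemma clamp_lip K x y : `|clamp K x - clamp K y| <= `|x - y|.
Proof.
have := ler_norm (x - y); have := ler_norm (- (x - y)).
rewrite normrN => h1 h2; rewrite ler_norml /clamp; apply/andP.
case: (leP x K) => hx; case: (leP y K) => hy.
- by case: (leP (- K) x) => ?; case: (leP (- K) y) => ?; split; lra.
- by case: (leP (- K) x) => ?; case: (leP (- K) K) => ?; split; lra.
- by case: (leP (- K) K) => ?; case: (leP (- K) y) => ?; split; lra.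
- by case: (leP (- K) K) => ?; split; lra.
Qed.

Lemma clamp_id K x : `|x| <= K -> clamp K x = x.
Proof.
rewrite ler_norml => /andP[? ?].
by rewrite /clamp min_l// max_r.
Qed.

Lemma clamp0_le K x : 0 <= K -> `|clamp K x| <= `|x|.
Proof.
move=> K0; have := clamp_lip K x 0; rewrite (@clamp_id K 0) ?normr0//.
by rewrite !subr0.
Qed.

Lemma measurable_clamp K : measurable_fun [set: R] (clamp K).
Proof.
apply: measurable_maxr; first exact: measurable_cst.
by apply: measurable_minr; [exact: measurable_id|exact: measurable_cst].
Qed.

(** Truncate [f] at a high level [N]. Of the deviation [eta], one half is left to the truncated
    function, one quarter to the truncation error and one quarter to the shift of the mean; hence
    the [eta / 2] in the bound. *)
Theorem concentration (q : R) f (beta : nat -> R) (V eta : R) :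
  2 < q -> mu.-integrable setT (EFin \o f) -> (forall k, 0 <= beta k) ->
  (forall k, (\int[(mu \x mu)%E]_z (`|f z.1 - f (resample k z)| `^ q)%:E <=
     (beta k `^ (q / 2))%:E)%E) ->
  0 <= V -> (forall n, \sum_(k < n) beta k <= V) -> 0 < eta ->
  (mu [set u | (eta < `|f u - E f|)%R] <=
    (concentration_cst q * (V + 1) `^ (q / 2) * (eta / 2) `^ (- q))%:E)%E.
Proof.
move=> q2 fi beta0 infl V0 betaV eta0; have q0 : 0 <= q by lra.
have /integrableP[/measurable_EFinP mf _] := fi.
pose g n u := clamp n%:R (f u).
have mg n : measurable_fun setT (g n).
  exact: (measurableT_comp (measurable_clamp n%:R)).
have bg n : bmeas (g n).
  by split => //; exists n%:R => u; exact: norm_clamp_le.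
have gcv u : g n u @[n --> \oo] --> f u.
  apply: cvg_near_cst; near=> n; apply: clamp_id.
  by near: n; exact: nbhs_infty_ger.
have [_ + _] : [/\ mu.-integrable setT (EFin \o f),
    (\int[mu]_u `|(g n u)%:E - (f u)%:E|)%E @[n --> \oo] --> 0%E &
    (\int[mu]_u (g n u)%:E)%E @[n --> \oo] --> (\int[mu]_u (f u)%:E)%E].
  apply: (@dominated_convergence _ _ _ mu setT measurableT (fun n => EFin \o g n)
      (EFin \o f) (fun u => `|(EFin \o f) u|%E)).
  - by move=> n; exact/measurable_EFinP.
  - exact/measurable_EFinP.
  - by apply: aeW => u _; apply/fine_cvgP; split; [exact: nearW|exact: gcv].
  - exact: integrable_abse.
  - by apply: aeW => u n _; rewrite /= lee_fin clamp0_le.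
move=> cv; apply/lee_addgt0Pr => e e0.
(* The first entry bounds the shift of the mean, the second makes Markov's inequality at level
   [eta / 4] cost at most [e]. *)
pose e' := Num.min (eta / 4) (e * (eta / 4)).
have e'0 : 0 < e' by rewrite lt_min (divr_gt0 eta0)// mulr_gt0// divr_gt0.
have [N _ /(_ N (leqnn N)) /= hN] := cvge0_lt e'0 cv.
have iN : (\int[mu]_u `|f u - g N u|%:E < e'%:E)%E.
  apply: le_lt_trans hN; rewrite le_eqVlt; apply/orP; left; apply/eqP.
  by apply: eq_integral => u _; rewrite distrC.
have Egf : `|E (g N) - E f| <= eta / 4.
  have gi := bmeas_integrable mu (bg N).
  rewrite distrC -RintegralB// -lee_fin.
  have fgi : mu.-integrable setT (EFin \o (f \- g N)).
    by rewrite (_ : EFin \o _ = (EFin \o f) \- (EFin \o g N))%E//; exact: integrableB.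
  apply: (le_trans (_ : _ <= \int[mu]_u `|f u - g N u|%:E)%E).
    rewrite EFin_normr_Rintegral//.
    exact: (le_abse_integral mu measurableT (measurable_int _ fgi)).
  by apply: (le_trans (ltW iN)); rewrite lee_fin ge_min lexx.
have inflg k : influence mu q k (g N) <= beta k `^ (q / 2).
  rewrite /influence (bmeas_prod mu mu (bmeas_diff_powR k q0 (bg N))).
  rewrite -lee_fin bmeas_EFin; last exact: bmeas_diff_powR.
  apply: le_trans (infl k); apply: ge0_le_integral => //.
  - by apply/measurable_EFinP; have [] := bmeas_diff_powR k q0 (bg N).
  - apply/measurable_EFinP.
    apply: (measurableT_comp (measurable_powR q)).
    apply: measurableT_comp => //; apply: measurable_funB.
      exact: (measurableT_comp mf measurable_fst).
    exact: (measurableT_comp mf (measurable_resample k)).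
  move=> z _; rewrite lee_fin; apply: ge0_ler_powR; rewrite ?nnegrE//.
  exact: clamp_lip.
have eta20 : 0 < eta / 2 by rewrite divr_gt0.
have h := concentration_bounded q2 (bg N) beta0 inflg V0 betaV eta20.
have mh : measurable_fun setT (fun u => f u - g N u) by exact: measurable_funB.
have eta40 : 0 < eta / 4 by rewrite divr_gt0.
have hm := markov_norm mu mh eta40.
set A := [set u | _]; set A1 := [set u | (eta / 2 < _)%R] in h.
set A2 := [set u | _] in hm.
have mset (a : R) (k : S -> R) : measurable_fun setT k ->
    measurable [set u | a < `|k u|].
  move=> mk; have -> : [set u | a < `|k u|] = (fun u => `|k u|) @^-1` `]a, +oo[.
    by apply/seteqP; split => x /=; rewrite in_itv/= andbT.
  have mnk : measurable_fun setT (fun u => `|k u|) by exact: measurableT_comp.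
  by rewrite -[X in measurable X]setTI; apply: mnk.
have mA1 : measurable A1 by apply: mset; exact: measurable_funB.
have mA2 : measurable A2 by exact: mset.
apply: (@le_trans _ _ (mu (A1 `|` A2))).
  apply: le_measure; rewrite ?inE.
  - by apply: mset; exact: measurable_funB.
  - exact: measurableU.
  move=> u; rewrite /A /A1 /A2 /= => hu.
  apply: contrapT => /not_orP[/negP + /negP]; rewrite -!leNgt => h1 h2.
  have := ler_normD (f u - g N u) (g N u - E (g N) + (E (g N) - E f)).
  have := ler_normD (g N u - E (g N)) (E (g N) - E f).
  rewrite !subrKA; lra.
apply: (le_trans (measureU2 _ mA1 mA2)); apply: leeD => //.
have : ((eta / 4)%:E * mu A2 <= (e * (eta / 4))%:E)%E.
  apply: (le_trans hm); apply: (le_trans (ltW iN)).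
  by rewrite lee_fin ge_min lexx orbT.
have fA2 : mu A2 \is a fin_num by exact: fin_num_measure.
rewrite -(fineK fA2) -EFinM lee_fin [e * _]mulrC ler_pM2l// => h3.
by rewrite -[leLHS](fineK fA2) lee_fin.
Unshelve. all: by end_near. Qed.

End concentration.

(** * Concentration of lagged products *)

Section past_law.
Context d (Omega : measurableType d) (R : realType) (P : probability Omega R).
Variable e : int -> {RV P >-> R}.
Local Notation S := (seqR R).

Definition past_rv (t : int) : Omega -> S := past (fun s => e s) t.

Lemma measurable_past_rv t : measurable_fun setT (past_rv t).
Proof. by apply: measurable_fun_seqP => k; exact: measurable_funPT. Qed.

HB.instance Definition _ t :=
  isMeasurableFun.Build _ _ _ _ (past_rv t) (measurable_past_rv t).

Definition past_law t : probability S R := distribution P (past_rv t).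

Definition rectangle (K : nat) (B : nat -> set R) : set S :=
  [set u | forall i, (i < K)%N -> B i (u i)].

Definition rectangles : set (set S) :=
  [set A | exists K B, (forall i, measurable (B i)) /\ A = rectangle K B].

Lemma measurable_rectangle K (B : nat -> set R) :
  (forall i, measurable (B i)) -> measurable (rectangle K B).
Proof.
move=> mB; have -> : rectangle K B =
    \bigcap_(i in [set i | (i < K)%N]) ((fun u : S => u i) @^-1` B i).
  by apply/seteqP; split => u /= h i; exact: h.
apply: bigcap_measurableType => i _.
by rewrite -[X in measurable X]setTI; exact: (measurable_coordinate i).
Qed.

Lemma measurable_rectanglesE : (measurable : set (set S)) = <<s rectangles >>.
Proof.
apply/seteqP; split; last first.
  apply: smallest_sub; first exact: sigma_algebra_measurable.
  by move=> _ [K [B [mB ->]]]; exact: measurable_rectangle.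
apply: smallest_sub; first exact: smallest_sigma_algebra.
move=> _ [k [B [mB ->]]]; apply: sub_sigma_algebra.
exists k.+1, (fun i => if i == k then B else setT); split.
  by move=> i; case: eqP.
apply/seteqP; split => u /= h; last by have := h k (ltnSn k); rewrite eqxx.
by move=> i _; case: eqP => // ->.
Qed.

Lemma setI_closed_rectangles : setI_closed rectangles.
Proof.
move=> _ _ [K [B [mB ->]]] [L [C [mC ->]]].
exists (maxn K L), (fun i => (if (i < K)%N then B i else setT) `&`
   (if (i < L)%N then C i else setT)); split.
  by move=> i; apply: measurableI; case: ifP.
apply/seteqP; split => u /=.
  move=> [hB hC] i _; split; case: ifP => // iK; [exact: hB|exact: hC].
move=> h; split => i iK.
  by have := h i; rewrite leq_max iK => /(_ isT)[].
by have := h i; rewrite leq_max iK orbT => /(_ isT)[].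
Qed.

Lemma rectangle_measure_unique (m1 m2 : {measure set S -> \bar R}) :
  (m1 setT < +oo)%E ->
  (forall K B, (forall i, measurable (B i)) ->
     m1 (rectangle K B) = m2 (rectangle K B)) ->
  forall A, measurable A -> m1 A = m2 A.
Proof.
move=> fin h; apply: (measure_unique rectangles (fun=> setT)) => //.
- exact: measurable_rectanglesE.
- exact: setI_closed_rectangles.
- move=> _; exists 0%N, (fun=> setT); split => //.
  by apply/seteqP; split.
- by rewrite bigcup_const//; exists 0%N.
- by move=> _ [K [B [mB ->]]]; exact: h.
Qed.

Hypothesis indep : mutually_independent e.

Lemma past_law_rectangle t K (B : nat -> set R) : (forall i, measurable (B i)) ->
  past_law t (rectangle K B) = (\prod_(i < K) P (e (t - i%:Z) @^-1` B i))%E.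
Proof.
move=> mB; pose s : seq int := [seq t - i%:Z | i <- iota 0 K].
have us : uniq s.
  by rewrite map_inj_uniq ?iota_uniq// => i j /addrI /oppr_inj[].
pose J : {fset int} := [fset x in s]%fset.
have Js : perm_eq J s.
  by apply: uniq_perm => // x; rewrite inE.
(* Independence is indexed by times, the sets by lags: the lag of time [x] is recovered as the
   absolute value of [t - x]. *)
have := indep J (fun x => mB (absz (t - x)%R)).
have iotaE : iota 0 K = index_iota 0 K by rewrite /index_iota subn0.
rewrite (perm_big _ Js) /= /s big_map iotaE big_mkord /=.
have absK (i : nat) : absz (t - (t - i%:Z))%R = i by rewrite opprB addrC subrK absz_nat.
under eq_bigr do rewrite absK.
move=> <-; rewrite /past_law /distribution /pushforward; congr (P _).
apply/seteqP; split => w /= h.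
  move=> x; rewrite /= inE => xs.
  have /mapP[k] : x \in [seq t - i%:Z | i <- iota 0 K] by exact: xs.
  rewrite mem_iota => /andP[_ kK] ->.
  by rewrite /= absK; exact: h.
move=> i iK; have := h (t - i%:Z); rewrite /= absK; apply.
have : t - i%:Z \in [seq t - i%:Z | i <- iota 0 K] by apply: map_f; rewrite mem_iota.
by rewrite inE.
Qed.

(** It suffices to check rectangles. The preimage of a rectangle is a product of two: one frees
    coordinate [k], the other constrains only coordinate [k], and by independence their
    probabilities multiply to that of the original. *)
Lemma past_law_resample t k (A : set S) : measurable A ->
  (past_law t \x past_law t)%E (resample k @^-1` A) = past_law t A.
Proof.
move: A; set mu := past_law t.
pose rs : {mfun (S * S)%type >-> S} :=
  HB.pack (@resample R k) (isMeasurableFun.Build _ _ _ _ _ (measurable_resample (R := R) k)).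
apply: (@rectangle_measure_unique (distribution (mu \x mu)%E rs) mu).
  by rewrite (le_lt_trans (probability_le1 _ _))// ltry.
move=> K B mB.
pose B1 i := if i == k then setT else B i; pose B2 i := if i == k then B i else setT.
have mB1 i : measurable (B1 i) by rewrite /B1; case: ifP.
have mB2 i : measurable (B2 i) by rewrite /B2; case: ifP.
have rectE : resample k @^-1` rectangle K B = rectangle K B1 `*` rectangle K B2.
  apply/seteqP; split => -[u v] /=.
    by move=> h; split => i iK; have := h i iK; rewrite /B1 /B2 /resample /=; case: eqP.
  move=> [h1 h2] i iK; have := h1 i iK; have := h2 i iK.
  by rewrite /B1 /B2 /resample /=; case: eqP.
transitivity ((mu \x mu)%E (rectangle K B1 `*` rectangle K B2)).
  by rewrite -rectE.
rewrite product_measure1E; [|exact: measurable_rectangle..].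
transitivity ((\prod_(i < K) P (e (t - i%:Z) @^-1` B1 i)) *
    (\prod_(i < K) P (e (t - i%:Z) @^-1` B2 i)))%E.
  by congr (_ * _)%E; exact: past_law_rectangle.
transitivity (\prod_(i < K) P (e (t - i%:Z) @^-1` B i))%E; last first.
  by apply/esym; exact: past_law_rectangle.
rewrite -big_split /=; apply: eq_bigr => i _.
by rewrite /B1 /B2; case: eqP => _; rewrite preimage_setT probability_setT ?mul1e ?mule1.
Qed.

Lemma past_law_resampling_invariant t : resampling_invariant (past_law t).
Proof.
move=> k f bf; rewrite (bmeas_prod _ _ (bmeas_resample k bf)).
rewrite /Rintegral; congr fine.
set mu := past_law t.
pose rs : {mfun (S * S)%type >-> S} :=
  HB.pack (@resample R k) (isMeasurableFun.Build _ _ _ _ _ (measurable_resample (R := R) k)).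
transitivity (\int[distribution (mu \x mu)%E rs]_u (f u)%:E)%E.
  rewrite integral_distribution//; first by apply/measurable_EFinP; case: bf.
  exact: (bmeas_integrable (mu \x mu)%E (bmeas_resample k bf)).
by apply: eq_measure_integral => A mA _; exact: past_law_resample.
Qed.

End past_law.

Section Lnorm_bounds.
Context d (T : measurableType d) (R : realType) (nu : probability T R).
Implicit Types (f g : T -> R) (q a b : R).
Local Notation N q f := (Lnorm nu q%:E (EFin \o f)).

Lemma Lnorm_poweR q f : 0 < q ->
  (N q f `^ q = \int[nu]_x (`|f x| `^ q)%:E)%E.
Proof. by move=> q0; rewrite poweR_Lnorm ?gt_eqF. Qed.

Lemma Lnorm_leP q f a : 0 < q -> 0 <= a ->
  (N q f <= a%:E)%E <-> (\int[nu]_x (`|f x| `^ q)%:E <= (a `^ q)%:E)%E.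
Proof.
move=> q0 a0; rewrite -(Lnorm_poweR f q0) -poweR_EFin.
have inE0 (y : \bar R) : (0 <= y)%E -> y \in `[0%E, +oo%E].
  by move=> y0; rewrite in_itv/= y0 leey.
have iN := inE0 _ (Lnorm_ge0 nu q%:E (EFin \o f)).
have ia : a%:E \in `[0%E, +oo%E] by apply: inE0; rewrite lee_fin.
split => h; first exact: (gt0_ler_poweR (ltW q0)).
have q'0 : 0 <= q^-1 by rewrite invr_ge0 ltW.
have := gt0_ler_poweR q'0 (inE0 _ (poweR_ge0 _ _)) (inE0 _ (poweR_ge0 _ _)) h.
have qq : q * q^-1 = 1 by rewrite divff// gt_eqF.
by rewrite /= -!poweRrM -powRrM qq powRr1// poweRe1//; exact: Lnorm_ge0.
Qed.

(** The Cauchy-Schwarz inequality for the q-th powers of the moduli. This is where moments of order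
    [2 * q] of the data turn into moments of order [q] of products. *)
Lemma Lnorm_mul_le q f g a b : 0 < q -> 0 <= a -> 0 <= b ->
  measurable_fun setT f -> measurable_fun setT g ->
  (N (2 * q) f <= a%:E)%E -> (N (2 * q) g <= b%:E)%E ->
  (N q (fun x => f x * g x)%R <= (a * b)%:E)%E.
Proof.
move=> q0 a0 b0 mf mg.
have q20 : 0 < 2 * q by rewrite mulr_gt0.
have half h c : 0 <= c -> (N (2 * q) h <= c%:E)%E ->
    (N 2 (fun x => `|h x| `^ q)%R <= (c `^ q)%:E)%E.
  move=> c0 /(Lnorm_leP _ q20 c0) hc; apply/Lnorm_leP => //; first exact: powR_ge0.
  rewrite -powRrM mulrC; apply: le_trans hc; rewrite le_eqVlt; apply/orP; left.
  apply/eqP; apply: eq_integral => x _.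
  by rewrite ger0_norm ?powR_ge0// -powRrM mulrC.
move=> /(half _ _ a0) hf /(half _ _ b0) hg; apply/Lnorm_leP => //.
  exact: mulr_ge0.
have mp (h : T -> R) : measurable_fun setT h -> measurable_fun setT (fun x : T => `|h x| `^ q).
  by move=> mh; apply: (measurableT_comp (measurable_powR q)); exact: measurableT_comp.
have := @hoelder _ _ _ nu _ _ 2 2 (mp _ mf) (mp _ mg).
move=> /(_ ltac:(lra) ltac:(lra) ltac:(lra)); rewrite Lnorm1 => h.
rewrite powRM// EFinM.
apply: (@le_trans _ _ (\int[nu]_x `|(EFin \o ((fun x => `|f x| `^ q) \*
    (fun x => `|g x| `^ q))%R) x|)%E).
  rewrite le_eqVlt; apply/orP; left; apply/eqP; apply: eq_integral => x _ /=.
  by rewrite normrM powRM// (ger0_norm (mulr_ge0 (powR_ge0 _ _) (powR_ge0 _ _))).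
by apply: (le_trans h); apply: lee_pmul => //; exact: Lnorm_ge0.
Qed.

Lemma Lnorm_add_le q f g a b : 1 <= q -> measurable_fun setT f -> measurable_fun setT g ->
  (N q f <= a%:E)%E -> (N q g <= b%:E)%E ->
  (N q (fun x => f x + g x)%R <= (a + b)%:E)%E.
Proof.
move=> q1 mf mg fa gb; apply: (le_trans (minkowski_EFin nu mf mg q1)).
by rewrite EFinD; exact: leeD.
Qed.

Lemma Lnorm_sum_le q n (F : nat -> T -> R) (a : nat -> R) : 1 <= q ->
  (forall r, measurable_fun setT (F r)) -> (forall r, (N q (F r) <= (a r)%:E)%E) ->
  (N q (fun x => \sum_(r < n) F r x)%R <= (\sum_(r < n) a r)%:E)%E.
Proof.
move=> q1 mF Fa; elim: n => [|n IH].
  rewrite big_ord0; apply/Lnorm_leP => //; first lra.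
  under eq_integral do rewrite big_ord0 normr0 powR0 ?(gt_eqF (lt_le_trans ltr01 q1))//.
  by rewrite integral0 lee_fin powR_ge0.
rewrite big_ord_recr /=.
rewrite (_ : (fun x => _) = fun x => \sum_(r < n) F r x + F n x); last first.
  by apply/funext => x; rewrite big_ord_recr.
by apply: Lnorm_add_le => //; exact: measurable_sum.
Qed.

Lemma Lnorm_integrable q f a : 1 <= q -> measurable_fun setT f ->
  (N q f <= a%:E)%E -> nu.-integrable setT (EFin \o f).
Proof.
move=> q1 mf fa; have q0 : 0 < q by lra.
have fa' : (N q f <= `|a|%:E)%E by rewrite (le_trans fa)// lee_fin ler_norm.
have /Lnorm_leP-/(_ q0 (normr_ge0 a)) h := fa'.
have mp : measurable_fun setT (fun x : T => `|f x| `^ q).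
  by apply: (measurableT_comp (measurable_powR q)); exact: measurableT_comp.
have ip : nu.-integrable setT (EFin \o (fun x => `|f x| `^ q)).
  apply/integrableP; split; first exact/measurable_EFinP.
  apply: le_lt_trans (ltry (`|a| `^ q)); apply: le_trans h.
  rewrite le_eqVlt; apply/orP; left; apply/eqP; apply: eq_integral => x _ /=.
  by rewrite ger0_norm ?powR_ge0.
apply: (@le_integrable _ _ _ nu setT measurableT _
    (EFin \o (fun x => 1 + `|f x| `^ q))).
- exact/measurable_EFinP.
- move=> x _ /=; rewrite lee_fin (ger0_norm (addr_ge0 ler01 (powR_ge0 _ _))).
  have [h1|h1] := lerP `|f x| 1; first by rewrite (le_trans h1)// lerDl powR_ge0.
  by rewrite (le_trans (le1r_powR (ltW h1) q1))// lerDr.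
- have -> : EFin \o (fun x => 1 + `|f x| `^ q) =
      ((EFin \o cst 1%R) \+ (EFin \o (fun x => (`|f x| `^ q)%R)))%E by [].
  by apply: integrableD => //; exact: finite_measure_integrable_cst.
Qed.

End Lnorm_bounds.

Section past_law_norm.
Context d (Omega : measurableType d) (R : realType) (P : probability Omega R).
Variable e : int -> {RV P >-> R}.
Local Notation S := (seqR R).

(** The bridge between the coupling on the product of sample spaces, in which [dependence_coef] is
    stated, and resampling on sequence space. *)
Lemma integral_past_law2 t (h : S * S -> \bar R) : measurable_fun setT h ->
  (forall z, 0 <= h z)%E ->
  (\int[(past_law e t \x past_law e t)%E]_z h z =
   \int[(P \x P)%E]_w h (past_rv e t w.1, past_rv e t w.2))%E.
Proof.
move=> mh h0; set mu := past_law e t; set X := past_rv e t.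
have mX : measurable_fun setT X by exact: measurable_past_rv.
have mX2 : measurable_fun setT (fun w : Omega * Omega => (X w.1, X w.2)).
  apply: measurable_fun_pair.
    exact: (measurableT_comp mX measurable_fst).
  exact: (measurableT_comp mX measurable_snd).
rewrite fubini_tonelli1// fubini_tonelli1//; last exact: (measurableT_comp mh mX2).
rewrite /fubini_F.
rewrite ge0_integral_distribution//; last 2 first.
- exact: (measurable_fun_fubini_tonelli_F (m2 := mu)).
- by move=> u; apply: integral_ge0.
apply: eq_integral => w _ /=.
rewrite ge0_integral_distribution//.
by apply: (measurableT_comp mh); exact: pair1_measurable.
Qed.

Definition shift (c : nat) (u : S) : S := fun k => u (c + k)%N.

Lemma measurable_shift c : measurable_fun setT (shift c).
Proof. by apply: measurable_fun_seqP => k; exact: measurable_coordinate. Qed.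

Lemma shift_past_rv c t w : shift c (past_rv e t w) = past_rv e (t - c%:Z) w.
Proof.
apply/funext => k; rewrite /shift /past_rv /past PoszD; congr (e _ w).
by rewrite opprD addrA.
Qed.

Lemma shift_resample_ge c k u v : (c <= k)%N ->
  shift c (resample k (u, v)) = resample (k - c) (shift c u, shift c v).
Proof.
move=> ck; apply/funext => i; rewrite /shift /resample /=.
by have -> : (c + i == k)%N = (i == k - c)%N by lia.
Qed.

Lemma shift_resample_lt c k u v : (k < c)%N ->
  shift c (resample k (u, v)) = shift c u.
Proof.
move=> ck; apply/funext => i; rewrite /shift /resample /=.
by have -> : (c + i == k)%N = false by lia.
Qed.

End past_law_norm.

Section lagged_sums.
Variables (R : realType) (delta : nat -> R) (Delta : R).
Hypothesis delta_ge0 : forall j, 0 <= delta j.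
Hypothesis delta_sum : forall n, \sum_(j < n) delta j <= Delta.

(** Bounds the effect of the innovation at lag [k] on an observation at lag [c]. It is 0 for
    [k < c], where the innovation is later than the observation. *)
Definition lagged (c k : nat) : R := if (c <= k)%N then delta (k - c) else 0.

Lemma lagged_ge0 c k : 0 <= lagged c k.
Proof. by rewrite /lagged; case: ifP. Qed.

(** Here the innovation is fixed and the observation time varies; [sum_lagged_time] fixes the time
    and lets the innovation vary. In both sums every [delta j] occurs at most once. *)
Lemma sum_lagged_shift n a k : \sum_(r < n) lagged (a + r) k <= Delta.
Proof.
apply: le_trans (delta_sum (k.+1 - a)).
elim: n a => [|n IH] a; first by rewrite big_ord0 sumr_ge0.
rewrite big_ord_recl addn0.
have -> : \sum_(r < n) lagged (a + lift ord0 r) k = \sum_(r < n) lagged (a.+1 + r) k.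
  by apply: eq_bigr => r _; rewrite addSnnS.
rewrite {1}/lagged; case: leqP => ak.
  rewrite subSn// [leRHS]big_ord_recr /= [leRHS]addrC lerD2l.
  by have := IH a.+1; rewrite subSS.
by rewrite add0r (le_trans (IH a.+1))// (_ : k.+1 - a.+1 = k.+1 - a)%N//; lia.
Qed.

Lemma sum_lagged_time N c : \sum_(k < N) lagged c k <= Delta.
Proof.
apply: le_trans (delta_sum (N - c)).
elim: N => [|N IH]; first by rewrite big_ord0 sumr_ge0.
rewrite big_ord_recr /= {2}/lagged; case: leqP => cN.
  by rewrite subSn// big_ord_recr /= lerD2r.
by rewrite addr0 (le_trans IH)// (_ : N - c = N.+1 - c)%N//; lia.
Qed.

End lagged_sums.

Section product_concentration.
Context d (Omega : measurableType d) (R : realType) (P : probability Omega R).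
Local Notation S := (seqR R).
Variables (e : int -> {RV P >-> R}) (D : nat) (g : int -> 'I_D -> S -> R).
Variables (q C : R) (delta : nat -> R) (Delta : R).
Hypothesis indep : mutually_independent e.
Hypothesis mg : forall t i, measurable_fun setT (g t i).
Hypothesis q2 : 2 < q.
Hypothesis C0 : 0 <= C.
Hypothesis g_norm : forall t i,
  (Lnorm P (2 * q)%:E (fun w => (g t i (past_rv e t w))%:E) <= C%:E)%E.
Hypothesis g_dep : forall j,
  (dependence_coef P (2 * q) (fun s => e s) g j <= (delta j)%:E)%E.
Hypothesis delta_ge0 : forall j, 0 <= delta j.
Hypothesis delta_sum : forall n, \sum_(j < n) delta j <= Delta.

Variable tau : int.
Local Notation mu := (past_law e tau).
Local Notation mu2 := (mu \x mu)%E.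

Let q0 : 0 < q. Proof. exact: lt_trans q2. Qed.
Let q20 : 0 < 2 * q. Proof. exact: mulr_gt0. Qed.
Let q1 : 1 <= q. Proof. by rewrite ltW// (lt_trans _ q2)// ltr1n. Qed.

(** The observation at time [tau - c] as a function of the past at the single time [tau], so that
    all factors of a sample sum live on one sequence space. *)
Definition lagged_fun (c : nat) (i : 'I_D) (u : S) : R := g (tau - c%:Z) i (shift c u).
Local Notation G := lagged_fun.

Lemma measurable_lagged_fun c i : measurable_fun setT (G c i).
Proof. exact: (measurableT_comp (mg _ i) (measurable_shift c)). Qed.

Lemma measurable_norm_powR d' (T : measurableType d') (f : T -> R) (r : R) :
  measurable_fun setT f -> measurable_fun setT (fun x => (`|f x| `^ r)%:E).
Proof.
move=> mf; apply/measurable_EFinP; apply: (measurableT_comp (measurable_powR r)).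
exact: measurableT_comp.
Qed.

Lemma Lnorm_lagged_fun c i : (Lnorm mu (2 * q)%:E (EFin \o G c i) <= C%:E)%E.
Proof.
apply/Lnorm_leP => //; rewrite ge0_integral_distribution//; last first.
  exact: (measurable_norm_powR (2 * q) (measurable_lagged_fun c i)).
apply: (le_trans _ ((Lnorm_leP _ _ q20 C0).1 (g_norm (tau - c%:Z) i))).
rewrite le_eqVlt; apply/orP; left; apply/eqP; apply: eq_integral => w _ /=.
by rewrite /lagged_fun shift_past_rv.
Qed.

Lemma Lnorm_fst (f : S -> R) r a : 0 < r -> 0 <= a -> measurable_fun setT f ->
  (Lnorm mu r%:E (EFin \o f) <= a%:E)%E ->
  (Lnorm mu2 r%:E (EFin \o (fun z => f z.1)) <= a%:E)%E.
Proof.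
move=> r0 a0 mf /(Lnorm_leP _ _ r0 a0) h; apply/Lnorm_leP => //.
rewrite fubini_tonelli1//; last first.
  exact: (measurableT_comp (measurable_norm_powR r mf) measurable_fst).
apply: le_trans h; rewrite le_eqVlt; apply/orP; left; apply/eqP.
apply: eq_integral => u _; rewrite /fubini_F /= integral_cst//.
by rewrite [X in (_ * X)%E](_ : _ = 1%E) ?mule1//; exact: probability_setT.
Qed.

Lemma Lnorm_resample (f : S -> R) k r a : 0 < r -> 0 <= a -> measurable_fun setT f ->
  (Lnorm mu r%:E (EFin \o f) <= a%:E)%E ->
  (Lnorm mu2 r%:E (EFin \o (fun z => f (resample k z))) <= a%:E)%E.
Proof.
move=> r0 a0 mf /(Lnorm_leP _ _ r0 a0) h; apply/Lnorm_leP => //.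
apply: le_trans h; rewrite le_eqVlt; apply/orP; left; apply/eqP.
pose rs : {mfun (S * S)%type >-> S} :=
  HB.pack (@resample R k) (isMeasurableFun.Build _ _ _ _ _ (measurable_resample (R := R) k)).
transitivity (\int[distribution mu2 rs]_u (`|f u| `^ r)%:E)%E.
  rewrite ge0_integral_distribution//; first exact: measurable_norm_powR.
by apply: eq_measure_integral => A mA _; exact: past_law_resample.
Qed.

(** For [k < c] the shift discards the resampled coordinate. Otherwise it turns the replacement into
    the coupling of lag [k - c] at time [tau - c]. *)
Lemma Lnorm_lagged_fun_diff c i k :
  (Lnorm mu2 (2 * q)%:E (EFin \o (fun z : S * S => G c i z.1 - G c i (resample k z))%R)
   <= (lagged delta c k)%:E)%E.
Proof.
have mG := measurable_lagged_fun c i.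
have mdiff : measurable_fun setT (fun z : S * S => G c i z.1 - G c i (resample k z)).
  apply: measurable_funB; first exact: (measurableT_comp mG measurable_fst).
  exact: (measurableT_comp mG (measurable_resample k)).
apply/Lnorm_leP => //; first exact: lagged_ge0.
rewrite /lagged; case: leqP => ck; last first.
  rewrite (@eq_integral _ _ _ _ _ (cst 0%E)); last first.
    move=> [u v] _ /=; rewrite /lagged_fun shift_resample_lt// subrr normr0.
    by rewrite powR0// gt_eqF.
  by rewrite integral0 lee_fin powR_ge0.
rewrite integral_past_law2//; last exact: measurable_norm_powR.
pose t := tau - c%:Z.
pose H (w : Omega * Omega) : R := g t i (past (fun s => e s) t w.1) -
  g t i (coupled_past (fun s => e s) t (k - c) w).
have /Lnorm_leP-/(_ q20 (delta_ge0 _)) :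
    (Lnorm (P \x P)%E (2 * q)%:E (EFin \o H) <= (delta (k - c))%:E)%E.
  apply: (le_trans _ (g_dep (k - c))).
  by apply: ereal_sup_ubound; exists t, i.
apply: le_trans; rewrite le_eqVlt; apply/orP; left; apply/eqP.
apply: eq_integral => w _ /=.
by rewrite /lagged_fun shift_resample_ge// !shift_past_rv.
Qed.

Definition lagged_products n a b i j (u : S) : R :=
  \sum_(r < n) G (a + r) i u * G (b + r) j u.

Lemma measurable_lagged_products n a b i j : measurable_fun setT (lagged_products n a b i j).
Proof.
by apply: measurable_sum => r; apply: measurable_funM; exact: measurable_lagged_fun.
Qed.

Lemma integrable_lagged_products n a b i j :
  mu.-integrable setT (EFin \o lagged_products n a b i j).
Proof.
apply: (Lnorm_integrable q1 (measurable_lagged_products n a b i j)).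
apply: (@Lnorm_sum_le _ _ _ _ _ _ (fun r u => G (a + r) i u * G (b + r) j u)
  (fun=> C * C)) => //.
- by move=> r; apply: measurable_funM; exact: measurable_lagged_fun.
- move=> r; apply: Lnorm_mul_le => //; do 1?exact: measurable_lagged_fun;
  exact: Lnorm_lagged_fun.
Qed.

Let A n a b k := \sum_(r < n) (lagged delta (a + r) k + lagged delta (b + r) k).

Lemma Lnorm_lagged_products_diff n a b i j k :
  (Lnorm mu2 q%:E (EFin \o (fun z : S * S => lagged_products n a b i j z.1 -
      lagged_products n a b i j (resample k z))%R) <= (C * A n a b k)%:E)%E.
Proof.
have mG1 c l : measurable_fun setT (fun z : S * S => G c l z.1).
  exact: (measurableT_comp (measurable_lagged_fun c l) measurable_fst).
have mG2 c l : measurable_fun setT (fun z : S * S => G c l (resample k z)).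
  exact: (measurableT_comp (measurable_lagged_fun c l) (measurable_resample k)).
(* The change of a product is written so that each summand has one changed factor, small by
   dependence, and one factor bounded in norm by [C]. *)
pose F r (z : S * S) := (G (a + r) i z.1 - G (a + r) i (resample k z)) * G (b + r) j z.1 +
  G (a + r) i (resample k z) * (G (b + r) j z.1 - G (b + r) j (resample k z)).
have -> : (fun z : S * S => lagged_products n a b i j z.1 - lagged_products n a b i j (resample k z))
    = fun z => \sum_(r < n) F r z.
  apply/funext => z; rewrite /lagged_products -sumrB; apply: eq_bigr => r _.
  by rewrite /F; ring.
rewrite /A mulr_sumr.
apply: (@Lnorm_sum_le _ _ _ _ _ _ F
  (fun r => C * (lagged delta (a + r) k + lagged delta (b + r) k))) => //.
  by move=> r; apply: measurable_funD; apply: measurable_funM => //; exact: measurable_funB.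
move=> r; rewrite mulrDr [C * lagged _ (a + r) _]mulrC.
have l0 := lagged_ge0 delta_ge0.
apply: Lnorm_add_le => //.
- by apply: measurable_funM => //; exact: measurable_funB.
- by apply: measurable_funM => //; exact: measurable_funB.
- apply: Lnorm_mul_le => //; [exact: measurable_funB|exact: Lnorm_lagged_fun_diff|].
  by apply: Lnorm_fst => //; [exact: measurable_lagged_fun|exact: Lnorm_lagged_fun].
- apply: Lnorm_mul_le => //; [exact: measurable_funB| |exact: Lnorm_lagged_fun_diff].
  by apply: Lnorm_resample => //; [exact: measurable_lagged_fun|exact: Lnorm_lagged_fun].
Qed.

(** The effect of coordinate [k] is at most [C * A k]. Each [A k] is at most [2 * Delta] and their
    sum is at most [2 * Delta * n], so the squares sum to a quantity linear in [n]. *)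
Lemma product_concentration n a b i j (eta : R) (f : Omega -> R) : 0 < eta ->
  (forall w, f w = \sum_(r < n)
    g (tau - (a + r)%N%:Z) i (past_rv e (tau - (a + r)%N%:Z) w) *
    g (tau - (b + r)%N%:Z) j (past_rv e (tau - (b + r)%N%:Z) w)) ->
  (P [set w | (eta < `|f w - fine 'E_P[f]|)%R] <=
    (concentration_cst q * ((2 * C * Delta) ^+ 2 * n%:R + 1) `^ (q / 2) *
     (eta / 2) `^ (- q))%:E)%E.
Proof.
move=> eta0 f_def.
have fE w : f w = lagged_products n a b i j (past_rv e tau w).
  by rewrite f_def; apply: eq_bigr => r _; rewrite /lagged_fun !shift_past_rv.
have l0 := lagged_ge0 delta_ge0.
have A0 k : 0 <= A n a b k by apply: sumr_ge0 => r _; rewrite addr_ge0.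
have A1 k : A n a b k <= 2 * Delta.
  rewrite /A big_split /= mulrDl mul1r.
  by apply: lerD; exact: sum_lagged_shift.
have A2 N : \sum_(k < N) A n a b k <= 2 * Delta * n%:R.
  rewrite /A exchange_big /=.
  apply: (@le_trans _ _ (\sum_(r < n) (2 * Delta))).
    apply: ler_sum => r _; rewrite big_split /= mulrDl mul1r.
    by apply: lerD; exact: sum_lagged_time.
  by rewrite sumr_const card_ord mulr_natr.
have D0 : 0 <= Delta by have := delta_sum 0; rewrite big_ord0.
pose beta k := (C * A n a b k) ^+ 2.
have V0 : 0 <= (2 * C * Delta) ^+ 2 * n%:R by rewrite mulr_ge0 ?sqr_ge0.
have betaV N : \sum_(k < N) beta k <= (2 * C * Delta) ^+ 2 * n%:R.
  apply: (@le_trans _ _ (\sum_(k < N) C ^+ 2 * (2 * Delta) * A n a b k)).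
    apply: ler_sum => k _; rewrite /beta exprMn -mulrA ler_wpM2l ?sqr_ge0//.
    by rewrite expr2 ler_wpM2r.
  rewrite -mulr_sumr.
  rewrite [leRHS](_ : _ = C ^+ 2 * (2 * Delta) * (2 * Delta * n%:R)); last by ring.
  by apply: ler_wpM2l => //; rewrite !mulr_ge0 ?sqr_ge0.
have infl k : (\int[mu2]_z (`|lagged_products n a b i j z.1 -
    lagged_products n a b i j (resample k z)| `^ q)%R%:E <= (beta k `^ (q / 2))%:E)%E.
  have CA0 : 0 <= C * A n a b k by exact: mulr_ge0.
  have -> : beta k `^ (q / 2) = (C * A n a b k) `^ q.
    by rewrite /beta -powR_mulrn// -powRrM; congr (_ `^ _); field.
  by have /Lnorm_leP-/(_ q0 CA0) := Lnorm_lagged_products_diff n a b i j k.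
have := concentration (@past_law_resampling_invariant _ _ _ _ _ indep tau) q2
  (integrable_lagged_products n a b i j) (fun k => sqr_ge0 _) infl V0 betaV eta0.
suff -> : \int[mu]_u lagged_products n a b i j u = fine 'E_P[f].
  apply: le_trans; rewrite le_eqVlt; apply/orP; left; apply/eqP.
  by congr (P _); apply/seteqP; split => w /=; rewrite fE.
have iX := integrable_lagged_products n a b i j.
have mX := measurable_lagged_products n a b i j.
rewrite /Rintegral unlock; congr fine.
rewrite integral_pushforward//.
- by apply: eq_integral => w _ /=; rewrite fE.
- exact/measurable_EFinP.
rewrite preimage_setT; apply/integrableP; split.
  apply: (measurableT_comp _ (measurable_past_rv e tau)).
  exact/measurable_EFinP.
have /integrableP[_] := iX; rewrite ge0_integral_distribution//.
by apply: measurableT_comp => //; exact/measurable_EFinP.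
Qed.

End product_concentration.

(** * The lasso oracle inequality *)

Section lasso.
Variables (R : realType) (q : nat).
Implicit Types (u v : 'cV[R]_q).

Lemma norm2_sqr n (u : 'cV[R]_n) : norm2 u ^+ 2 = \sum_(k < n) u k 0 ^+ 2.
Proof. by rewrite sqr_sqrtr// sumr_ge0// => k _; exact: sqr_ge0. Qed.

Lemma norm2_le_norm1 n (u : 'cV[R]_n) : norm2 u <= norm1 u.
Proof.
have n0 : 0 <= norm1 u by apply: sumr_ge0 => k _.
rewrite -(@ler_pXn2r _ 2) ?nnegrE ?sqrtr_ge0// norm2_sqr /norm1 expr2 mulr_suml.
apply: ler_sum => k _; rewrite -(real_normK (num_real _)) expr2 ler_wpM2l//.
by rewrite (bigD1 k)//= lerDl sumr_ge0.
Qed.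

Lemma norm1_ge0 n (u : 'cV[R]_n) : 0 <= norm1 u.
Proof. by apply: sumr_ge0 => k _. Qed.

Lemma sqr_sum_le (I : finType) (B : {set I}) (f : I -> R) :
  (\sum_(k in B) f k) ^+ 2 <= #|B|%:R * \sum_(k in B) f k ^+ 2.
Proof.
set s := \sum_(k in B) f k; set n := #|B|%:R.
have [n0|n0] := eqVneq #|B| 0%N.
  have B0 : B = finset.set0 by apply/eqP; rewrite -cards_eq0 n0.
  by rewrite /s B0 big_set0 expr0n /= mulr_ge0// sumr_ge0// => k _; exact: sqr_ge0.
have n1 : 0 < n by rewrite ltr0n lt0n.
have : 0 <= \sum_(k in B) (f k * n - s) ^+ 2 by apply: sumr_ge0 => k _; exact: sqr_ge0.
under eq_bigr do rewrite sqrrB exprMn.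
rewrite big_split /= sumrB -mulr_suml.
have -> : \sum_(i in B) f i * n * s *+ 2 = s * n * s *+ 2.
  by rewrite sumrMnl -!mulr_suml.
have -> : \sum_(i in B) s ^+ 2 = s ^+ 2 * n by rewrite sumr_const mulr_natr.
have -> : (\sum_(i in B) f i ^+ 2) * n ^+ 2 - s * n * s *+ 2 + s ^+ 2 * n =
  n * (n * (\sum_(i in B) f i ^+ 2) - s ^+ 2) by ring.
by rewrite pmulr_rge0// subr_ge0.
Qed.

Definition quad (M : 'M[R]_q) v : R := \sum_i \sum_j v i 0 * M i j * v j 0.

Lemma quadE (M : 'M[R]_q) v : quad M v = (v^T *m M *m v) 0 0.
Proof.
rewrite mxE /quad exchange_big; apply: eq_bigr => j _ /=.
by rewrite mxE mulr_suml; apply: eq_bigr => i _; rewrite mxE.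
Qed.

Lemma quadD (M N : 'M[R]_q) v : quad (M + N) v = quad M v + quad N v.
Proof. by rewrite !quadE mulmxDr mulmxDl mxE. Qed.

Lemma quadZ (a : R) (M : 'M[R]_q) v : quad (a *: M) v = a * quad M v.
Proof. by rewrite !quadE -scalemxAr -scalemxAl mxE. Qed.

Lemma quad_gram n (W : 'M[R]_(n, q)) v :
  quad (W^T *m W) v = \sum_i (W *m v) i 0 ^+ 2.
Proof.
rewrite quadE -!mulmxA mulmxA -trmx_mul mxE; apply: eq_bigr => i _.
by rewrite mxE expr2.
Qed.

Lemma quad_norm1_le (M : 'M[R]_q) v (kappa : R) : (forall i j, `|M i j| <= kappa) ->
  `|quad M v| <= kappa * norm1 v ^+ 2.
Proof.
move=> Mk; rewrite expr2 /norm1 mulr_suml mulr_sumr.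
apply: (le_trans (ler_norm_sum _ _ _)); apply: ler_sum => i _.
rewrite mulr_sumr mulr_sumr.
apply: (le_trans (ler_norm_sum _ _ _)); apply: ler_sum => j _.
by rewrite !normrM mulrA [kappa * _]mulrC ler_wpM2r// ler_wpM2l.
Qed.

(** The basic inequality of the lasso. The noise term costs [lambda / 2] times the whole l1 norm of
    the error, and the penalties differ by at most [lambda] times its norm on [B] minus its norm off
    [B]; together these give the weights 3 and -1. *)
Lemma lasso_cone (n T : nat) (lambda : R) (W : 'M[R]_(n, q)) (y : 'cV[R]_n) (S St : 'cV[R]_q)
    (B : {set 'I_q}) : 0 < lambda ->
  (forall k, k \notin B -> S k 0 = 0) ->
  (forall k, `|T%:R^-1 * (W^T *m (y - W *m S)) k 0| <= lambda / 2) ->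
  lasso_objective T lambda y W St <= lasso_objective T lambda y W S ->
  (2 * T%:R)^-1 * (\sum_i (W *m (St - S)) i 0 ^+ 2) <=
    lambda / 2 * (3 * \sum_(k in B) `|(St - S) k 0| - \sum_(k in ~: B) `|(St - S) k 0|).
Proof.
move=> l0 SB noise; rewrite /lasso_objective !norm2_sqr.
set v := St - S; set h := W *m v; set r := y - W *m S.
have -> : y - W *m St = r - h.
  by rewrite /r /h /v mulmxBr opprB subrKA.
have -> : \sum_k (r - h) k 0 ^+ 2 =
    \sum_k r k 0 ^+ 2 - 2 * (\sum_k r k 0 * h k 0) + \sum_k h k 0 ^+ 2.
  rewrite mulr_sumr -sumrB -big_split /=; apply: eq_bigr => k _.
  by rewrite !mxE; ring.
have rh : T%:R^-1 * (\sum_k r k 0 * h k 0) <= lambda / 2 * norm1 v.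
  have -> : \sum_k r k 0 * h k 0 = \sum_k v k 0 * (W^T *m r) k 0.
    have hE k : h k 0 = \sum_i W k i * v i 0 by rewrite /h mxE.
    have WrE k : (W^T *m r) k 0 = \sum_i W i k * r i 0.
      by rewrite mxE; apply: eq_bigr => i _; rewrite mxE.
    under eq_bigr do rewrite hE mulr_sumr.
    under [RHS]eq_bigr do rewrite WrE mulr_sumr.
    rewrite exchange_big; apply: eq_bigr => k _; apply: eq_bigr => i _.
    by ring.
  rewrite mulr_sumr /norm1 mulr_sumr; apply: ler_sum => k _.
  rewrite mulrCA mulrC; apply: (le_trans (ler_norm _)).
  by rewrite normrM ler_wpM2r.
have n1 : norm1 S - norm1 St <=
    \sum_(k in B) `|v k 0| - \sum_(k in ~: B) `|v k 0|.
  have split_sum (f : 'I_q -> R) : \sum_k f k = \sum_(k in B) f k + \sum_(k in ~: B) f k.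
    rewrite (bigID (mem B)) /=; congr (_ + _).
    by apply: eq_bigl => k; rewrite finset.in_setC.
  rewrite /norm1 !split_sum opprD addrACA -!sumrB -sumrN; apply: lerD.
    by apply: ler_sum => k _; rewrite /v !mxE distrC; exact: lerB_dist.
  apply: ler_sum => k; rewrite finset.in_setC => kB.
  by rewrite /v !mxE SB// subr0 normr0 sub0r.
have nv : norm1 v = \sum_(k in B) `|v k 0| + \sum_(k in ~: B) `|v k 0|.
  rewrite /norm1 (bigID (mem B)) /=; congr (_ + _).
  by apply: eq_bigl => k; rewrite finset.in_setC.
rewrite nv in rh.
have T2 : (2 * T%:R)^-1 = T%:R^-1 / 2 :> R by rewrite invfM mulrC.
rewrite T2; have := ler_wpM2l (ltW l0) n1.
set x1 := \sum_(k in B) _ in rh *; set x2 := \sum_(k in ~: B) _ in rh *.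
set x3 := \sum_k r k 0 * _ in rh *; set x4 := \sum_k h k 0 ^+ 2.
set x5 := \sum_k r k 0 ^+ 2; set t := T%:R^-1 in rh *.
by move: (norm1 S) (norm1 St) => a b; lra.
Qed.

(** On the cone the squared l1 norm is at most [16 * s] times the squared l2 norm, so an entrywise
    error [kappa] costs at most half of the curvature [c]. Then [c / 2] times the squared l2 norm is
    at most [3 * lambda] times the l1 norm, and 96 is 16 times 2 times 3. *)
Theorem lasso_norm1_bound (n T : nat) (lambda c kappa s : R) (W : 'M[R]_(n, q))
    (y : 'cV[R]_n) (S St : 'cV[R]_q) (B : {set 'I_q}) (Sigma : 'M[R]_q) :
  0 < lambda -> 0 < c -> 0 < s -> #|B|%:R <= s ->
  (forall k, k \notin B -> S k 0 = 0) ->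
  (forall k, `|T%:R^-1 * (W^T *m (y - W *m S)) k 0| <= lambda / 2) ->
  (forall v, c * (\sum_k v k 0 ^+ 2) <= quad Sigma v) ->
  (forall i j, `|T%:R^-1 * (W^T *m W) i j - Sigma i j| <= kappa) ->
  32 * s * kappa <= c ->
  lasso_objective T lambda y W St <= lasso_objective T lambda y W S ->
  norm1 (St - S) <= 96 * s * lambda / c.
Proof.
move=> l0 c0 s0 Bs SB noise eig gram sk obj.
have := lasso_cone l0 SB noise obj; set v := St - S.
set vB := \sum_(k in B) _; set vC := \sum_(k in ~: B) _.
set h2 := \sum_i _.
have h20 : 0 <= h2 by apply: sumr_ge0 => i _; exact: sqr_ge0.
have vB0 : 0 <= vB by apply: sumr_ge0.
have vC0 : 0 <= vC by apply: sumr_ge0.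
have nv : norm1 v = vB + vC.
  rewrite /norm1 (bigID (mem B)) /=; congr (_ + _).
  by apply: eq_bigl => k; rewrite finset.in_setC.
set w := \sum_k v k 0 ^+ 2 in eig *.
pose n2 := \sum_k v k 0 ^+ 2.
have n20 : 0 <= n2 by apply: sumr_ge0 => i _; exact: sqr_ge0.
have vBn2 : vB ^+ 2 <= s * n2.
  apply: (le_trans (sqr_sum_le B _)).
  apply: (@le_trans _ _ (#|B|%:R * n2)).
    rewrite ler_wpM2l// /n2 [leRHS](bigID (mem B)) /=.
    under eq_bigr do rewrite real_normK ?num_real//.
    by rewrite lerDl sumr_ge0// => k _; exact: sqr_ge0.
  by rewrite ler_wpM2r.
have T0 : 0 <= T%:R^-1 :> R by rewrite invr_ge0.
have h2E : T%:R^-1 * h2 = quad Sigma v + quad (T%:R^-1 *: (W^T *m W) - Sigma) v.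
  by rewrite -quadD addrC subrK quadZ quad_gram.
have err : `|quad (T%:R^-1 *: (W^T *m W) - Sigma) v| <= kappa * norm1 v ^+ 2.
  apply: quad_norm1_le => i j; have := gram i j.
  by rewrite [in X in _ -> X]mxE [in X in _ -> X]mxE [(- Sigma) i j]mxE.
have := eig v; rewrite -/n2 => eigv cone.
have T2 : (2 * T%:R)^-1 = T%:R^-1 / 2 :> R by rewrite invfM mulrC.
rewrite T2 in cone.
have cone2 : T%:R^-1 * h2 <= lambda * (3 * vB - vC) by lra.
have cone3 : vC <= 3 * vB.
  have : 0 <= lambda * (3 * vB - vC) by rewrite (le_trans _ cone2)// mulr_ge0.
  by rewrite pmulr_rge0// subr_ge0.
have n1n2 : norm1 v ^+ 2 <= 16 * s * n2.
  apply: (@le_trans _ _ ((4 * vB) ^+ 2)); last by rewrite exprMn; lra.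
  by rewrite ler_pXn2r// ?nnegrE ?norm1_ge0 ?mulr_ge0// nv; lra.
have lower : c / 2 * n2 <= T%:R^-1 * h2.
  have k0 : 0 <= 32 * s * n2 by rewrite !mulr_ge0// ltW.
  move: err; rewrite ler_norml => /andP[err _]; rewrite h2E.
  (* The sign of [kappa] is open here; if negative, it makes the error bound nonpositive. *)
  have [k0'|k0'] := lerP 0 kappa.
    have := ler_wpM2l k0' n1n2; have := ler_wpM2r n20 sk.
    by lra.
  have : kappa * norm1 v ^+ 2 <= 0 by rewrite nmulr_rle0// sqr_ge0.
  by have := mulr_ge0 (ltW c0) n20; lra.
have fin : norm1 v ^+ 2 * c <= 96 * s * lambda * norm1 v.
  have sl0 : 0 <= s * lambda by rewrite mulr_ge0// ltW.
  have := ler_wpM2r (ltW c0) n1n2.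
  have e1 : c / 2 * n2 <= lambda * (3 * vB - vC) by exact: le_trans cone2.
  have := ler_wpM2l (ltW s0) e1.
  have e2 : lambda * (3 * vB - vC) <= 3 * lambda * norm1 v.
    have := mulr_ge0 (ltW l0) vC0; rewrite nv; lra.
  have := ler_wpM2l (ltW s0) e2.
  by lra.
have [nv0|nv0] := eqVneq (norm1 v) 0.
  by rewrite nv0 divr_ge0 ?mulr_ge0// ltW.
rewrite ler_pdivlMr//.
have nvp : 0 < norm1 v by rewrite lt_def nv0 norm1_ge0.
by rewrite -(ler_pM2r nvp) mulrAC -expr2.
Qed.

End lasso.

(** * Covariance structure of the stable autoregression *)

Section symmetric_eigenvalues.
Variable R : realType.
Local Notation C := R[i].
Local Notation toC := (real_complex R).
Local Open Scope sesquilinear_scope.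

(** The spectral theorem for the complexified matrix: in unitary coordinates the form is a sum of
    squared moduli weighted by the spectral values, which are real and above [c]. *)
Lemma symmetric_quad_lower n (M : 'M[R]_n) (c : R) : M^T = M ->
  (forall a, eigenvalue M a -> c < a) ->
  forall v : 'cV[R]_n, c * (\sum_k v k 0 ^+ 2) <= quad M v.
Proof.
move=> Msym eig v; pose A := map_mx toC M.
have conjR k l (X : 'M[R]_(k, l)) : (map_mx toC X)^t* = map_mx toC X^T.
  by apply/matrixP => i j; rewrite !mxE; exact: conjc_real.
have Aherm : A \is hermsymmx.
  by apply/is_hermitianmxP; rewrite expr0 scale1r conjR Msym.
have Anormal := hermitian_normalmx Aherm.
have /orthomx_spectralP := Anormal.
have Preal := hermitian_spectral_diag_real Aherm.
have Punitary := spectral_unitarymx A.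
set Q := spectralmx A in Punitary *; set sp := spectral_diag A in Preal *.
rewrite invmx_unitary// => AE.
have QA : Q *m A = diag_mx sp *m Q.
  by rewrite AE !mulmxA (elimT unitarymxP Punitary) mul1mx.
(* Row [k] of the unitary matrix [Q] is a nonzero left eigenvector, so the real spectral value is an
   eigenvalue of [M] itself. *)
have spk k : toC c <= sp 0 k.
  have /mxOverP/(_ 0 k)/complex_realP[x spx] := Preal.
  rewrite spx lecR ltW//; apply: eig; rewrite -(eigenvalue_map toC).
  apply/eigenvalueP; exists (row k Q).
    by rewrite -row_mul QA row_mul row_diag_mx -scalemxAl -rowE spx.
  apply/eqP => rk0; have := unitarymx_unit Punitary.
  rewrite -row_free_unit => /row_free_inj/(_ (delta_mx 0 k : 'rV[C]_n) 0).
  rewrite /= -rowE rk0 mul0mx => /(_ erefl)/matrixP/(_ 0 k).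
  by rewrite !mxE !eqxx => /eqP; rewrite oner_eq0.
pose w := Q *m map_mx toC v.
have quadC : toC (quad M v) = \sum_k sp 0 k * (w k 0 * (w k 0)^*).
  have -> : toC (quad M v) = (w^t* *m (diag_mx sp *m w)) 0 0.
    rewrite /w trmx_mul map_mxM/= conjR.
    transitivity ((map_mx toC v^T *m A *m map_mx toC v) 0 0).
      by rewrite -!map_mxM mxE quadE.
    by rewrite [in LHS]AE !mulmxA.
  rewrite mxE; apply: eq_bigr => k _.
  by rewrite mul_diag_mx !mxE mulrCA [X in _ = _ * X]mulrC.
have normC : toC (\sum_k v k 0 ^+ 2) = \sum_k w k 0 * (w k 0)^*.
  have -> : toC (\sum_k v k 0 ^+ 2) = (w^t* *m w) 0 0.
    rewrite /w trmx_mul map_mxM/= conjR mulmxA -(mulmxA _ (Q^t*)).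
    have -> : Q^t* *m Q = 1%:M.
      apply: mulmx1C; exact: (elimT unitarymxP Punitary).
    rewrite mulmx1 -map_mxM mxE mxE; congr toC.
    by apply: eq_bigr => k _; rewrite mxE expr2.
  by rewrite mxE; apply: eq_bigr => k _; rewrite !mxE mulrC.
rewrite -lecR rmorphM /= quadC normC mulr_sumr; apply: ler_sum => k _.
by apply: ler_wpM2r => //; exact: mul_conjC_ge0.
Qed.

End symmetric_eigenvalues.

(** * Bounded solutions of stable linear recursions *)

Section stable_recursions.
Variable R : realType.
Local Notation C := R[i].
Local Notation toC := (real_complex R).

Definition bounded_mx k n (r : nat -> 'M[C]_(k, n)) : Prop :=
  exists K : C, forall t i j, `|r t i j| <= K.

Lemma bounded_mx_mulr k n l (r : nat -> 'M[C]_(k, n)) (M : 'M[C]_(n, l)) :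
  bounded_mx r -> bounded_mx (fun t => r t *m M).
Proof.
move=> [K rK]; exists (K * \sum_a \sum_b `|M a b|) => t i j.
rewrite mxE mulr_sumr; apply: (le_trans (ler_norm_sum _ _ _)).
apply: ler_sum => a _; rewrite normrM ler_pM//.
by rewrite (bigD1 j)//= lerDl sumr_ge0.
Qed.

Lemma le_geometric_eq0 (a z K : C) : `|a| < 1 ->
  (forall t, `|z| <= `|a| ^+ t * K) -> z = 0.
Proof.
move=> a1 zK.
have nR (y : C) : exists2 x, 0 <= x & `|y| = toC x.
  exists (Num.sqrt (complex.Re y ^+ 2 + complex.Im y ^+ 2)); first exact: sqrtr_ge0.
  exact: normc_def.
have [x x0 ax] := nR a; have [y y0 zy] := nR z.
(* At [t = 0] the constant [K] dominates a norm, which in the order of the complex numbers forces it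
   to be real. *)
have [L KL] : exists L, K = toC L.
  have := zK 0%N; rewrite expr0 mul1r => /(le_trans (normr_ge0 _)) K0.
  by exists (complex.Re K); rewrite RRe_real// ger0_real.
have yx t : y <= x ^+ t * L.
  by rewrite -lecR rmorphM rmorphXn /= -ax -zy -KL.
move: a1; rewrite ax -(rmorph1 toC) ltcR => x1.
have cv : x ^+ t * L @[t --> \oo] --> 0.
  rewrite -[X in _ --> X](mul0r L); apply: cvgMl.
  by apply: cvg_expr; rewrite ger0_norm.
have y00 : y <= 0.
  rewrite leNgt; apply/negP => ypos.
  have [N _ /(_ N (leqnn N))/=] := cvgr_lt _ cv _ ypos.
  by rewrite ltNge yx.
apply/eqP; rewrite -normr_eq0 zy; have -> : y = 0 by apply/eqP; rewrite eq_le y00.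
by rewrite rmorph0.
Qed.

Lemma bounded_mx_contraction_eq0 k n (a : C) (r : nat -> 'M[C]_(k, n)) : `|a| < 1 ->
  bounded_mx r -> (forall t, r t = a *: r t.+1) -> forall t, r t = 0.
Proof.
move=> a1 [K rK] rec t.
have iter s : r t = a ^+ s *: r (t + s)%N.
  elim: s => [|s IH]; first by rewrite expr0 scale1r addn0.
  by rewrite IH rec scalerA -exprSr addnS.
apply/matrixP => i j; rewrite [RHS]mxE; apply: (le_geometric_eq0 (K := K) a1) => s.
by rewrite (iter s) mxE normrM normrX ler_wpM2l// exprn_ge0.
Qed.

(* Cayley-Hamilton splits [r t] along linear factors [M - a], and each factor is
   peeled off by [hG], so that no bound on the powers of [M] is needed. *)
Lemma stable_recursion_eq0 k n (G : 'M[C]_(k, n) -> 'M[C]_(k, n)) (M : 'M[C]_n)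
    (r : nat -> 'M[C]_(k, n)) :
  (forall X (Y : 'M[C]_n), G X *m Y = G (X *m Y)) ->
  (forall a X, G (a *: X) = a *: G X) ->
  (forall a s, `|a| < 1 -> bounded_mx s -> (forall t, s t = a *: G (s t.+1)) ->
     forall t, s t = 0) ->
  (forall a, eigenvalue M a -> `|a| < 1) ->
  bounded_mx r -> (forall t, r t = G (r t.+1) *m M) -> forall t, r t = 0.
Proof.
move=> GM GZ hG eigM br rec.
case: n => [|n] in G M r GM GZ hG eigM br rec *.
  by move=> t; apply/matrixP => i [].
have [s char_s] := closed_field_poly_normal (char_poly M).
have lead1 : lead_coef (char_poly M) = 1 by apply/monicP; exact: char_poly_monic.
rewrite lead1 scale1r in char_s.
have s1 a : a \in s -> `|a| < 1.
  move=> sa; apply: eigM; rewrite eigenvalue_root_char char_s.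
  by rewrite root_prod_XsubC.
have kill t : r t *m \prod_(a <- s) (M - a%:M) = 0.
  have := Cayley_Hamilton M; rewrite char_s rmorph_prod /=.
  under eq_bigr do rewrite rmorphB /= horner_mx_X horner_mx_C.
  by move=> ->; rewrite mulmx0.
clear char_s lead1; elim: s => [|a s IH] in r br rec s1 kill *.
  by move=> t; have := kill t; rewrite big_nil mulmx1.
pose w t := r t *m (M - a%:M).
have w0 : forall t, w t = 0.
  apply: IH.
  - exact: bounded_mx_mulr.
  - move=> t; rewrite /w [in LHS]rec -GM -!mulmxA; congr (_ *m _).
    by rewrite mulmxBr mulmxBl scalar_mxC.
  - by move=> b sb; apply: s1; rewrite inE sb orbT.
  - by move=> t; have := kill t; rewrite big_cons /w -mulmxA.
have rM t : r t *m M = a *: r t.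
  by apply/eqP; rewrite -subr_eq0 -mul_mx_scalar -mulmxBr; apply/eqP; exact: w0.
apply: (hG a) => //; first by apply: s1; rewrite inE eqxx.
by move=> t; rewrite [LHS]rec GM rM GZ.
Qed.

(** The factor [a] may have modulus 1: it is 1 for the plain row recursion, and an eigenvalue of [M]
    when this lemma serves the two-sided recursion. *)
Lemma eigenvalue_le1_row k n (M : 'M[C]_n) (a : C) (r : nat -> 'M[C]_(k, n)) :
  (forall a, eigenvalue M a -> `|a| < 1) -> `|a| <= 1 -> bounded_mx r ->
  (forall t, r t = a *: r t.+1 *m M) -> forall t, r t = 0.
Proof.
move=> eigM a1 br rec; apply: (@stable_recursion_eq0 _ _ (fun X => a *: X) M) => //.
- by move=> X Y; rewrite scalemxAl.
- by move=> b X; rewrite !scalerA mulrC.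
- move=> b s b1 bs recs; apply: (@bounded_mx_contraction_eq0 _ _ (b * a)) => //.
    rewrite normrM; apply: le_lt_trans b1.
    by rewrite -[leRHS]mulr1 ler_wpM2l.
  by move=> t; rewrite recs scalerA.
Qed.

Definition real_bounded_mx k n (r : nat -> 'M[R]_(k, n)) : Prop :=
  exists K : R, forall t i j, `|r t i j| <= K.

Lemma real_bounded_mxC k n (r : nat -> 'M[R]_(k, n)) :
  real_bounded_mx r -> bounded_mx (fun t => map_mx toC (r t)).
Proof.
move=> [K rK]; exists (toC K) => t i j; rewrite mxE normc_def /= expr0n /= addr0.
by rewrite sqrtr_sqr lecR.
Qed.

Lemma map_mx_toC_eq0 k n (X : 'M[R]_(k, n)) : map_mx toC X = 0 -> X = 0.
Proof.
move=> /matrixP X0; apply/matrixP => i j; have := X0 i j; rewrite !mxE.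
by move=> /complexI.
Qed.

Theorem stable_row_recursion_eq0 k n (M : 'M[R]_n) (r : nat -> 'M[R]_(k, n)) :
  (forall a, eigenvalue (map_mx toC M) a -> `|a| < 1) -> real_bounded_mx r ->
  (forall t, r t = r t.+1 *m M) -> forall t, r t = 0.
Proof.
move=> eigM /real_bounded_mxC br rec t; apply: map_mx_toC_eq0.
apply: (@eigenvalue_le1_row _ _ _ 1 (fun t => map_mx toC (r t)) eigM) => //.
  by rewrite normr1.
by move=> s; rewrite scale1r [in LHS]rec map_mxM.
Qed.

(** Peeling the right factor along the eigenvalues [a] of [M] leaves one-sided recursions in the
    transpose of [M], scaled by [a]; transposed, they are row recursions. *)
Theorem stable_conj_recursion_eq0 n (M : 'M[R]_n) (r : nat -> 'M[R]_n) :
  (forall a, eigenvalue (map_mx toC M) a -> `|a| < 1) -> real_bounded_mx r ->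
  (forall t, r t = M^T *m r t.+1 *m M) -> forall t, r t = 0.
Proof.
move=> eigM /real_bounded_mxC br rec t; apply: map_mx_toC_eq0.
apply: (@stable_recursion_eq0 _ _ (fun X => (map_mx toC M)^T *m X) (map_mx toC M)
  (fun t => map_mx toC (r t))) => //.
- by move=> X Y; rewrite mulmxA.
- by move=> a X; rewrite scalemxAr.
- move=> a s a1 [K sK] recs u; apply: trmx_inj; rewrite trmx0.
  apply: (@eigenvalue_le1_row _ _ _ a (fun t => (s t)^T) eigM (ltW a1)).
    by exists K => v i j; rewrite mxE.
  by move=> v; rewrite [in LHS]recs linearZ /= trmx_mul trmxK scalemxAl.
by move=> s; rewrite [in LHS]rec !map_mxM map_trmx.
Qed.

End stable_recursions.

Section mxvec_indexing.
Variables (m n : nat).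

Lemma index_allpairs (S T : eqType) (s : seq S) (t : seq T) x y : x \in s -> y \in t ->
  index (x, y) [seq (a, b) | a <- s, b <- t] = (index x s * size t + index y t)%N.
Proof.
elim: s => // a s IH; rewrite inE => xs yt.
rewrite allpairs_cons index_cat /=; case: (eqVneq a x) xs => [->|ax] xs.
  by rewrite map_f// index_map// => b c [].
rewrite ifN; last by apply/mapP => -[b _ [xa _]]; rewrite xa eqxx in ax.
by rewrite size_map IH// mulSn addnA.
Qed.

(** The companion matrix is defined through numerical positions, the lag vector through pairs of a
    block and a coordinate; this converts between them. *)
Lemma val_mxvec_index (i : 'I_m) (j : 'I_n) :
  mxvec_index i j = (i * n + j)%N :> nat.
Proof.
rewrite /mxvec_index /=.
have -> : enum_rank (i, j) = index (i, j) (enum {: 'I_m * 'I_n}) :> nat.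
  rewrite -[in RHS](nth_enum_rank (i, j) (i, j)) index_uniq ?enum_uniq//.
  by rewrite -cardE.
have -> : enum {: 'I_m * 'I_n} = [seq (a, b) | a <- enum 'I_m, b <- enum 'I_n].
  by rewrite enumT unlock.
by rewrite index_allpairs ?mem_enum// !index_enum_ord size_enum_ord.
Qed.

Lemma big_mxvec_index (V : nmodType) (F : 'I_(m * n) -> V) :
  \sum_k F k = \sum_i \sum_j F (mxvec_index i j).
Proof.
rewrite pair_bigA /= (reindex _ (curry_mxvec_bij m n)).
by apply: eq_bigr => -[i j] _.
Qed.

End mxvec_indexing.

(** * First-order companion form of the autoregression *)

Section companion.
Variables (R : realType) (Omega : Type) (p d : nat).
Variables (x eps : int -> Omega -> 'cV[R]_d) (A : 'I_p -> 'M[R]_d).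
Hypothesis model : forall t w,
  x t w = \sum_(j < p) A j *m x (t - j.+1%:Z) w + eps t w.

Lemma lag_vectorE t w a i : lag_vector p x t w (mxvec_index a i) 0 = x (t - a%:Z) w i 0.
Proof. by rewrite mxE mxvecE mxE. Qed.

Lemma coef_mxE a i l : coef_mx A (mxvec_index a i) l = A a l i.
Proof. by rewrite mxE mxvecE mxE. Qed.

Lemma model_lag_vector t w l :
  x t w l 0 = \sum_k coef_mx A k l * lag_vector p x (t - 1) w k 0 + eps t w l 0.
Proof.
rewrite model mxE; congr (_ + _); rewrite summxE big_mxvec_index.
apply: eq_bigr => j _; rewrite mxE; apply: eq_bigr => i _.
by rewrite coef_mxE lag_vectorE -addrA -opprD -[1]/(1%:Z) -PoszD add1n.
Qed.

Definition innovation (t : int) (w : Omega) : 'cV[R]_(p * d) :=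
  \col_k (if insub (val k) is Some l then eps t w l 0 else 0).

Lemma lag_vector_companion t w :
  lag_vector p x t w =
    block_companion (coef_mx A) *m lag_vector p x (t - 1) w + innovation t w.
Proof.
apply/colP => k; case/mxvec_indexP: k => a i.
rewrite lag_vectorE [RHS]mxE [X in _ = X + _]mxE [X in _ = _ + X]mxE.
under eq_bigr do rewrite mxE.
have vk : \val (mxvec_index a i) = (a * d + i)%N := val_mxvec_index a i.
rewrite vk; case: insubP => [l il vl|].
  have a0 : a = 0%N :> nat.
    apply/eqP; rewrite -leqn0 leqNgt; apply/negP => a1.
    by move: il; rewrite ltnNge (leq_trans (leq_pmull d a1) (leq_addr _ _)).
  have -> : l = i by apply/val_inj; rewrite /= vl a0.
  rewrite a0 subr0 model_lag_vector; congr (_ + _).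
  by apply: eq_bigr => k _; rewrite [_^T _ _]mxE.
rewrite -leqNgt => di.
have a0 : (0 < a)%N.
  rewrite lt0n; apply/eqP => a0; move: di; rewrite a0 mul0n add0n.
  by rewrite leqNgt ltn_ord.
have ap : (a.-1 < p)%N by have := ltn_ord a; lia.
(* Below the first block, row [a * d + i] selects position [(a - 1) * d + i]: lag [a] from [t] is
   lag [a - 1] from [t - 1]. *)
have e1 : (mxvec_index a i == (d + mxvec_index (Ordinal ap) i)%N :> nat) = true.
  apply/eqP; rewrite (val_mxvec_index a i) (val_mxvec_index (Ordinal ap) i).
  by rewrite addnA -mulSn prednK.
rewrite (bigD1 (mxvec_index (Ordinal ap) i))// big1 => [|k kk].
  rewrite e1 mul1r lag_vectorE /= !addr0; congr (x _ w i 0).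
  by rewrite -addrA -opprD -[1]/(1%:Z) -PoszD add1n prednK.
case: eqP => [e|_]; last by rewrite mul0r.
by move: kk; rewrite -val_eqE /= -(eqn_add2l d) -e e1.
Qed.

End companion.

Section expected_matrices.
Context d' (Omega : measurableType d') (R : realType) (P : probability Omega R).

Definition integrable_mx m n (M : Omega -> 'M[R]_(m, n)) : Prop :=
  forall i j, P.-integrable setT (EFin \o (fun w => M w i j)).

Lemma expect_mxE m n (M : Omega -> 'M[R]_(m, n)) i j :
  expect_mx P M i j = \int[P]_w M w i j.
Proof. by rewrite mxE unlock. Qed.

Lemma integrable_eqfun (f g : Omega -> R) : f =1 g ->
  P.-integrable setT (EFin \o f) -> P.-integrable setT (EFin \o g).
Proof. by move=> /funext ->. Qed.

Lemma integrable_lincomb (I : Type) (s : seq I) (a : I -> R) (F : I -> Omega -> R) :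
  (forall k, P.-integrable setT (EFin \o F k)) ->
  P.-integrable setT (EFin \o (fun w => \sum_(k <- s) a k * F k w)) /\
  \int[P]_w (\sum_(k <- s) a k * F k w) = \sum_(k <- s) a k * \int[P]_w F k w.
Proof.
move=> iF; elim: s => [|k s [IH1 IH2]].
  split; last by under eq_Rintegral do rewrite big_nil; rewrite exp_cst big_nil.
  apply: (@integrable_eqfun (fun=> 0)); first by move=> w; rewrite big_nil.
  exact: (bmeas_integrable P (@bmeas_cst _ Omega R 0)).
have ia : P.-integrable setT (EFin \o (fun w => a k * F k w)).
  have -> : EFin \o (fun w => a k * F k w) = (fun w => ((a k)%:E * (EFin \o F k) w)%E).
    by apply/funext => w /=; rewrite EFinM.
  exact: integrableZl.
have sumE w : \sum_(j <- k :: s) a j * F j w = a k * F k w + \sum_(j <- s) a j * F j w.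
  by rewrite big_cons.
split.
  have -> : EFin \o (fun w => \sum_(j <- k :: s) a j * F j w) =
     ((EFin \o (fun w => (a k * F k w)%R)) \+
      (EFin \o (fun w => (\sum_(j <- s) a j * F j w)%R)))%E.
    by apply/funext => w /=; rewrite sumE EFinD.
  exact: integrableD.
under eq_Rintegral do rewrite sumE.
rewrite RintegralD// IH2 RintegralZl// big_cons//.
Qed.

Lemma integrable_mxD m n (M N : Omega -> 'M[R]_(m, n)) :
  integrable_mx M -> integrable_mx N -> integrable_mx (fun w => M w + N w).
Proof.
move=> iM iN i j.
have -> : EFin \o (fun w => (M w + N w) i j) =
   ((EFin \o (fun w => M w i j)) \+ (EFin \o (fun w => N w i j)))%E.
  by apply/funext => w /=; rewrite mxE EFinD.
exact: integrableD.
Qed.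

Lemma expect_mxD m n (M N : Omega -> 'M[R]_(m, n)) :
  integrable_mx M -> integrable_mx N ->
  expect_mx P (fun w => M w + N w) = expect_mx P M + expect_mx P N.
Proof.
move=> iM iN; apply/matrixP => i j; rewrite expect_mxE mxE !expect_mxE.
by rewrite -RintegralD//; apply: eq_Rintegral => w _; rewrite mxE.
Qed.

Lemma integrable_mx_mull m n k (L : 'M[R]_(k, m)) (M : Omega -> 'M[R]_(m, n)) :
  integrable_mx M -> integrable_mx (fun w => L *m M w) /\
  expect_mx P (fun w => L *m M w) = L *m expect_mx P M.
Proof.
move=> iM; split.
  move=> i j; apply: (integrable_eqfun _ (integrable_lincomb _ (L i) (fun a => iM a j)).1).
  by move=> w; rewrite mxE.
apply/matrixP => i j; rewrite expect_mxE mxE.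
under eq_Rintegral do rewrite mxE.
rewrite (integrable_lincomb _ (L i) (fun a => iM a j)).2.
by apply: eq_bigr => a _; rewrite expect_mxE.
Qed.

Lemma integrable_mx_tr m n (M : Omega -> 'M[R]_(m, n)) :
  integrable_mx M -> integrable_mx (fun w => (M w)^T).
Proof. by move=> iM i j; apply: integrable_eqfun (iM j i) => w; rewrite mxE. Qed.

Lemma expect_mx_tr m n (M : Omega -> 'M[R]_(m, n)) :
  expect_mx P (fun w => (M w)^T) = (expect_mx P M)^T.
Proof.
apply/matrixP => i j; rewrite expect_mxE [RHS]mxE expect_mxE.
by apply: eq_Rintegral => w _; rewrite mxE.
Qed.

Lemma integrable_mx_mulr m n k (L : 'M[R]_(n, k)) (M : Omega -> 'M[R]_(m, n)) :
  integrable_mx M -> integrable_mx (fun w => M w *m L) /\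
  expect_mx P (fun w => M w *m L) = expect_mx P M *m L.
Proof.
move=> iM; have [i1 e1] := integrable_mx_mull L^T (integrable_mx_tr iM).
have trE : (fun w => M w *m L) = (fun w => (L^T *m (M w)^T)^T).
  by apply/funext => w; rewrite trmx_mul !trmxK.
rewrite trE; split; first exact: integrable_mx_tr.
by rewrite (expect_mx_tr (fun w => L^T *m (M w)^T)) e1 expect_mx_tr trmx_mul !trmxK.
Qed.

End expected_matrices.

(** * Square integrability and second moments *)

Section second_moments.
Context d' (Omega : measurableType d') (R : realType) (P : probability Omega R).

Lemma Lfun2B (f g : Omega -> R) : f \in Lfun P 2%:E -> g \in Lfun P 2%:E ->
  (fun w => f w - g w) \in Lfun P 2%:E.
Proof.
move=> f2 g2; have p1 : (1 <= (2%:E : \bar R))%E by rewrite lee_fin; lra.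
have [_ /(_ (-1) g f g2 f2)] := Lfun_submod_closed P p1.
by rewrite scaleN1r addrC.
Qed.

Lemma Lfun2_lincomb (I : Type) (s : seq I) (a : I -> R) (F : I -> Omega -> R) :
  (forall k, F k \in Lfun P 2%:E) ->
  (fun w => \sum_(k <- s) a k * F k w) \in Lfun P 2%:E.
Proof.
move=> F2; have p1 : (1 <= (2%:E : \bar R))%E by rewrite lee_fin; lra.
have [z0 lin] := Lfun_submod_closed P p1.
have -> : (fun w => \sum_(k <- s) a k * F k w) = \sum_(k <- s) a k *: F k.
  by apply/funext => w; rewrite fct_sumE.
elim: s => [|k s IH]; first by rewrite big_nil.
by rewrite big_cons; exact: lin.
Qed.

Lemma Lfun2_integrableM (f g : Omega -> R) : f \in Lfun P 2%:E -> g \in Lfun P 2%:E ->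
  P.-integrable setT (EFin \o (fun w => f w * g w)).
Proof. by move=> f2 g2; apply/Lfun1_integrable; exact: Lfun2_mul_Lfun1. Qed.

(** A crude form of the arithmetic-geometric mean bound, sufficient to see that covariances stay
    bounded in time. *)
Lemma Rintegral_mul_le (f g : Omega -> R) : f \in Lfun P 2%:E -> g \in Lfun P 2%:E ->
  `|\int[P]_w (f w * g w)| <= \int[P]_w (f w ^+ 2) + \int[P]_w (g w ^+ 2).
Proof.
move=> f2 g2; have ifg := Lfun2_integrableM f2 g2.
have i_f := Lfun2_integrable_sqr f2; have i_g := Lfun2_integrable_sqr g2.
apply: (le_trans (le_normr_Rintegral measurableT ifg)).
rewrite -RintegralD//; apply: le_Rintegral => //.
- by have := integrable_abse ifg; congr (_.-integrable _ _).
- have -> : EFin \o (fun w => f w ^+ 2 + g w ^+ 2) =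
    ((EFin \o (fun w => (f w ^+ 2)%R)) \+ (EFin \o (fun w => (g w ^+ 2)%R)))%E by [].
  exact: integrableD.
- move=> w _; rewrite normrM.
  rewrite -(real_normK (num_real (f w))) -(real_normK (num_real (g w))).
  have := normr_ge0 (f w); have := normr_ge0 (g w); nra.
Qed.

(** Integrate the pointwise bound of the square by 1 plus the m-th power of the modulus. *)
Lemma Lnorm_Lfun2 (f : Omega -> R) (m C : R) : 2 <= m -> 0 <= C ->
  measurable_fun setT f -> (Lnorm P m%:E (EFin \o f) <= C%:E)%E ->
  f \in Lfun P 2%:E /\ \int[P]_w (f w ^+ 2) <= 1 + C `^ m.
Proof.
move=> m2 C0 mf fC; have m0 : 0 < m by lra.
have /Lnorm_leP-/(_ m0 C0) fC' := fC.
have sqE w : f w ^+ 2 <= 1 + `|f w| `^ m.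
  rewrite -(real_normK (num_real (f w))).
  have [h1|h1] := lerP `|f w| 1.
    have := powR_ge0 `|f w| m; have := normr_ge0 (f w); nra.
  have : `|f w| ^+ 2 <= `|f w| `^ m by rewrite -powR_mulrn// ler_powR// ltW.
  by lra.
have ip : P.-integrable setT (EFin \o (fun w => `|f w| `^ m)).
  apply/integrableP; split.
    apply/measurable_EFinP; apply: (measurableT_comp (measurable_powR m)).
    exact: measurableT_comp.
  apply: le_lt_trans (ltry (C `^ m)); apply: le_trans fC'.
  rewrite le_eqVlt; apply/orP; left; apply/eqP; apply: eq_integral => x _ /=.
  by rewrite ger0_norm ?powR_ge0.
have i1 : P.-integrable setT (EFin \o (fun w => 1 + `|f w| `^ m)).
  have -> : EFin \o (fun w => 1 + `|f w| `^ m) =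
      ((EFin \o cst 1%R) \+ (EFin \o (fun w => (`|f w| `^ m)%R)))%E by [].
  by apply: integrableD => //; exact: finite_measure_integrable_cst.
have i2 : P.-integrable setT (EFin \o (fun w => f w ^+ 2)).
  apply: (@le_integrable _ _ _ P setT measurableT _ _ _ _ i1).
    by apply/measurable_EFinP; exact: measurable_funX.
  move=> w _ /=; rewrite lee_fin ger0_norm ?sqr_ge0// (le_trans (sqE w))//.
  exact: ler_norm.
split.
  rewrite inE; apply/andP; split; rewrite inE/=; first exact: mf.
  rewrite /finite_norm.
  have := (@integrable_lty _ _ _ P setT measurableT _ i2); rewrite unlock /=.
  move=> h; apply: poweR_lty; apply: le_lt_trans h.
  rewrite le_eqVlt; apply/orP; left; apply/eqP; apply: eq_integral => w _ /=.
  by rewrite powR_mulrn// real_normK ?num_real.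
apply: (@le_trans _ _ (\int[P]_w (1 + `|f w| `^ m))).
  by apply: le_Rintegral => // w _; exact: sqE.
have i0 : P.-integrable setT (EFin \o cst 1%R) by exact: finite_measure_integrable_cst.
rewrite (@RintegralD _ _ _ P setT (cst 1) (fun w => `|f w| `^ m))// exp_cst lerD2l.
by rewrite -lee_fin /Rintegral fineK//; exact: integrable_fin_num.
Qed.

End second_moments.

(** * Second-order stationarity *)

Section stationary_moments.
Context d' (Omega : measurableType d') (R : realType) (P : probability Omega R).
Variables (p d : nat) (x eps : int -> Omega -> 'cV[R]_d) (A : 'I_p -> 'M[R]_d).
Variables (Sigma_eps : 'M[R]_d) (K : R).
Hypothesis model : forall t w,
  x t w = \sum_(j < p) A j *m x (t - j.+1%:Z) w + eps t w.
Hypothesis x_L2 : forall t i, (fun w => x t w i 0) \in Lfun P 2%:E.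
Hypothesis x_var : forall t i, \int[P]_w (x t w i 0 ^+ 2) <= K.
Hypothesis noise_var : forall t i j,
  \int[P]_w (eps t w i 0 * eps t w j 0) = Sigma_eps i j.
Hypothesis noise_uncorrelated : forall t1 t2 i j, t1 <> t2 ->
  \int[P]_w (eps t1 w i 0 * eps t2 w j 0) = 0.
Local Notation Smx := (coef_mx A).
Local Notation z := (lag_vector p x).
Local Notation u := (innovation p eps).
Local Notation comp := (block_companion Smx).
Hypothesis stable : forall a : R[i],
  eigenvalue (map_mx (real_complex R) (Sdagger Smx)) a -> `|a| < 1.

Lemma lag_vector_L2 t k : (fun w => z t w k 0) \in Lfun P 2%:E.
Proof.
case/mxvec_indexP: k => a i; under eq_fun do rewrite lag_vectorE; exact: x_L2.
Qed.

Lemma lag_vector_var t k : \int[P]_w (z t w k 0 ^+ 2) <= K.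
Proof.
case/mxvec_indexP: k => a i; under eq_Rintegral do rewrite lag_vectorE; exact: x_var.
Qed.

(** Moments of the innovations are inherited from the observations, since the model equation
    expresses [eps] as a linear combination of values of [x]. *)
Lemma noise_L2 t i : (fun w => eps t w i 0) \in Lfun P 2%:E.
Proof.
have -> : (fun w => eps t w i 0) =
    (fun w => x t w i 0 - \sum_k Smx k i * z (t - 1) w k 0).
  by apply/funext => w; rewrite (model_lag_vector model) addrC addKr.
by apply: Lfun2B; [exact: x_L2|apply: Lfun2_lincomb => k; exact: lag_vector_L2].
Qed.

Lemma noise_integrable t i j s :
  P.-integrable setT (EFin \o (fun w => eps t w i 0 * z s w j 0)).
Proof. by apply: Lfun2_integrableM; [exact: noise_L2|exact: lag_vector_L2]. Qed.

Lemma innovation_L2 t k : (fun w => u t w k 0) \in Lfun P 2%:E.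
Proof.
under eq_fun do rewrite mxE; case: insubP => [l _ _|_]; first exact: noise_L2.
exact: Lfun_cst.
Qed.

Lemma integrable_mx_outer n m (f : Omega -> 'cV[R]_n) (g : Omega -> 'cV[R]_m) :
  (forall i, (fun w => f w i 0) \in Lfun P 2%:E) ->
  (forall i, (fun w => g w i 0) \in Lfun P 2%:E) ->
  integrable_mx P (fun w => f w *m (g w)^T).
Proof.
move=> f2 g2 i j; apply: integrable_eqfun (Lfun2_integrableM (f2 i) (g2 j)) => w.
by rewrite mxE big_ord1 mxE.
Qed.

Lemma expect_mx_outer n m (f : Omega -> 'cV[R]_n) (g : Omega -> 'cV[R]_m) i j :
  expect_mx P (fun w => f w *m (g w)^T) i j = \int[P]_w (f w i 0 * g w j 0).
Proof.
by rewrite expect_mxE; apply: eq_Rintegral => w _; rewrite mxE big_ord1 mxE.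
Qed.

Lemma noise_innovation_uncorrelated t s i k : t <> s ->
  \int[P]_w (eps t w i 0 * u s w k 0) = 0.
Proof.
move=> ts; under eq_Rintegral do rewrite mxE.
case: insubP => [l _ _|_]; first exact: noise_uncorrelated.
by under eq_Rintegral do rewrite mulr0; rewrite exp_cst.
Qed.

(* The cross covariances satisfy a recursion running backwards in time, so they
   vanish because they are bounded. *)
Lemma noise_lag_uncorrelated t : expect_mx P (fun w => eps t w *m (z (t - 1) w)^T) = 0.
Proof.
pose r n := expect_mx P (fun w => eps t w *m (z (t - 1 - n%:Z) w)^T).
suff : forall n, r n = 0 by move=> /(_ 0%N); rewrite /r subr0.
have eps2 := noise_L2 t; have z2 := lag_vector_L2.
apply: (@stable_row_recursion_eq0 _ _ _ (Sdagger Smx)); first exact: stable.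
  exists (\sum_i Sigma_eps i i + \sum_(k < p * d) K) => n i k.
  rewrite expect_mx_outer (le_trans (Rintegral_mul_le (eps2 i) (z2 _ k)))//.
  have S0 j : 0 <= Sigma_eps j j.
    rewrite -(noise_var t); apply: Rintegral_ge0 => w _.
    by rewrite -expr2 sqr_ge0.
  apply: lerD.
    under eq_Rintegral do rewrite expr2.
    by rewrite noise_var (bigD1 i)//= lerDl sumr_ge0.
  apply: (le_trans (lag_vector_var _ k)); rewrite (bigD1 k)//= lerDl sumr_ge0//.
  move=> _ _; apply: le_trans (lag_vector_var t k); apply: Rintegral_ge0 => w _.
  exact: sqr_ge0.
move=> n; rewrite /r.
have split_z w : eps t w *m (z (t - 1 - n%:Z) w)^T =
    eps t w *m (z (t - 1 - n.+1%:Z) w)^T *m comp^T + eps t w *m (u (t - 1 - n%:Z) w)^T.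
  rewrite (lag_vector_companion model) linearD mulmxDr /= trmx_mul mulmxA.
  by rewrite (_ : t - 1 - n%:Z - 1 = t - 1 - n.+1%:Z)//; lia.
under [in LHS]eq_fun do rewrite split_z.
have i1 := integrable_mx_outer eps2 (z2 (t - 1 - n.+1%:Z)).
have [i2 e2] := integrable_mx_mulr comp^T i1.
have i3 := integrable_mx_outer eps2 (innovation_L2 (t - 1 - n%:Z)).
rewrite expect_mxD// e2 [X in _ + X](_ : _ = 0) ?addr0//.
apply/matrixP => i k; rewrite expect_mx_outer noise_innovation_uncorrelated ?mxE//.
by lia.
Qed.

Lemma noise_lag_uncorrelatedE t i k : \int[P]_w (eps t w i 0 * z (t - 1) w k 0) = 0.
Proof. by rewrite -expect_mx_outer noise_lag_uncorrelated mxE. Qed.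

Definition second_moment t := expect_mx P (fun w => z t w *m (z t w)^T).

Lemma second_moment_bounded t k l : `|second_moment t k l| <= K + K.
Proof.
rewrite expect_mx_outer.
apply: (le_trans (Rintegral_mul_le (lag_vector_L2 t k) (lag_vector_L2 t l))).
by apply: lerD; exact: lag_vector_var.
Qed.

Definition innovation_var : 'M[R]_(p * d) := expect_mx P (fun w => u 0 w *m (u 0 w)^T).

(** Both cross terms vanish because the innovation is uncorrelated with the past, and its covariance
    is the same at time [t] as at time 0. *)
Lemma second_moment_rec t :
  second_moment t = comp *m second_moment (t - 1) *m comp^T + innovation_var.
Proof.
have z2 := lag_vector_L2 (t - 1); have u2 := innovation_L2 t.
have izz := integrable_mx_outer z2 z2; have izu := integrable_mx_outer z2 u2.
have iuz := integrable_mx_outer u2 z2; have iuu := integrable_mx_outer u2 u2.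
have [i1 e1] := integrable_mx_mull comp izz.
have [i2 e2] := integrable_mx_mulr comp^T i1.
have [i3 e3] := integrable_mx_mull comp izu.
have [i4 e4] := integrable_mx_mulr comp^T iuz.
have uz0 : expect_mx P (fun w => u t w *m (z (t - 1) w)^T) = 0.
  apply/matrixP => k l; rewrite expect_mx_outer [RHS]mxE.
  under eq_Rintegral do rewrite mxE.
  case: insubP => [i _ _|_]; first exact: noise_lag_uncorrelatedE.
  by under eq_Rintegral do rewrite mul0r; rewrite exp_cst.
have zu0 : expect_mx P (fun w => z (t - 1) w *m (u t w)^T) = 0.
  apply/matrixP => k l; rewrite expect_mx_outer.
  have /matrixP/(_ l k) := uz0; rewrite expect_mx_outer => uz.
  rewrite [RHS]mxE -[RHS](_ : (0 : 'M[R]_(p * d)) l k = 0) ?mxE//.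
  by move: uz; rewrite mxE => <-; apply: eq_Rintegral => w _; rewrite mulrC.
have split_zz w : z t w *m (z t w)^T =
    (comp *m (z (t - 1) w *m (z (t - 1) w)^T) *m comp^T +
     comp *m (z (t - 1) w *m (u t w)^T)) +
    (u t w *m (z (t - 1) w)^T *m comp^T + u t w *m (u t w)^T).
  rewrite (lag_vector_companion model) linearD mulmxDl !mulmxDr /= trmx_mul.
  by rewrite !mulmxA.
rewrite /second_moment; under [in LHS]eq_fun do rewrite split_zz.
rewrite expect_mxD; [|exact: integrable_mxD|exact: integrable_mxD].
rewrite !expect_mxD// e2 e1 e3 e4 uz0 zu0 mulmx0 mul0mx addr0 add0r; congr (_ + _).
apply/matrixP => k l; rewrite !expect_mx_outer.
under eq_Rintegral do rewrite !mxE; under [RHS]eq_Rintegral do rewrite !mxE.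
case: insubP => [i _ _|_]; last by under eq_Rintegral do rewrite mul0r;
  under [RHS]eq_Rintegral do rewrite mul0r.
case: insubP => [j _ _|_]; first by rewrite !noise_var.
by under eq_Rintegral do rewrite mulr0; under [RHS]eq_Rintegral do rewrite mulr0.
Qed.

(** The constant innovation term drops out of differences of consecutive second moments, which are
    bounded and satisfy the homogeneous two-sided recursion. *)
Lemma second_moment_step t : second_moment t = second_moment (t - 1).
Proof.
apply/eqP; rewrite -subr_eq0; apply/eqP.
pose r n := second_moment (t - n%:Z) - second_moment (t - n%:Z - 1).
suff : forall n, r n = 0 by move=> /(_ 0%N); rewrite /r subr0.
apply: (@stable_conj_recursion_eq0 _ _ (Sdagger Smx)); first exact: stable.
  exists (K + K + (K + K)) => n k l; rewrite mxE [X in _ + X]mxE.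
  by apply: (le_trans (ler_normB _ _)); apply: lerD; exact: second_moment_bounded.
move=> n; rewrite /r trmxK.
rewrite (_ : t - n.+1%:Z = t - n%:Z - 1); last by lia.
rewrite [in LHS](second_moment_rec (t - n%:Z)).
rewrite [X in _ - X](second_moment_rec (t - n%:Z - 1)).
by rewrite opprD addrACA subrr addr0 mulmxBr mulmxBl.
Qed.

Lemma second_moment_cst t : second_moment t = Sigma0 P p x.
Proof.
have down s n : second_moment s = second_moment (s - n%:Z).
  elim: n => [|n IH]; first by rewrite subr0.
  by rewrite IH second_moment_step; congr second_moment; lia.
rewrite -[RHS]/(second_moment p%:Z).
have [tp|pt] := lerP t p%:Z.
  rewrite (down p%:Z `|p%:Z - t|%N); congr second_moment; lia.
by rewrite (down t `|t - p%:Z|%N); congr second_moment; lia.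
Qed.

Lemma lag_vector_second_moment t k l :
  \int[P]_w (z t w k 0 * z t w l 0) = Sigma0 P p x k l.
Proof. by rewrite -(second_moment_cst t) expect_mx_outer. Qed.

(** The Yule-Walker equations. *)
Lemma lag_vector_next_moment t k l :
  \int[P]_w (z t w k 0 * x (t + 1) w l 0) = \sum_j Sigma0 P p x k j * Smx j l.
Proof.
have z2 := lag_vector_L2 t.
transitivity (\int[P]_w (\sum_j Smx j l * (z t w k 0 * z t w j 0) +
    eps (t + 1) w l 0 * z t w k 0)).
  apply: eq_Rintegral => w _; rewrite (model_lag_vector model) addrK mulrDr.
  rewrite mulr_sumr [z t w k 0 * eps _ _ _ _]mulrC; congr (_ + _).
  by apply: eq_bigr => j _; ring.
have [i1 e1] := integrable_lincomb (P := P) (index_enum _) (fun j => Smx j l)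
  (fun j => Lfun2_integrableM (z2 k) (z2 j)).
rewrite RintegralD//; last exact: noise_integrable.
rewrite e1 (_ : \int[P]_w (eps (t + 1) w l 0 * z t w k 0) = 0); last first.
  by have := noise_lag_uncorrelatedE (t + 1) l k; rewrite addrK.
rewrite addr0; apply: eq_bigr => j _.
by rewrite lag_vector_second_moment mulrC.
Qed.

Lemma Sigma0_sym : (Sigma0 P p x)^T = Sigma0 P p x.
Proof.
apply/matrixP => k l; rewrite mxE -!(lag_vector_second_moment 0).
by apply: eq_Rintegral => w _; rewrite mulrC.
Qed.

(** An observation is its linear prediction plus an uncorrelated innovation, so its second moment is
    at least that of the prediction, which is the quadratic form. *)
Lemma quad_Sigma0_coef l : quad (Sigma0 P p x) (col l Smx) <= K.
Proof.
pose t : int := 0.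
have z2 := lag_vector_L2 t; have e2 := noise_L2 (t + 1).
pose f w := \sum_k Smx k l * z t w k 0.
have f2 : f \in Lfun P 2%:E.
  by apply: Lfun2_lincomb => k; exact: z2.
have xE w : x (t + 1) w l 0 = f w + eps (t + 1) w l 0.
  by rewrite (model_lag_vector model) addrK.
have quadE : quad (Sigma0 P p x) (col l Smx) = \int[P]_w (f w * f w).
  have ff w : f w * f w = \sum_i Smx i l * (f w * z t w i 0).
    by rewrite {2}/f mulr_sumr; apply: eq_bigr => i _; ring.
  under eq_Rintegral do rewrite ff.
  rewrite (integrable_lincomb (P := P) (index_enum _) (fun j => Smx j l)
    (fun j => Lfun2_integrableM f2 (z2 j))).2.
  rewrite /quad; apply: eq_bigr => i _.
  have fz w : f w * z t w i 0 = \sum_j Smx j l * (z t w j 0 * z t w i 0).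
    by rewrite /f mulr_suml; apply: eq_bigr => j _; ring.
  under [in RHS]eq_Rintegral do rewrite fz.
  rewrite (integrable_lincomb (P := P) (index_enum _) (fun j => Smx j l)
    (fun j => Lfun2_integrableM (z2 j) (z2 i))).2 mulr_sumr.
  apply: eq_bigr => j _; rewrite ![col l Smx _ _]mxE lag_vector_second_moment.
  rewrite (_ : Sigma0 P p x j i = Sigma0 P p x i j); last by rewrite -[in LHS]Sigma0_sym mxE.
  by ring.
have fe0 : \int[P]_w (f w * eps (t + 1) w l 0) = 0.
  have fe w : f w * eps (t + 1) w l 0 = \sum_k Smx k l * (eps (t + 1) w l 0 * z t w k 0).
    by rewrite /f mulr_suml; apply: eq_bigr => k _; ring.
  under eq_Rintegral do rewrite fe.
  rewrite (integrable_lincomb (P := P) (index_enum _) (fun j => Smx j l)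
    (fun j => Lfun2_integrableM (e2 l) (z2 j))).2.
  rewrite big1// => k _; have := noise_lag_uncorrelatedE (t + 1) l k.
  by rewrite addrK => ->; rewrite mulr0.
rewrite quadE; apply: le_trans (x_var (t + 1) l).
have iff := Lfun2_integrableM f2 f2; have ife := Lfun2_integrableM f2 (e2 l).
have iee := Lfun2_integrableM (e2 l) (e2 l).
have -> : \int[P]_w (x (t + 1) w l 0 ^+ 2) =
    \int[P]_w ((f w * f w + f w * eps (t + 1) w l 0) +
      (f w * eps (t + 1) w l 0 + eps (t + 1) w l 0 * eps (t + 1) w l 0)).
  by apply: eq_Rintegral => w _; rewrite xE; ring.
have integrableDR (a b : Omega -> R) : P.-integrable setT (EFin \o a) ->
    P.-integrable setT (EFin \o b) -> P.-integrable setT (EFin \o (fun w => a w + b w)).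
  move=> ia ib.
  by rewrite (_ : EFin \o _ = ((EFin \o a) \+ (EFin \o b))%E)//; exact: integrableD.
rewrite RintegralD//; [|exact: integrableDR|exact: integrableDR].
rewrite !RintegralD// fe0 addr0 add0r lerDl; apply: Rintegral_ge0 => w _.
by rewrite -expr2 sqr_ge0.
Qed.

End stationary_moments.

(** * Probability of a large lasso error *)

Section lasso_sample.
Context (R : realType) (n q T : nat).
Variables (W : 'M[R]_(n, q)) (y : 'cV[R]_n) (G : 'M[R]_q) (S St : 'cV[R]_q).
Variables (lambda c eta s L : R) (B : {set 'I_q}).

(** The Gram matrix has [n] rows but is divided by [T], so its target is [n / T] times [G]. As [T]
    is at most twice [n], the curvature is still [c / 2], which doubles the constants 96 and 32. *)
Lemma lasso_sample_bound : 0 < lambda -> 0 < c -> 0 < s -> (0 < T)%N -> (T <= n.*2)%N ->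
  #|B|%:R <= s -> (forall k, k \notin B -> S k 0 = 0) -> norm1 S <= L ->
  (forall v : 'cV[R]_q, c * (\sum_k v k 0 ^+ 2) <= quad G v) ->
  (forall i j, `|(W^T *m W) i j - n%:R * G i j| <= T%:R * eta) ->
  (forall k, `|(W^T *m y) k 0 - n%:R * (G *m S) k 0| <= T%:R * eta) ->
  eta * (1 + L) <= lambda / 2 -> 64 * s * eta <= c ->
  lasso_objective T lambda y W St <= lasso_objective T lambda y W S ->
  norm1 (St - S) <= 192 * s * lambda / c.
Proof.
move=> l0 c0 s0 T0 Tn Bs SB SL eig gram cross etaL etac obj.
have T0R : 0 < T%:R :> R by rewrite ltr0n.
rewrite (_ : 192 * s * lambda / c = 96 * s * lambda / (c / 2)); last first.
  by field; rewrite gt_eqF.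
have normT a : `|a| <= T%:R * eta -> `|T%:R^-1 * a| <= eta.
  by move=> h; rewrite normrM ger0_norm ?invr_ge0// ler_pdivrMl.
apply: (@lasso_norm1_bound _ _ n T lambda (c / 2) eta s W y S St B
  ((n%:R / T%:R) *: G)) => //.
- by rewrite divr_gt0.
- move=> k.
  (* The mean of [W^T *m y] equals the mean of [W^T *m W] times [S], so only deviations remain, of
     total size at most [eta * (1 + L)]. *)
  have -> : T%:R^-1 * (W^T *m (y - W *m S)) k 0 =
     T%:R^-1 * ((W^T *m y) k 0 - n%:R * (G *m S) k 0) -
     \sum_j (T%:R^-1 * ((W^T *m W) k j - n%:R * G k j)) * S j 0.
    rewrite mulmxBr mulmxA mxE [X in _ + X]mxE [(W^T *m W *m S) _ _]mxE.
    rewrite [(G *m S) _ _]mxE.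
    under [X in _ = _ - X]eq_bigr do rewrite mulrBr mulrBl.
    rewrite sumrB.
    under [X in _ = _ - (X - _)]eq_bigr do rewrite -mulrA.
    under [X in _ = _ - (_ - X)]eq_bigr do rewrite -!mulrA.
    rewrite -!mulr_sumr; ring.
  apply: le_trans etaL; apply: (le_trans (ler_normB _ _)).
  rewrite [eta * _]mulrDr mulr1; apply: lerD; first exact: normT.
  apply: (le_trans (ler_norm_sum _ _ _)).
  apply: (@le_trans _ _ (\sum_j eta * `|S j 0|)).
    by apply: ler_sum => j _; rewrite normrM ler_wpM2r// normT.
  rewrite -mulr_sumr ler_wpM2l//.
  by rewrite -(pmulr_rge0 _ T0R) (le_trans _ (cross k)).
- move=> v; rewrite quadZ; have := eig v; set Q := quad G v; set N := \sum_k _ => h.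
  have N0 : 0 <= N by apply: sumr_ge0 => k _; exact: sqr_ge0.
  have half : 1 / 2 <= n%:R / T%:R :> R.
    have : T%:R <= (n * 2)%:R :> R by rewrite ler_nat muln2.
    by rewrite ler_pdivlMr// natrM; lra.
  apply: (@le_trans _ _ (n%:R / T%:R * (c * N))); last first.
    by rewrite ler_wpM2l// divr_ge0.
  rewrite (_ : c / 2 * N = 1 / 2 * (c * N)); last by field.
  by rewrite ler_wpM2r// mulr_ge0// ltW.
- move=> i j; rewrite [X in _ - X]mxE.
  rewrite (_ : _ - _ = T%:R^-1 * ((W^T *m W) i j - n%:R * G i j)); first exact: normT.
  by ring.
- by move: etac; lra.
Qed.

End lasso_sample.

(** * Union bound and measurability of the error events *)

Section measurable_events.
Context d' (Omega : measurableType d') (R : realType) (P : probability Omega R).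

Lemma probability_union_le (I : finType) (E : I -> set Omega) (F : set Omega) (b : R) :
  (forall i, measurable (E i)) -> measurable F -> F `<=` [set w | exists i, E i w] ->
  (forall i, (P (E i) <= b%:E)%E) -> (P F <= (#|I|%:R * b)%:E)%E.
Proof.
move=> mE mF FE Eb.
have bigE (s : seq I) : measurable (\big[setU/set0]_(i <- s) E i) /\
    (P (\big[setU/set0]_(i <- s) E i) <= ((size s)%:R * b)%:E)%E.
  elim: s => [|i s [IH1 IH2]].
    by rewrite big_nil measure0 mul0r; split.
  rewrite big_cons; split; first exact: measurableU.
  apply: le_trans; first exact: measureU2.
  by rewrite /= -natr1 mulrDl mul1r addrC EFinD leeD.
have [mU PU] := bigE (index_enum I).
apply: (@le_trans _ _ (P (\big[setU/set0]_i E i))).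
  apply: le_measure; rewrite ?inE// => w /FE[i Ei].
  by rewrite (bigD1 i)//=; left.
by apply: (le_trans PU); rewrite cardT enumT /index_enum unlock.
Qed.

Lemma measurable_superlevel (a : R) (f : Omega -> R) : measurable_fun setT f ->
  measurable [set w | a < f w].
Proof.
move=> mf; rewrite -[X in measurable X]setTI.
have -> : [set w | a < f w] = f @^-1` `]a, +oo[%classic.
  by apply/seteqP; split => w /=; rewrite in_itv /= andbT.
by apply: mf.
Qed.

Lemma measurable_exists_superlevel (I : finType) (a : R) (f : I -> Omega -> R) :
  (forall i, measurable_fun setT (f i)) -> measurable [set w | exists i, a < f i w].
Proof.
move=> mf; have -> : [set w | exists i, a < f i w] =
    \bigcup_(i in [set: I]) [set w | a < f i w].
  by apply/seteqP; split => [w [i h]|w [i _ h]]; exists i.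
apply: fin_bigcup_measurable => [|i _]; first exact: finite_finset.
exact: measurable_superlevel.
Qed.

Lemma measurable_norm1_col n k (M : Omega -> 'M[R]_(n, k)) (N : 'M[R]_(n, k)) l :
  (forall i, measurable_fun setT (fun w => M w i l)) ->
  measurable_fun setT (fun w => norm1 (col l (M w) - col l N)).
Proof.
move=> mM; apply: measurable_sum => i; apply: measurableT_comp => //.
under eq_fun do rewrite mxE [X in X + _]mxE.
by apply: measurable_funD => //; exact: measurable_cst.
Qed.

Lemma measurable_norm2_col n k (M : Omega -> 'M[R]_(n, k)) (N : 'M[R]_(n, k)) l :
  (forall i, measurable_fun setT (fun w => M w i l)) ->
  measurable_fun setT (fun w => norm2 (col l (M w) - col l N)).
Proof.
move=> mM; apply: (measurableT_comp (continuous_measurable_fun (@sqrt_continuous R))).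
apply: measurable_sum => i; apply: measurable_funX.
under eq_fun do rewrite mxE [X in X + _]mxE.
by apply: measurable_funD => //; exact: measurable_cst.
Qed.

Lemma measurable_thresholded_neq n k (b : R) (M : Omega -> 'M[R]_(n, k)) l
    (B : {set 'I_n}) : (forall i, measurable_fun setT (fun w => M w i l)) ->
  measurable [set w | thresholded b (M w) l != B].
Proof.
move=> mM; have -> : [set w | thresholded b (M w) l != B] =
    \bigcup_(i in [set: 'I_n]) [set w | (b < `|M w i l|) != (i \in B)].
  apply/seteqP; split => [w /= neq|w [i _] /=].
    apply: contrapT => noi; move/negP: neq; apply; apply/eqP/setP => i.
    rewrite finset.in_set; apply/eqP; apply: contrapT => /negP h; apply: noi.
    by exists i.
  by apply: contra => /eqP <-; rewrite finset.in_set.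
apply: fin_bigcup_measurable => [|i _]; first exact: finite_finset.
have mi : measurable [set w | b < `|M w i l|].
  by apply: measurable_superlevel; exact: measurableT_comp.
have [iB|iB] := boolP (i \in B); last by under eq_set do rewrite eqbF_neg negbK.
under eq_set do rewrite eqb_id.
by rewrite (_ : [set w | ~~ _] = ~` [set w | b < `|M w i l|]);
  [exact: measurableC|apply/seteqP; split => w /= /negP].
Qed.

End measurable_events.

(* The rows are enumerated backwards from time T, so that every factor is a
   function of the past of e at the one time T, as [product_concentration] needs. *)
Section sample_sums.
Context (Omega : Type) (R : realType).
Variables (p d T : nat) (x : int -> Omega -> 'cV[R]_d).
Hypothesis pT : (p <= T)%N.
Local Notation W := (design p T x).

(** The last row of the design is the lag vector at [T - 1], hence the offset [a.+1]; the last
    response is at time [T], hence the offset 0 in [design_responseE]. *)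
Lemma design_gramE w a i b j :
  ((W w)^T *m W w) (mxvec_index a i) (mxvec_index b j) =
  \sum_(r < T - p) x (T%:Z - (a.+1 + r)%N%:Z) w i 0 * x (T%:Z - (b.+1 + r)%N%:Z) w j 0.
Proof.
rewrite mxE (reindex_inj rev_ord_inj); apply: eq_bigr => r _.
rewrite mxE [W w _ _]mxE [W w _ _]mxE !lag_vectorE.
by congr (x _ w i 0 * x _ w j 0); have := ltn_ord r; rewrite /=; lia.
Qed.

Lemma design_responseE w a i l :
  ((W w)^T *m sample_column p T x l w) (mxvec_index a i) 0 =
  \sum_(r < T - p) x (T%:Z - (a.+1 + r)%N%:Z) w i 0 * x (T%:Z - (0 + r)%N%:Z) w l 0.
Proof.
rewrite mxE (reindex_inj rev_ord_inj); apply: eq_bigr => r _.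
rewrite mxE [W w _ _]mxE lag_vectorE [X in _ * X]mxE.
by congr (x _ w i 0 * x _ w l 0); have := ltn_ord r; rewrite /=; lia.
Qed.

End sample_sums.

Section sample_probability.
Context d' (Omega : measurableType d') (R : realType) (P : probability Omega R).
Variables (p d T : nat) (x eps : int -> Omega -> 'cV[R]_d) (A : 'I_p -> 'M[R]_d).
Variables (Sigma_eps : 'M[R]_d).
Hypothesis model : forall t w,
  x t w = \sum_(j < p) A j *m x (t - j.+1%:Z) w + eps t w.
Hypothesis noise_var : forall t i j,
  \int[P]_w (eps t w i 0 * eps t w j 0) = Sigma_eps i j.
Hypothesis noise_uncorrelated : forall t1 t2 i j, t1 <> t2 ->
  \int[P]_w (eps t1 w i 0 * eps t2 w j 0) = 0.
Local Notation Smx := (coef_mx A).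
Hypothesis stable : forall a : R[i],
  eigenvalue (map_mx (real_complex R) (Sdagger Smx)) a -> `|a| < 1.
Variables (e : int -> {RV P >-> R}) (g : int -> 'I_d -> seqR R -> R).
(* The moment order m is 2 * q: products of two coordinates have q moments. *)
Variables (q C : R) (delta : nat -> R) (Delta : R).
Hypothesis x_g : forall t i w, x t w i 0 = g t i (past_rv e t w).
Hypothesis indep : mutually_independent e.
Hypothesis mg : forall t i, measurable_fun setT (g t i).
Hypothesis q2 : 2 < q.
Hypothesis C0 : 0 <= C.
Hypothesis g_norm : forall t i,
  (Lnorm P (2 * q)%:E (fun w => (g t i (past_rv e t w))%:E) <= C%:E)%E.
Hypothesis g_dep : forall j,
  (dependence_coef P (2 * q) (fun s => e s) g j <= (delta j)%:E)%E.
Hypothesis delta_ge0 : forall j, 0 <= delta j.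
Hypothesis delta_sum : forall n, \sum_(j < n) delta j <= Delta.
Hypothesis pT : (p <= T)%N.
Local Notation W := (design p T x).
Local Notation y := (sample_column p T x).
Local Notation G := (Sigma0 P p x).
Local Notation K := (1 + C `^ (2 * q)).

Let measurable_x t i : measurable_fun setT (fun w => x t w i 0).
Proof.
have -> : (fun w => x t w i 0) = g t i \o past_rv e t by apply/funext => w; exact: x_g.
by apply: measurableT_comp => //; exact: measurable_past_rv.
Qed.

Let x_moments t i : (fun w => x t w i 0) \in Lfun P 2%:E /\
  \int[P]_w (x t w i 0 ^+ 2) <= K.
Proof.
apply: Lnorm_Lfun2 => //; first by move: q2; lra.
have -> : EFin \o (fun w => x t w i 0) = (fun w => (g t i (past_rv e t w))%:E).
  by apply/funext => w /=; rewrite x_g.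
exact: g_norm.
Qed.

Let x_L2 t i := (x_moments t i).1.
Let x_var t i := (x_moments t i).2.
Let z2 := lag_vector_L2 (p := p) x_L2.

Lemma expectation_gram k l :
  fine 'E_P[fun w => ((W w)^T *m W w) k l] = (T - p)%:R * G k l.
Proof.
rewrite unlock -/(Rintegral P setT _).
transitivity (\int[P]_w (\sum_(r < T - p) 1 *
    (lag_vector p x (p + r)%N w k 0 * lag_vector p x (p + r)%N w l 0))).
  apply: eq_Rintegral => w _; rewrite mxE; apply: eq_bigr => r _.
  by rewrite mul1r mxE !mxE.
rewrite (integrable_lincomb (P := P) (index_enum _) (fun r : 'I_(T - p) => 1)
  (fun r : 'I_(T - p) => Lfun2_integrableM (z2 (p + r)%N k) (z2 (p + r)%N l))).2.
under eq_bigr do rewrite mul1r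
  (lag_vector_second_moment model x_L2 x_var noise_var noise_uncorrelated stable).
by rewrite sumr_const card_ord mulr_natl.
Qed.

Lemma expectation_response k l :
  fine 'E_P[fun w => ((W w)^T *m y l w) k 0] = (T - p)%:R * (G *m Smx) k l.
Proof.
rewrite unlock -/(Rintegral P setT _).
transitivity (\int[P]_w (\sum_(r < T - p) 1 *
    (lag_vector p x (p + r)%N w k 0 * x (p + r)%N.+1 w l 0))).
  apply: eq_Rintegral => w _; rewrite mxE; apply: eq_bigr => r _.
  by rewrite mul1r mxE !mxE.
rewrite (integrable_lincomb (P := P) (index_enum _) (fun r : 'I_(T - p) => 1)
  (fun r : 'I_(T - p) => Lfun2_integrableM (z2 (p + r)%N k) (x_L2 (p + r)%N.+1 l))).2.
under eq_bigr => r _.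
  rewrite mul1r (_ : Posz (p + r).+1 = (p + r)%N%:Z + 1); last by lia.
  rewrite (lag_vector_next_moment model x_L2 x_var noise_var noise_uncorrelated stable).
  over.
by rewrite sumr_const card_ord mulr_natl [(_ *m _) _ _]mxE.
Qed.

Variables (eta : R).
Hypothesis Teta0 : 0 < T%:R * eta.

Definition deviation_bound : R :=
  concentration_cst q * ((2 * C * Delta) ^+ 2 * (T - p)%:R + 1) `^ (q / 2) *
  (T%:R * eta / 2) `^ (- q).

Lemma gram_deviation k l :
  (P [set w | (T%:R * eta < `|((W w)^T *m W w) k l - (T - p)%:R * G k l|)%R] <=
    deviation_bound%:E)%E.
Proof.
rewrite -expectation_gram; case/mxvec_indexP: k => a i; case/mxvec_indexP: l => b j.
apply: (product_concentration indep mg q2 C0 g_norm g_dep delta_ge0 delta_sum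
  (tau := T%:Z) (a := a.+1) (b := b.+1) (i := i) (j := j)) => // w.
by rewrite design_gramE//; under eq_bigr do rewrite !x_g.
Qed.

Lemma response_deviation k l :
  (P [set w | (T%:R * eta < `|((W w)^T *m y l w) k 0 - (T - p)%:R * (G *m Smx) k l|)%R] <=
    deviation_bound%:E)%E.
Proof.
rewrite -expectation_response; case/mxvec_indexP: k => a i.
apply: (product_concentration indep mg q2 C0 g_norm g_dep delta_ge0 delta_sum
  (tau := T%:Z) (a := a.+1) (b := 0) (i := i) (j := l)) => // w.
by rewrite design_responseE//; under eq_bigr do rewrite !x_g.
Qed.

Variables (c s lambda : R) (St : Omega -> 'M[R]_(p * d, d)).
Hypothesis c0 : 0 < c.
Hypothesis eig : forall a, eigenvalue G a -> c < a.
Hypothesis s0 : 0 < s.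
Hypothesis sparse : forall l, #|active Smx l|%:R <= s.
Hypothesis measurable_St : forall k l, measurable_fun setT (fun w => St w k l).
Hypothesis lasso_argmin : forall w l (u : 'cV[R]_(p * d)),
  lasso_objective T lambda (y l w) (W w) (col l (St w)) <=
  lasso_objective T lambda (y l w) (W w) u.
Hypothesis lambda0 : 0 < lambda.
Hypothesis T0 : (0 < T)%N.
Hypothesis pT2 : (T <= (T - p).*2)%N.

(** The square of the l1 norm is at most [s] times the squared l2 norm, which the eigenvalue bound
    and [quad_Sigma0_coef] limit to [K / c]. The final [+ 1] replaces a square root, as
    [t <= t ^+ 2 + 1]. *)
Lemma coef_norm1_le l : norm1 (col l Smx) <= s * K / c + 1.
Proof.
have -> : norm1 (col l Smx) = \sum_(k in active Smx l) `|Smx k l|.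
  rewrite /norm1 [RHS]big_mkcond; apply: eq_bigr => k _; rewrite mxE.
  by rewrite finset.in_set; case: eqP => // ->; rewrite normr0.
set t := \sum_(k in _) _.
suff : t ^+ 2 <= s * K / c by move=> h; have := sqr_ge0 (t - 1); nra.
apply: (le_trans (sqr_sum_le _ _)).
have h1 : \sum_(k in active Smx l) `|Smx k l| ^+ 2 <= K / c.
  rewrite ler_pdivlMr// mulrC.
  apply: le_trans (quad_Sigma0_coef model x_L2 x_var noise_var noise_uncorrelated stable l).
  have Gsym := Sigma0_sym model x_L2 x_var noise_var noise_uncorrelated stable.
  apply: le_trans (symmetric_quad_lower Gsym eig (col l Smx)).
  rewrite ler_pM2l// big_mkcond; apply: ler_sum => k _.
  rewrite [col l Smx k 0]mxE real_normK ?num_real//; case: ifP => // _.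
  exact: sqr_ge0.
rewrite -mulrA; apply: ler_pM; [exact: ler0n| |exact: sparse|exact: h1].
by apply: sumr_ge0 => k _; exact: sqr_ge0.
Qed.

(** If no entry of the Gram matrix or of the cross products deviates, the deterministic bound holds
    for all columns at once. The two families of entries form a sum type, whose cardinality is the
    factor in the union bound. *)
Lemma lasso_error_probability : eta * (s * K / c + 2) <= lambda / 2 ->
  64 * s * eta <= c ->
  (P [set w | exists l, (192 * s * lambda / c < norm1 (col l (St w) - col l Smx))%R] <=
   (((p * d) * (p * d) + (p * d) * d)%:R * deviation_bound)%:E)%E.
Proof.
move=> eta_lambda eta_c.
pose E (i : ('I_(p * d) * 'I_(p * d) + 'I_(p * d) * 'I_d)%type) : set Omega :=
  match i with
  | inl kl => [set w | T%:R * eta <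
      `|((W w)^T *m W w) kl.1 kl.2 - (T - p)%:R * G kl.1 kl.2|]
  | inr kl => [set w | T%:R * eta <
      `|((W w)^T *m y kl.2 w) kl.1 0 - (T - p)%:R * (G *m Smx) kl.1 kl.2|]
  end.
have -> : ((p * d) * (p * d) + (p * d) * d)%N =
    #|{: ('I_(p * d) * 'I_(p * d) + 'I_(p * d) * 'I_d)%type}|.
  by rewrite card_sum !card_prod !card_ord.
have mz t k : measurable_fun setT (fun w => lag_vector p x t w k 0).
  by case/mxvec_indexP: k => a i; under eq_fun do rewrite lag_vectorE; exact: measurable_x.
apply: (@probability_union_le _ _ _ P _ E).
- have mW r k : measurable_fun setT (fun w => W w r k).
    by under eq_fun do rewrite mxE; exact: mz.
  have my l r : measurable_fun setT (fun w => y l w r 0).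
    by under eq_fun do rewrite mxE; exact: measurable_x.
  case=> -[k l] /=; apply: measurable_superlevel; apply: measurableT_comp => //;
    apply: measurable_funB => //; under eq_fun do rewrite mxE;
    apply: measurable_sum => r; apply: measurable_funM => //;
    by under eq_fun do rewrite mxE; exact: mW.
- by apply: measurable_exists_superlevel => l; exact: measurable_norm1_col.
- move=> w /= [l]; apply: contraPP => noE; apply/negP; rewrite -leNgt.
  apply: (@lasso_sample_bound R _ _ T (W w) (y l w) G (col l Smx) (col l (St w))
    lambda c eta s (s * K / c + 1) (active Smx l)) => //.
  + by move=> k; rewrite finset.in_set negbK [col _ _ _ _]mxE => /eqP.
  + exact: coef_norm1_le.
  + have Gsym := Sigma0_sym model x_L2 x_var noise_var noise_uncorrelated stable.
    exact: symmetric_quad_lower Gsym eig.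
  + by move=> k k'; rewrite leNgt; apply/negP => h; apply: noE; exists (inl (k, k')).
  + move=> k; rewrite leNgt; apply/negP => h; apply: noE; exists (inr (k, l)) => /=.
    suff -> : (G *m Smx) k l = (G *m col l Smx) k 0 by [].
    by rewrite [LHS]mxE [RHS]mxE; apply: eq_bigr => j _; rewrite [col _ _ _ _]mxE.
  + by rewrite addrCA -[1 + 1]/(2).
- by case=> -[k l] /=; [exact: gram_deviation|exact: response_deviation].
Qed.

End sample_probability.

(** * Asymptotics *)

Lemma leq_double_sub (n k T : nat) : (n <= k)%N -> (k.*2 <= T)%N -> (T <= (T - n).*2)%N.
Proof. lia. Qed.

Section asymptotics.
Context (R : realType).

Lemma near_natr_powRN_le (theta eps : R) : 0 < theta -> 0 < eps ->
  \forall T \near \oo, (T%:R : R) `^ (- theta) < eps.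
Proof.
move=> theta0 eps0; near=> T.
have T0 : 0 < T%:R :> R.
  by near: T; exact: (cvgry_gt cvgr_idn).
have Tbig : eps^-1 `^ theta^-1 < T%:R by near: T; exact: (cvgry_gt cvgr_idn).
rewrite powRN invf_plt ?posrE ?powR_gt0//.
have eps1 : 0 <= eps^-1 by rewrite invr_ge0 ltW.
have -> : eps^-1 = (eps^-1 `^ theta^-1) `^ theta.
  by rewrite -powRrM mulVf ?powRr1// gt_eqF.
by apply: gt0_ltr_powR; rewrite ?nnegrE ?powR_ge0.
Unshelve. all: by end_near. Qed.

Lemma concentration_cst_ge0 (q : R) : 0 <= concentration_cst q.
Proof. by rewrite mulr_ge0 ?powR_ge0// mulr_ge0// expR_ge0. Qed.

Lemma rate_exponent_gt0 (m alpha_d alpha_l : R) : 8 < m ->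
  alpha_l < 1 / 2 - 4 * alpha_d / m ->
  0 < m / 2 * (1 - alpha_l) - m / 2 / 2 - alpha_d * 2.
Proof.
move=> m8; have m0 : 0 < m by lra.
rewrite -(ltr_pM2l m0) (_ : m * (1 / 2 - _) = m / 2 - 4 * alpha_d); last first.
  by field; rewrite gt_eqF.
lra.
Qed.

(** In the final exponent, [alpha_d * 2] counts entries, [q / 2] comes from the number of summands,
    and [- q * (1 - alpha_l)] from the deviation level [T * eta]. *)
Lemma deviation_bound_rate (p d T p0 : nat) (D q C Delta kappa alpha_d alpha_l eta : R) :
  (p <= p0)%N -> d%:R <= D * T%:R `^ alpha_d -> 2 < q -> (0 < T)%N ->
  0 < kappa -> T%:R * eta / 2 = kappa * T%:R `^ (1 - alpha_l) ->
  ((p * d) * (p * d) + (p * d) * d)%:R * deviation_bound p T q C Delta eta <=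
  (p0 * p0 + p0)%:R * D ^+ 2 *
    (concentration_cst q * ((2 * C * Delta) ^+ 2 + 1) `^ (q / 2) * kappa `^ (- q)) *
    T%:R `^ (alpha_d * 2 + q / 2 - q * (1 - alpha_l)).
Proof.
move=> pp0 dD q2 T0 kappa0 etaE; set V := (2 * C * Delta) ^+ 2.
have T0R : 0 < T%:R :> R by rewrite ltr0n.
have T1R : 1 <= T%:R :> R by rewrite ler1n.
have V0 : 0 <= V by exact: sqr_ge0.
have cst0 : 0 <= concentration_cst q by exact: concentration_cst_ge0.
have dd : (d * d)%:R <= D ^+ 2 * T%:R `^ (alpha_d * 2).
  rewrite natrM powRrM (_ : _ `^ 2 = (T%:R `^ alpha_d) ^+ 2) ?powR_mulrn ?powR_ge0//.
  by rewrite -exprMn expr2 ler_pM.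
have count : ((p * d) * (p * d) + (p * d) * d)%:R <=
    (p0 * p0 + p0)%:R * (D ^+ 2 * T%:R `^ (alpha_d * 2)).
  apply: (@le_trans _ _ ((p0 * p0 + p0)%:R * (d * d)%:R)); last by rewrite ler_wpM2l.
  rewrite -natrM ler_nat mulnACA mulnDl leq_add//; first by rewrite leq_mul// leq_mul.
  by rewrite -mulnA leq_mul.
rewrite /deviation_bound etaE -/V.
have base : (V * (T - p)%:R + 1) `^ (q / 2) <= (V + 1) `^ (q / 2) * T%:R `^ (q / 2).
  rewrite -powRM ?addr_ge0//; apply: ge0_ler_powR; rewrite ?nnegrE.
  - by lra.
  - by rewrite addr_ge0// mulr_ge0.
  - by rewrite mulr_ge0// addr_ge0.
  - rewrite mulrDl mul1r lerD// ler_wpM2l// ler_nat; exact: leq_subr.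
have kappaE : (kappa * T%:R `^ (1 - alpha_l)) `^ (- q) =
    kappa `^ (- q) * T%:R `^ (- (q * (1 - alpha_l))).
  by rewrite powRM ?(ltW kappa0) ?powR_ge0// -powRrM mulrN [q * _]mulrC.
rewrite kappaE.
rewrite [_ `^ (alpha_d * 2 + q / 2 - q * (1 - alpha_l))]powRD ?(gt_eqF T0R) ?implybT//.
rewrite [_ `^ (alpha_d * 2 + q / 2)]powRD ?(gt_eqF T0R) ?implybT//.
apply: (@le_trans _ _ ((p0 * p0 + p0)%:R * (D ^+ 2 * T%:R `^ (alpha_d * 2)) *
  (concentration_cst q * ((V + 1) `^ (q / 2) * T%:R `^ (q / 2)) *
   (kappa `^ (- q) * T%:R `^ (- (q * (1 - alpha_l))))))).
  apply: ler_pM => //.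
    by rewrite !mulr_ge0// powR_ge0.
  rewrite ler_wpM2r ?mulr_ge0 ?powR_ge0// ler_wpM2l//.
by rewrite le_eqVlt; apply/orP; left; apply/eqP; ring.
Qed.

End asymptotics.

Lemma ltr_norm_bigmax (R : realType) n (a : R) (f : 'I_n -> R) : 0 <= a ->
  (a < `|\big[Num.max/0]_(l < n) f l|) = [exists l, a < f l].
Proof.
move=> a0; rewrite ger0_norm ?bigmax_ge_id//; apply/idP/existsP => [|[l al]].
  apply: contraPP => noex; apply/negP; rewrite -leNgt; apply: bigmax_le => // l _.
  by rewrite leNgt; apply/negP => h; apply: noex; exists l.
by apply: (lt_le_trans al); exact: le_bigmax.
Qed.

Section dependence.
Context d' (Omega : measurableType d') (R : realType) (P : probability Omega R).
Variables (m alpha : R) (n : nat) (e : int -> Omega -> R).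
Variable g : int -> 'I_n -> seqR R -> R.
Hypothesis n0 : (0 < n)%N.

(** The supremum over an empty index set would be -oo; [n0] supplies a coordinate. *)
Lemma dependence_coef_ge0 j : (0 <= dependence_coef P m e g j)%E.
Proof.
pose i0 := Ordinal n0.
apply: (@le_trans _ _ (Lnorm (P \x P)%E m%:E (fun w : Omega * Omega =>
  (g 0 i0 (past e 0 w.1) - g 0 i0 (coupled_past e 0 j w))%:E))).
  exact: Lnorm_ge0.
by apply: ereal_sup_ubound; exists 0, i0.
Qed.

(** The term [k = 0] of the supremum has weight 1 and bounds the whole series, which makes every
    coefficient finite. *)
Lemma dependence_coef_summable (Delta : R) :
  (ereal_sup [set y | exists k : nat,
     y = ((1 + k%:R) `^ alpha)%:E * \sum_(k <= j <oo) dependence_coef P m e g j] <=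
   Delta%:E)%E ->
  exists delta : nat -> R, [/\ forall j, 0 <= delta j,
    forall j, (dependence_coef P m e g j <= (delta j)%:E)%E
    & forall k, \sum_(j < k) delta j <= Delta].
Proof.
move=> sup_le; have dep0 := dependence_coef_ge0.
have sum_le : (\sum_(0 <= j <oo) dependence_coef P m e g j <= Delta%:E)%E.
  apply: le_trans sup_le; apply: ereal_sup_ubound; exists 0%N.
  by rewrite addr0 powR1 mul1e.
have part_le k : (\sum_(0 <= j < k) dependence_coef P m e g j <= Delta%:E)%E.
  by apply: le_trans sum_le; exact: nneseries_lim_ge.
have fin j : dependence_coef P m e g j \is a fin_num.
  rewrite ge0_fin_numE//; apply: le_lt_trans (ltry Delta).
  apply: le_trans (part_le j.+1); rewrite big_nat_recr//= leeDr//.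
  by apply: sume_ge0.
exists (fun j => fine (dependence_coef P m e g j)); split => [j|j|k].
- exact: fine_ge0.
- by rewrite fineK.
- rewrite -lee_fin -sumEFin; under eq_bigr do rewrite fineK//.
  by rewrite -(big_mkord xpredT (dependence_coef P m e g)).
Qed.

End dependence.

Section selection.
Context (R : realType) (q d : nat) (S St : 'M[R]_(q, d)).

(** The l1 error bounds every entry: active entries stay above [2 * b - b], and the others stay
    below [b]. *)
Lemma thresholded_eq_active (b : R) l :
  (forall k, k \in active S l -> 2 * b < `|S k l|) ->
  norm1 (col l St - col l S) < b -> thresholded b St l = active S l.
Proof.
move=> signal err; apply/setP => k; rewrite finset.in_set.
have entry : `|St k l - S k l| < b.
  apply: le_lt_trans err; rewrite /norm1 (bigD1 k)//= !mxE.
  by rewrite lerDl sumr_ge0.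
have [kB|kB] := boolP (k \in active S l).
  have := signal _ kB; have := ler_distD (S k l) 0 (St k l).
  have := ler_normB (St k l) (St k l - S k l).
  rewrite opprB addrC subrK => h _ h'; lra.
move: kB; rewrite finset.in_set negbK => /eqP S0; apply/negbTE; rewrite -leNgt.
by move: entry; rewrite S0 subr0 => /ltW.
Qed.

End selection.

Theorem theorem2 (R : realType)
  (disp : nat -> measure_display) (Omega : forall T, measurableType (disp T))
  (P : forall T, probability (Omega T) R)
  (d p : nat -> nat)
  (x eps : forall T, int -> Omega T -> 'cV[R]_(d T))
  (A : forall T, 'I_(p T) -> 'M[R]_(d T))
  (Sigma_eps : forall T, 'M[R]_(d T))
  (Smx := fun T => coef_mx (A T))
  (B := fun T => active (Smx T))
  (lambda b : nat -> R)
  (Stilde : forall T, Omega T -> 'M[R]_(p T * d T, d T))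
  (Btilde := fun T w => thresholded (b T) (Stilde T w))
  (m alpha alpha_d c_lambda alpha_lambda c c' : R)
  (model : forall T t w,
     x T t w = \sum_(j < p T) A T j *m x T (t - j.+1%:Z) w + eps T t w)
  (noise_mean : forall T t i, ('E_(P T)[(fun w => eps T t w i 0)%R] = 0)%E)
  (noise_var : forall T t i j,
     ('E_(P T)[(fun w => eps T t w i 0 * eps T t w j 0)%R] = (Sigma_eps T i j)%:E)%E)
  (noise_uncorrelated : forall T t1 t2 i j, t1 <> t2 ->
     ('E_(P T)[(fun w => eps T t1 w i 0 * eps T t2 w j 0)%R] = 0)%E)
  (lasso_measurable : forall T k l,
     measurable_fun [set: Omega T] (fun w => Stilde T w k l))
  (lasso_argmin : forall T w l (s : 'cV[R]_(p T * d T)),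
     lasso_objective T (lambda T) (sample_column (p T) T (x T) l w)
       (design (p T) T (x T) w) (col l (Stilde T w)) <=
     lasso_objective T (lambda T) (sample_column (p T) T (x T) l w)
       (design (p T) T (x T) w) s)
  (x_srd : short_range_dependent m alpha P x)
  (m_gt8 : 8 < m) (alpha_gt1 : 1 < alpha)
  (p_bounded : (fun T => (p T)%:R : R) =O_\oo (fun=> 1 : R))
  (d_growth : (fun T => (d T)%:R : R) =O_\oo (fun T => T%:R `^ alpha_d : R))
  (alpha_d_ge0 : 0 <= alpha_d)
  (alpha_d_lt : alpha_d < m * alpha / (2 + 24 * alpha))
  (lambdaE : forall T, lambda T = c_lambda * T%:R `^ (- alpha_lambda))
  (c_lambda_gt0 : 0 < c_lambda)
  (alpha_lambda_gt0 : 0 < alpha_lambda)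
  (alpha_lambda_lt : alpha_lambda < 1 / 2 - 4 * alpha_d / m)
  (b_cvg0 : b @ \oo --> (0 : R))
  (b_lambda : (fun T => b T / lambda T) @ \oo --> +oo)
  (sparse : (fun T => (\max_(l < d T) #|B T l|)%:R : R) =O_\oo (fun=> 1 : R))
  (nonzero : forall T, (0 < \max_(l < d T) #|B T l|)%N)
  (signal : forall T l k, k \in B T l -> 2 * b T < `|Smx T k l|)
  (stable : forall T (a : R[i]),
     eigenvalue (map_mx (real_complex R) (Sdagger (Smx T))) a -> `|a| < 1)
  (c_gt0 : 0 < c)
  (Sigma0_eig : forall T (a : R),
     eigenvalue (Sigma0 (P T) (p T) (x T)) a -> c < a)
  (c'_gt0 : 0 < c')
  (Lambda_diag : \forall T \near \oo, forall l k, k \in B T l ->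
     c' < Lambda (P T) T (x T) (eps T) (Smx T) l l k k) :
  [/\ bigO_prob P (fun T w =>
        \big[Num.max/0]_(l < d T) norm1 (col l (Stilde T w) - col l (Smx T)))
        lambda,
      bigO_prob P (fun T w =>
        \big[Num.max/0]_(l < d T) norm2 (col l (Stilde T w) - col l (Smx T)))
        lambda
    & P T (\bigcup_(l in [set: 'I_(d T)])
             [set w | Btilde T w l != B T l]) @[T --> \oo] --> 0%E].
Proof.
have [e [g [[indep mg x_g] [_ norm_bounded dep_bounded]]]] := x_srd.
have [C0 near_C0] := norm_bounded; have [Delta near_Delta] := dep_bounded.
have /eqO_exP[s s_gt0 near_s] := sparse.
have /eqO_exP[pmax pmax_gt0 near_p] := p_bounded.
have /eqO_exP[D D_gt0 near_d] := d_growth.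
(* The constant [C0] of the O(1) condition carries no sign, hence the maximum with 0. [p0] is a
   natural number above the bound on [p]. *)
pose C := Num.max C0 0; pose q := m / 2; pose p0 := Num.bound pmax.
(* [L] exceeds the bound of [coef_norm1_le] by 1, as the noise estimate requires; [kappa] is chosen
   to make [T * eta / 2] equal to [kappa] times the power [1 - alpha_lambda] of [T]. *)
pose K := 1 + C `^ (2 * q); pose L := s * K / c + 2.
pose M := 192 * s / c; pose kappa := c_lambda / (4 * L).
have C_ge0 : 0 <= C by rewrite /C le_max lexx orbT.
have mq : m = 2 * q by rewrite /q; field.
have q2 : 2 < q by rewrite /q ltr_pdivlMr// (le_lt_trans _ m_gt8)// -natrM ler_nat.
have K_gt0 : 0 < K by rewrite /K ltr_wpDr ?powR_ge0.
have L_gt0 : 0 < L by rewrite /L ltr_wpDl// divr_ge0 ?mulr_ge0// ltW.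
have M_gt0 : 0 < M by exact: divr_gt0 (mulr_gt0 (ltr0Sn _ _) s_gt0) c_gt0.
have kappa_gt0 : 0 < kappa by rewrite /kappa divr_gt0// mulr_gt0.
(* A positive maximum over the columns requires a column. *)
have d_gt0 T : (0 < d T)%N.
  rewrite lt0n; apply: contraTneq (nonzero T) => dT0; rewrite -leqNgt.
  by apply/bigmax_leqP => -[l ld]; exfalso; rewrite dT0 in ld.
have lambda_gt0 T : (0 < T)%N -> 0 < lambda T.
  by move=> T0; rewrite lambdaE mulr_gt0// powR_gt0// ltr0n.
pose theta := q * (1 - alpha_lambda) - q / 2 - alpha_d * 2.
have theta_gt0 : 0 < theta.
  exact: rate_exponent_gt0.
pose err T w l := norm1 (col l (Stilde T w) - col l (Smx T)).
pose bad T := [set w | exists l, M * lambda T < err T w l].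
have tail (eps0 : R) : 0 < eps0 -> \forall T \near \oo, (P T (bad T) <= eps0%:E)%E.
  move=> eps0_gt0.
  pose H := (p0 * p0 + p0)%:R * D ^+ 2 *
    (concentration_cst q * ((2 * C * Delta) ^+ 2 + 1) `^ (q / 2) * kappa `^ (- q)).
  have H_ge0 : 0 <= H.
    apply: mulr_ge0; first by rewrite mulr_ge0 ?sqr_ge0.
    by rewrite !mulr_ge0 ?powR_ge0 ?concentration_cst_ge0.
  (* [H] is the factor in front of the vanishing power of [T]; [H + 1] is used to divide safely even
     if [H] is 0. *)
  have small : 0 < eps0 / (H + 1) by rewrite divr_gt0// ltr_wpDl.
  (* The threshold below which the power [- alpha_lambda] of [T] ensures [64 * s * eta <= c]. *)
  have small_eta : 0 < c * (2 * L) / (64 * s * c_lambda).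
    by rewrite divr_gt0// !mulr_gt0.
  near=> T.
  have T_gt0 : (0 < T)%N by near: T; exact: nbhs_infty_gt.
  have T_gt0R : 0 < T%:R :> R by rewrite ltr0n.
  have pp0 : (p T <= p0)%N.
    rewrite -(ler_nat R) ltW//.
    have h : `|(p T)%:R : R| <= pmax * `|1 : R| by near: T.
    apply: le_lt_trans (archi_boundP (ltW pmax_gt0)).
    by move: h; rewrite normr1 mulr1 ger0_norm.
  (* At least half of the [T] time points are then rows of the design. *)
  have T_ge : (p0.*2 <= T)%N by near: T; exact: nbhs_infty_ge.
  have dD : (d T)%:R <= D * T%:R `^ alpha_d.
    have h : `|(d T)%:R : R| <= D * `|T%:R `^ alpha_d : R| by near: T.
    by move: h; rewrite !ger0_norm ?powR_ge0.
  have sB l : #|active (Smx T) l|%:R <= s.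
    have h : `|(\max_(l < d T) #|B T l|)%:R : R| <= s * `|1 : R| by near: T.
    move: h; rewrite normr1 mulr1 ger0_norm//; apply: le_trans.
    by rewrite ler_nat (leq_bigmax l).
  have eta_small : T%:R `^ (- alpha_lambda) < c * (2 * L) / (64 * s * c_lambda).
    by near: T; exact: near_natr_powRN_le.
  have T_small : T%:R `^ (- theta) < eps0 / (H + 1).
    by near: T; exact: near_natr_powRN_le.
  have g_norm t i : (Lnorm (P T) (2 * q)%:E
      (fun w => (g T t i (past_rv (e T) t w))%:E) <= C%:E)%E.
    have h : (ereal_sup [set y | exists t i,
        y = Lnorm (P T) m%:E (fun w => (x T t w i 0)%:E)] <= C0%:E)%E by near: T.
    apply: (@le_trans _ _ C0%:E); last by rewrite lee_fin le_max lexx.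
    apply: le_trans h; apply: ereal_sup_ubound; exists t, i; rewrite -mq.
    by under eq_fun do rewrite -x_g.
  have [delta [delta_ge0 g_dep delta_sum]] : exists delta : nat -> R,
      [/\ forall j, 0 <= delta j,
          forall j, (dependence_coef (P T) (2 * q) (fun s => e T s) (g T) j <= (delta j)%:E)%E
        & forall k, \sum_(j < k) delta j <= Delta].
    rewrite -mq; apply: (dependence_coef_summable (alpha := alpha)); first exact: d_gt0.
    by near: T.
  (* The largest deviation for which the total noise [eta * L] stays within [lambda T / 2]. *)
  pose eta := lambda T / (2 * L).
  have eta_gt0 : 0 < eta by rewrite divr_gt0 ?lambda_gt0// mulr_gt0.
  have noise_varR t i j : \int[P T]_w (eps T t w i 0 * eps T t w j 0) = Sigma_eps T i j.
    by have := noise_var T t i j; rewrite unlock /Rintegral => ->.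
  have noise_uncorrelatedR t1 t2 i j : t1 <> t2 ->
      \int[P T]_w (eps T t1 w i 0 * eps T t2 w j 0) = 0.
    by move=> /(noise_uncorrelated T t1 t2 i j); rewrite unlock /Rintegral => ->.
  have etaL : eta * (s * K / c + 2) <= lambda T / 2.
    by rewrite -/L /eta le_eqVlt; apply/orP; left; apply/eqP; field; rewrite gt_eqF.
  have etac : 64 * s * eta <= c.
    rewrite /eta lambdaE.
    move: eta_small; rewrite ltr_pdivlMr ?mulr_gt0// => h.
    rewrite mulrA ler_pdivrMr ?mulr_gt0//; apply: ltW; apply: le_lt_trans h.
    by rewrite le_eqVlt; apply/orP; left; apply/eqP; ring.
  have Teta0 : 0 < T%:R * eta by rewrite mulr_gt0.
  have pT2 : (T <= (T - p T).*2)%N by exact: leq_double_sub pp0 T_ge.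
  have pT : (p T <= T)%N by apply: (leq_trans pp0); apply: leq_trans T_ge; rewrite -addnn leq_addr.
  have := lasso_error_probability (model T) noise_varR noise_uncorrelatedR (@stable T)
    (@x_g T) (indep T) (mg T) q2 C_ge0 g_norm g_dep delta_ge0 delta_sum pT Teta0 c_gt0
    (@Sigma0_eig T) s_gt0 sB (@lasso_measurable T) (@lasso_argmin T) (lambda_gt0 _ T_gt0)
    T_gt0 pT2 etaL etac.
  rewrite (_ : 192 * s * lambda T / c = M * lambda T); last by rewrite /M; ring.
  move=> h; apply: (le_trans h); rewrite lee_fin.
  apply: (@le_trans _ _ (H * T%:R `^ (- theta))).
    rewrite (_ : - theta = alpha_d * 2 + q / 2 - q * (1 - alpha_lambda)); last first.
      by rewrite /theta; ring.
    apply: deviation_bound_rate => //.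
    rewrite powRD ?(gt_eqF T_gt0R) ?implybT// powRr1 ?ltW// /eta lambdaE /kappa.
    by field; rewrite gt_eqF.
  move: T_small; rewrite ltr_pdivlMr ?ltr_wpDl// => h2; apply: ltW; apply: le_lt_trans h2.
  by rewrite mulrC ler_wpM2l ?powR_ge0// lerDl.
have bad_measurable T : measurable (bad T).
  by apply: measurable_exists_superlevel => l; exact: measurable_norm1_col.
have le_bad T E eps0 : measurable E -> E `<=` bad T ->
    (P T (bad T) <= eps0%:E)%E -> (P T E <= eps0%:E)%E.
  by move=> mE Ebad; apply: le_trans; apply: le_measure; rewrite ?inE.
split.
- move=> eps0 eps0_gt0; exists M => //; near=> T.
  have T_gt0 : (0 < T)%N by near: T; exact: nbhs_infty_gt.
  have Ml0 : 0 <= M * lambda T by rewrite ltW// mulr_gt0// lambda_gt0.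
  under eq_set do rewrite ltr_norm_bigmax//.
  have -> : [set w | [exists l, M * lambda T < err T w l]] = bad T.
    by apply/seteqP; split => w /existsP.
  by near: T; exact: tail.
- move=> eps0 eps0_gt0; exists M => //; near=> T.
  have T_gt0 : (0 < T)%N by near: T; exact: nbhs_infty_gt.
  have Ml0 : 0 <= M * lambda T by rewrite ltW// mulr_gt0// lambda_gt0.
  under eq_set do rewrite ltr_norm_bigmax//.
  have -> : [set w | [exists l, M * lambda T < norm2 (col l (Stilde T w) - col l (Smx T))]] =
      [set w | exists l, M * lambda T < norm2 (col l (Stilde T w) - col l (Smx T))].
    by apply/seteqP; split => w /existsP.
  apply: le_bad.
  + by apply: measurable_exists_superlevel => l; exact: measurable_norm2_col.
  + by move=> w [l h]; exists l; apply: lt_le_trans h _; exact: norm2_le_norm1.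
  + by near: T; exact: tail.
- have wrong_measurable T : measurable (\bigcup_(l in [set: 'I_(d T)])
      [set w | Btilde T w l != B T l]).
    apply: fin_bigcup_measurable => [|l _]; first exact: finite_finset.
    by apply: measurable_thresholded_neq => k; exact: lasso_measurable.
  apply/fine_cvgP; split; first by near=> T; exact: fin_num_measure.
  apply/cvgrPdist_le => eps0 eps0_gt0; near=> T.
  have T_gt0 : (0 < T)%N by near: T; exact: nbhs_infty_gt.
  (* Eventually the ratio of threshold to penalty exceeds [M]; outside the bad event every column
     error is then below the threshold, which gives exact recovery. *)
  have Mb : M * lambda T < b T.
    rewrite -ltr_pdivlMr ?lambda_gt0//; near: T; exact: (cvgry_gt b_lambda).
  rewrite sub0r normrN ger0_norm ?fine_ge0//= -lee_fin fineK ?fin_num_measure//.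
  apply: le_bad; [exact: wrong_measurable| |by near: T; exact: tail].
  move=> w [l _] /= wrong; apply: contrapT => no_bad; move/negP: wrong; apply; apply/eqP.
  apply: thresholded_eq_active; first by move=> k; exact: signal.
  apply: le_lt_trans Mb; rewrite leNgt; apply/negP => h; apply: no_bad; by exists l.
Unshelve. all: by end_near. Qed.
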